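(* Let $0<\alpha<2$. Each of the following operators is bounded on the weighted Dirichlet space $\mathcal{D}_\alpha$: $$\mathcal{C}(f)(z)=\frac{1}{z}\int_0^z\frac{f(\zeta)}{1-\zeta}\,d\zeta,\qquad \mathcal{A}(f)(z)=\frac{1}{z-1}\int_1^z f(\zeta)\,d\zeta,\qquad \mathcal{J}(f)(z)=\frac{1}{z-1}\int_1^z\frac{f(\zeta)}{-1-\zeta}\,d\zeta,$$ $$\mathcal{H}(f)(z)=\int_0^1\frac{f(\zeta)}{1-\zeta z}\,d\zeta,\qquad \mathcal{H}_0(f)(z)=\frac12\int_{-1}^1\frac{f(\zeta)}{1-\zeta z}\,d\zeta .$$
   Context: $\mathbb{D}$ is the open unit disc in $\mathbb{C}$ and $m$ is area measure on $\mathbb{D}$. The weighted Dirichlet space $\mathcal{D}_\alpha$, $0<\alpha<2$, consists of the analytic functions $f$ in $\mathbb{D}$ with $$\|f\|_{\mathcal{D}_\alpha}^2=|f(0)|^2+\iint_{\mathbb{D}}|f'(z)|^2(1-|z|)^\alpha\,dm(z)<\infty.$$ Here $z\in\mathbb{D}$, all integrals are along the straight line segments joining the indicated endpoints, and $\mathcal{C}(f)(0)$ is defined by continuity, i.e. $\mathcal{C}(f)(0)=f(0)$. *)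

(* Defs.v *)
From HB Require Import structures.
From mathcomp Require Import all_boot all_order all_algebra.
From mathcomp Require Import complex.
From mathcomp Require Import all_classical all_reals all_analysis measurable_realfun.

Set Implicit Arguments.
Unset Strict Implicit.
Unset Printing Implicit Defensive.

Import Order.TTheory GRing.Theory Num.Theory.
Import numFieldNormedType.Exports.

Local Open Scope classical_set_scope.
Local Open Scope complex_scope.
Local Open Scope ring_scope.

(* Functions on the unit disc are total functions C -> C of which only the
   values on the disc matter: every notion below depends on f only through
   its restriction to the disc.  [R[i]^o] is R[i] seen as a normed space over
   itself, so that [derivable] and [derive1] are complex differentiation. *)

Section Disc.
Context {R : realType}.
Implicit Types (f g : R[i]^o -> R[i]^o) (z a b : R[i]).

(* The modulus as an element of R (the norm of R[i] takes values in R[i]). *)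
Definition cmod z : R := complex.Re `|z|.

Definition unit_disc : set R[i] := [set z | cmod z < 1].

Definition analytic_disc f : Prop :=
  forall z, unit_disc z -> derivable f z 1.

Definition area_measure :=
  (@lebesgue_measure R \x @lebesgue_measure R)%E.

Definition area_disc : set (R * R) := [set p | unit_disc (p.1 +i* p.2)].

(* ||f||^2, with values in [0, +oo]. *)
Definition dirichlet_norm2 (alpha : R) f : \bar R :=
  ((cmod (f 0) ^+ 2)%:E +
   \int[area_measure]_(p in area_disc)
     (cmod (derive1 f (p.1 +i* p.2)) ^+ 2
      * (1 - cmod (p.1 +i* p.2)) `^ alpha)%:E)%E.

Definition dirichlet (alpha : R) : set (R[i]^o -> R[i]^o) :=
  [set f | analytic_disc f /\ (dirichlet_norm2 alpha f < +oo)%E].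

(* Meaningful for f in [dirichlet alpha] ([fine] sends +oo to 0). *)
Definition dirichlet_norm (alpha : R) f : R :=
  Num.sqrt (fine (dirichlet_norm2 alpha f)).

Definition segment a b (t : R) : R[i] := a + t%:C * (b - a).

(* Absolute convergence of the integral of g along [a, b].  The parameter
   ranges over the open interval, since an endpoint of the segment may lie on
   the unit circle. *)
Definition segment_integrable g a b : Prop :=
  (@lebesgue_measure R).-integrable `]0, 1[
    (fun t => (complex.Re (g (segment a b t)))%:E) /\
  (@lebesgue_measure R).-integrable `]0, 1[
    (fun t => (complex.Im (g (segment a b t)))%:E).

Definition segment_integral g a b : R[i] :=
  (b - a) *
  ((\int[@lebesgue_measure R]_(t in `]0, 1[) complex.Re (g (segment a b t)))
   +i*
   (\int[@lebesgue_measure R]_(t in `]0, 1[) complex.Im (g (segment a b t)))).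

Definition opC_integrand f (w : R[i]) : R[i] := f w / (1 - w).
Definition opA_integrand f (w : R[i]) : R[i] := f w.
Definition opJ_integrand f (w : R[i]) : R[i] := f w / (- 1 - w).
Definition opH_integrand f z (w : R[i]) : R[i] := f w / (1 - w * z).

Definition opC f (z : R[i]) : R[i] :=
  if z == 0 then f 0 else z^-1 * segment_integral (opC_integrand f) 0 z.
Definition opA f (z : R[i]) : R[i] :=
  (z - 1)^-1 * segment_integral (opA_integrand f) 1 z.
Definition opJ f (z : R[i]) : R[i] :=
  (z - 1)^-1 * segment_integral (opJ_integrand f) 1 z.
Definition opH f (z : R[i]) : R[i] :=
  segment_integral (opH_integrand f z) 0 1.
Definition opH0 f (z : R[i]) : R[i] :=
  2^-1 * segment_integral (opH_integrand f z) (- 1) 1.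

(* The integrals defining an operator converge for all f in the space and all
   z in the disc. *)
Definition well_defined_on (alpha : R) (P : (R[i]^o -> R[i]^o) -> R[i] -> Prop)
    : Prop :=
  forall f z, dirichlet alpha f -> unit_disc z -> P f z.

Definition bounded_operator (alpha : R)
    (T : (R[i]^o -> R[i]^o) -> (R[i]^o -> R[i]^o)) : Prop :=
  [/\ forall f, dirichlet alpha f -> dirichlet alpha (T f),
      forall (c : R[i]) f g z,
        dirichlet alpha f -> dirichlet alpha g -> unit_disc z ->
        T (fun w => c * f w + g w) z = c * T f z + T g z
    & exists M : R, forall f, dirichlet alpha f ->
        dirichlet_norm alpha (T f) <= M * dirichlet_norm alpha f].

End Disc.

(* Main.v *)
(* Each operator has the form T f(z) = \int_0^1 f(g_z(t)) k_z(g_z(t)) dt for a segment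
   g_z, and so acts on Taylor coefficients by a matrix (t_nk) whose k-th column lists
   the coefficients of T(w^k).  In all five cases |t_nk| <= C / (max(n, k) + 1).
   Parseval's identity and the moments
   \int |z|^(2n) (1 - |z|)^alpha dm(z) ~ (n+1)^(-1-alpha) make ||f||^2 comparable to
   \sum_n (n+1)^(1-alpha) |a_n|^2, and since -1 < 1 - alpha < 1 the matrix is bounded
   for this norm by Schur's test. *)

Require Import Defs.
From mathcomp Require Import all_boot all_order all_algebra.
From mathcomp Require Import complex ring lra cyclic separable cyclotomic.
From mathcomp Require Import all_classical all_reals all_analysis measurable_realfun.
Import Order.TTheory GRing.Theory Num.Theory.
Import numFieldNormedType.Exports.
Local Open Scope classical_set_scope.
Local Open Scope complex_scope.
Local Open Scope ring_scope.

(** * Modulus and complex derivative *)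

(** The segments may reach the unit circle, where the Taylor series of f can diverge, so the
    delicate step is integrating that series term by term. Two facts allow it: sum |a_k|/(k+1) is
    finite on the space, by Cauchy-Schwarz and alpha < 2, and for each z the integral of |g_z(t)|^k
    over [0, 1] is O(1/(k+1)). The size of t_nk is visible for four operators: 1/(n+1) for k <= n
    and 0 otherwise (C), the transpose of this (A), 1/(n+k+1) (H), and half the integral of x^(n+k)
    over [-1, 1] (H_0). For J the entries obey a recurrence in k whose solution is (-1)^k u_max(n,k)
    with u_n = O(1/(n+1)). Analyticity is given only as complex differentiability, so Taylor
    expansions are derived from Goursat's lemma and Cauchy's formula. In place of polar coordinates,
    Parseval's identity comes from averaging over rotations by roots of unity, a rotation being a
    product of shears, and the moments come from the scaling of area. *)

Section Modulus.
Context {R : realType}.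
Implicit Types (z w : R[i]) (x y : R).

Lemma normC_cmod z : `|z| = (cmod z)%:C.
Proof. rewrite /cmod normc_def; reflexivity. Qed.

Lemma cmod_ge0 z : 0 <= cmod z.
Proof. rewrite -lecR -normC_cmod; exact: normr_ge0. Qed.

Lemma cmodM z w : cmod (z * w) = cmod z * cmod w.
Proof. by apply: complexI; rewrite rmorphM /= -!normC_cmod normrM. Qed.

Lemma cmodD z w : cmod (z + w) <= cmod z + cmod w.
Proof. rewrite -lecR rmorphD /= -!normC_cmod; exact: ler_normD. Qed.

Lemma cmodN z : cmod (- z) = cmod z.
Proof. by rewrite /cmod normrN. Qed.

Lemma cmodBC z w : cmod (z - w) = cmod (w - z).
Proof. by rewrite /cmod distrC. Qed.

Lemma cmod_triangle z w u : cmod (z - u) <= cmod (z - w) + cmod (w - u).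
Proof. by rewrite -[z - u](subrKA w) cmodD. Qed.

Lemma cmodB z w : cmod z <= cmod (z - w) + cmod w.
Proof. by rewrite -{1}(subrK w z) cmodD. Qed.

Lemma cmod0 : cmod (0 : R[i]) = 0.
Proof. by rewrite /cmod normr0. Qed.

Lemma cmod1 : cmod (1 : R[i]) = 1.
Proof. by rewrite /cmod normr1. Qed.

Lemma cmodX z n : cmod (z ^+ n) = cmod z ^+ n.
Proof. by elim: n => [|n IH]; rewrite ?expr0 ?cmod1// !exprS cmodM IH. Qed.

Lemma cmodV z : cmod z^-1 = (cmod z)^-1.
Proof. by apply: complexI; rewrite fmorphV /= -!normC_cmod normfV. Qed.

Lemma cmod_eq0 z : (cmod z == 0) = (z == 0).
Proof. by rewrite -[RHS]normr_eq0 normC_cmod -(inj_eq (@complexI R)). Qed.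

Lemma cmod_gt0 z : (0 < cmod z) = (z != 0).
Proof. by rewrite lt0r cmod_eq0 cmod_ge0 andbT. Qed.

Lemma cmodR x : cmod (x%:C) = `|x|.
Proof. by rewrite /cmod normc_def /= expr0n addr0 sqrtr_sqr. Qed.

Lemma cmodn n : cmod (n%:R : R[i]) = n%:R.
Proof. by rewrite -[n%:R](rmorph_nat (real_complex R)) /= cmodR normr_nat. Qed.

Lemma cmod_sqr z : cmod z ^+ 2 = complex.Re z ^+ 2 + complex.Im z ^+ 2.
Proof. by rewrite /cmod normc_def sqr_sqrtr // addr_ge0 // sqr_ge0. Qed.

Lemma cmod_sum (I : Type) (r : seq I) (P : pred I) (F : I -> R[i]) :
  cmod (\sum_(i <- r | P i) F i) <= \sum_(i <- r | P i) cmod (F i).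
Proof.
elim/big_ind2 : _ => [|z x w y zx wy|//]; first by rewrite cmod0.
exact: le_trans (cmodD _ _) (lerD zx wy).
Qed.

Lemma ler_Re_cmod z : `|complex.Re z| <= cmod z.
Proof.
rewrite -(ler_pXn2r (n := 2)) ?nnegrE ?cmod_ge0 //.
by rewrite real_normK ?num_real // cmod_sqr lerDl sqr_ge0.
Qed.

Lemma ler_Im_cmod z : `|complex.Im z| <= cmod z.
Proof.
rewrite -(ler_pXn2r (n := 2)) ?nnegrE ?cmod_ge0 //.
by rewrite real_normK ?num_real // cmod_sqr lerDr sqr_ge0.
Qed.

Lemma ler_cmod_ReIm z : cmod z <= `|complex.Re z| + `|complex.Im z|.
Proof.
rewrite -(ler_pXn2r (n := 2)) ?nnegrE ?cmod_ge0 ?addr_ge0 //.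
rewrite cmod_sqr sqrrD !real_normK ?num_real //.
by rewrite -addrA lerD2l lerDr mulrn_wge0 // mulr_ge0.
Qed.

Lemma cReD z w : complex.Re (z + w) = complex.Re z + complex.Re w.
Proof. by case: z; case: w. Qed.
Lemma cImD z w : complex.Im (z + w) = complex.Im z + complex.Im w.
Proof. by case: z; case: w. Qed.
Lemma cReN z : complex.Re (- z) = - complex.Re z.
Proof. by case: z. Qed.
Lemma cImN z : complex.Im (- z) = - complex.Im z.
Proof. by case: z. Qed.
Lemma cReM z w : complex.Re (z * w) =
  complex.Re z * complex.Re w - complex.Im z * complex.Im w.
Proof. by case: z; case: w. Qed.
Lemma cImM z w : complex.Im (z * w) =
  complex.Re z * complex.Im w + complex.Im z * complex.Re w.
Proof. by case: z; case: w. Qed.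

Lemma eq_ReIm z w : complex.Re z = complex.Re w -> complex.Im z = complex.Im w ->
  z = w.
Proof. by case: z; case: w => ? ? ? ? /= -> ->. Qed.

End Modulus.

(** Multiplying the difference quotient by the increment removes the division and the excluded
    point. The field is kept general because the statement serves both for derivatives over [R[i]]
    and over [R]. *)
Lemma difference_quotientP (K : numFieldType) (f : K^o -> K^o) (z d : K) :
  ((fun h : K^o => h^-1 *: (f (h *: (1 : K^o) + z) - f z)) @ (0 : K^o)^' --> (d : K^o)) <->
  (forall e : K, 0 < e -> exists2 r : K, 0 < r & forall w, `|w - z| < r ->
     `|f w - f z - d * (w - z)| <= e * `|w - z|).
Proof.
have E (h : K) : h != 0 -> d - h^-1 *: (f (h *: (1 : K^o) + z) - f z) =
    - h^-1 * (f (h + z) - f z - d * h).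
  move=> h0; have -> : h *: (1 : K^o) = h by rewrite /GRing.scale /= mulr1.
  by rewrite /GRing.scale /=; field.
split=> [H e e0|H].
- have [r /= r0 Hr] := (cvgrPdist_le _ _).1 H _ e0.
  exists r => // w wr; have [->|wz] := eqVneq w z.
    by rewrite !subrr mulr0 subrr normr0 mulr0.
  have wz0 : w - z != 0 by rewrite subr_eq0.
  have := Hr (w - z); rewrite /= sub0r normrN => /(_ wr wz0).
  by rewrite E // subrK normrM normrN normfV ler_pdivrMl ?normr_gt0 // [leRHS]mulrC.
- apply/cvgrPdist_le => e e0; have [r r0 Hr] := H _ e0.
  exists r => // h /=; rewrite sub0r normrN => hr h0.
  have {}Hr := Hr (h + z); rewrite addrK in Hr.
  by rewrite E // normrM normrN normfV ler_pdivrMl ?normr_gt0 // [leRHS]mulrC Hr.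
Qed.

Section Cdiff.
Context {R : realType}.
Implicit Types (f g : R[i] -> R[i]) (z w d : R[i]).

Definition ccont_at f z := forall e : R, 0 < e -> exists2 r : R, 0 < r &
  forall w, cmod (w - z) < r -> cmod (f w - f z) <= e.

(** First-order expansion with real radii and errors; by [cdiffP] it is complex differentiability at
    z with derivative d. *)
Definition cdiff f z d := forall e : R, 0 < e -> exists2 r : R, 0 < r &
  forall w, cmod (w - z) < r ->
    cmod (f w - f z - d * (w - z)) <= e * cmod (w - z).

Lemma cdiffP f z d : cdiff f z d <->
  ((fun h : R[i]^o => h^-1 *: ((f : R[i]^o -> R[i]^o) (h *: (1 : R[i]^o) + z) - f z))
     @ (0 : R[i]^o)^' --> (d : R[i]^o)).
Proof.
rewrite difference_quotientP; split=> H e e0.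
- have [r r0 Hr] : exists2 r : R, 0 < r & forall w, cmod (w - z) < r ->
      cmod (f w - f z - d * (w - z)) <= cmod e * cmod (w - z).
    by apply: H; rewrite cmod_gt0 gt_eqF.
  exists r%:C => [|w]; first by rewrite ltcR.
  rewrite normC_cmod ltcR => /Hr; rewrite -lecR rmorphM /= -!normC_cmod.
  by rewrite (gtr0_norm e0).
- have [|r r0 Hr] := H e%:C; first by rewrite ltcR.
  exists (cmod r) => [|w]; first by rewrite cmod_gt0 gt_eqF.
  rewrite -ltcR -!normC_cmod (gtr0_norm r0) => /Hr.
  by rewrite !normC_cmod -rmorphM lecR.
Qed.

Lemma cdiff_derivable f z d : cdiff f z d ->
  derivable (f : R[i]^o -> R[i]^o) z 1 /\ derive1 (f : R[i]^o -> R[i]^o) z = d.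
Proof.
move=> /cdiffP H; split; first by apply/cvg_ex; exists d.
by rewrite derive1E; apply: cvg_lim H; exact: norm_hausdorff.
Qed.

Lemma derivable_cdiff f z : derivable (f : R[i]^o -> R[i]^o) z 1 ->
  exists d, cdiff f z d.
Proof. by move=> /cvg_ex [d Hd]; exists d; apply/cdiffP. Qed.

Lemma cdiff_uniq f z d d' : cdiff f z d -> cdiff f z d' -> d = d'.
Proof. by move=> /cdiff_derivable [_ <-] /cdiff_derivable [_ <-]. Qed.

Lemma cdiff_cont f z d : cdiff f z d -> ccont_at f z.
Proof.
move=> H e e0; have [r r0 Hr] := H 1 ltr01.
have K0 : 0 < 1 + cmod d by rewrite ltr_pwDl ?cmod_ge0.
exists (Num.min r (e / (1 + cmod d))); first by rewrite lt_min r0 divr_gt0.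
move=> w; rewrite lt_min => /andP[wr we].
rewrite -(subrK (d * (w - z)) (f w - f z)).
apply: le_trans (cmodD _ _) _.
apply: (@le_trans _ _ ((1 + cmod d) * cmod (w - z))).
  by rewrite mulrDl cmodM lerD2r Hr.
by rewrite mulrC -ler_pdivlMr // ltW.
Qed.

Lemma cdiff_ext f g z d (r : R) : 0 < r ->
  (forall w, cmod (w - z) < r -> f w = g w) -> cdiff f z d -> cdiff g z d.
Proof.
move=> r0 fg H e e0; have [r' r'0 Hr] := H e e0.
exists (Num.min r r'); first by rewrite lt_min r0.
move=> w; rewrite lt_min => /andP[wr wr'].
by rewrite -!fg ?subrr ?cmod0 //; exact: Hr.
Qed.

Lemma cdiffD f g z d d' : cdiff f z d -> cdiff g z d' ->
  cdiff (fun w => f w + g w) z (d + d').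
Proof.
move=> Hf Hg e e0; have e20 : 0 < e / 2 by rewrite divr_gt0.
have [r r0 Hr] := Hf _ e20; have [r' r'0 Hr'] := Hg _ e20.
exists (Num.min r r'); first by rewrite lt_min r0.
move=> w; rewrite lt_min => /andP[wr wr'].
have -> : f w + g w - (f z + g z) - (d + d') * (w - z) =
  (f w - f z - d * (w - z)) + (g w - g z - d' * (w - z)) by ring.
apply: le_trans (cmodD _ _) _.
rewrite [e]splitr mulrDl; exact: lerD (Hr _ wr) (Hr' _ wr').
Qed.

Lemma cdiff_cst c z : cdiff (fun=> c) z 0.
Proof.
move=> e e0; exists 1 => // w _.
by rewrite subrr mul0r subrr cmod0 mulr_ge0 ?cmod_ge0 // ltW.
Qed.

Lemma cdiff_id z : cdiff id z 1.
Proof.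
move=> e e0; exists 1 => // w _.
by rewrite mul1r subrr cmod0 mulr_ge0 ?cmod_ge0 // ltW.
Qed.

Lemma cdiffM f g z d d' : cdiff f z d -> cdiff g z d' ->
  cdiff (fun w => f w * g w) z (d * g z + f z * d').
Proof.
move=> Hf Hg e e0.
(* K collects the coefficients of the four error terms below, so that their sum is at most e' * K *
   |w - z|; the factor 3 in e' is slack. *)
set K := cmod (g z) + cmod (f z) + cmod d + 1.
have K0 : 0 < K by rewrite ltr_wpDl ?addr_ge0 ?cmod_ge0.
have eK : 0 < e / (3 * K) by rewrite divr_gt0 ?mulr_gt0.
set e' := Num.min 1 (e / (3 * K)).
have e'0 : 0 < e' by rewrite lt_min eK ltr01.
have [r r0 Hr] := Hf _ e'0; have [r' r'0 Hr'] := Hg _ e'0.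
have [r2 r20 Hr2] := cdiff_cont _ _ _ Hg _ e'0.
exists (Num.min r (Num.min r' r2)); first by rewrite !lt_min r0 r'0.
move=> w; rewrite !lt_min => /andP[wr /andP[wr' wr2]].
have {}Hr := Hr _ wr; have {}Hr' := Hr' _ wr'; have {}Hr2 := Hr2 _ wr2.
have -> : f w * g w - f z * g z - (d * g z + f z * d') * (w - z) =
  (f w - f z - d * (w - z)) * (g w - g z) + d * (w - z) * (g w - g z) +
  (f w - f z - d * (w - z)) * g z + f z * (g w - g z - d' * (w - z)) by ring.
set m := cmod (w - z) in Hr Hr' *.
have m0 : 0 <= m := cmod_ge0 _.
have e'1 : e' <= 1 by rewrite ge_min lexx.
have e'K : e' * K <= e / 3.
  by rewrite -ler_pdivlMr // -mulrA -invfM ge_min lexx orbT.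
apply: le_trans (cmodD _ _) _; apply: le_trans (lerD (cmodD _ _) (lexx _)) _.
apply: le_trans (lerD (lerD (cmodD _ _) (lexx _)) (lexx _)) _.
rewrite !cmodM -/m.
have h1 : cmod (f w - f z - d * (w - z)) * cmod (g w - g z) <= e' * m * 1.
  by apply: ler_pM => //; rewrite ?cmod_ge0 // (le_trans Hr2).
have h2 : cmod d * m * cmod (g w - g z) <= cmod d * m * e'.
  by apply: ler_wpM2l => //; rewrite mulr_ge0 ?cmod_ge0.
have h3 : cmod (f w - f z - d * (w - z)) * cmod (g z) <= e' * m * cmod (g z).
  by apply: ler_wpM2r => //; rewrite cmod_ge0.
have h4 : cmod (f z) * cmod (g w - g z - d' * (w - z)) <= cmod (f z) * (e' * m).
  by apply: ler_wpM2l => //; rewrite cmod_ge0.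
apply: (@le_trans _ _ (e' * K * m)).
  by rewrite /K; lra.
apply: ler_wpM2r => //; apply: le_trans e'K _; lra.
Qed.

Lemma ccontD f g z : ccont_at f z -> ccont_at g z ->
  ccont_at (fun w => f w + g w) z.
Proof.
move=> Hf Hg e e0; have e20 : 0 < e / 2 by rewrite divr_gt0.
have [r r0 Hr] := Hf _ e20; have [r' r'0 Hr'] := Hg _ e20.
exists (Num.min r r'); first by rewrite lt_min r0.
move=> w; rewrite lt_min => /andP[wr wr'].
rewrite opprD addrACA [e]splitr.
exact: le_trans (cmodD _ _) (lerD (Hr _ wr) (Hr' _ wr')).
Qed.

End Cdiff.

(** * Convergent series of complex numbers *)

Section ComplexSeries.
Context {R : realType}.
Implicit Types (u v c : nat -> R[i]) (s z w : R[i]).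

Definition has_csum u s : Prop :=
  (fun N => cmod (\sum_(n < N) u n - s)) @ \oo --> (0 : R).

Lemma has_csumP u s : has_csum u s <-> forall e : R, 0 < e ->
  exists N0, forall N, (N0 <= N)%N -> cmod (\sum_(n < N) u n - s) <= e.
Proof.
split=> [/cvgrPdist_le H e /H[N0 _ HN]|H].
  exists N0 => N /HN; rewrite /= sub0r normrN ger0_norm //; exact: cmod_ge0.
apply/cvgrPdist_le => e /H[N0 HN]; exists N0 => // N /HN.
by rewrite /= sub0r normrN ger0_norm //; exact: cmod_ge0.
Qed.

Lemma has_csum_squeeze u s (b : nat -> R) : b @ \oo --> (0 : R) ->
  (forall N, cmod (\sum_(n < N) u n - s) <= b N) -> has_csum u s.
Proof.
move=> b0 H; apply: (squeeze_cvgr _ (cvg_cst 0) b0).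
by apply: nearW => N; rewrite cmod_ge0 H.
Qed.

(** Closed discs are closed under limits. With a partial sum for w this yields the tail
    estimates. *)
Lemma has_csum_bound M u s w K : has_csum u s ->
  (forall N, (M <= N)%N -> cmod (\sum_(n < N) u n - w) <= K) -> cmod (s - w) <= K.
Proof.
move=> /has_csumP H HK; apply/ler_addgt0Pl => e /H[N0 HN].
apply: le_trans (cmod_triangle _ (\sum_(n < maxn N0 M) u n) _) _.
by rewrite cmodBC lerD // ?HN ?HK ?leq_maxl ?leq_maxr.
Qed.

Lemma has_csum_le u s K : has_csum u s ->
  (forall N, \sum_(n < N) cmod (u n) <= K) -> cmod s <= K.
Proof.
move=> H HK; rewrite -[s]subr0; apply: (has_csum_bound 0 _ _ _ _ H) => N _.
by rewrite subr0; apply: le_trans (cmod_sum _ _ _ _) (HK N).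
Qed.

Lemma has_csum_uniq u s s' : has_csum u s -> has_csum u s' -> s = s'.
Proof.
move=> H /has_csumP H'; apply/eqP; rewrite -subr_eq0 -cmod_eq0 eq_le cmod_ge0 andbT.
apply/ler_addgt0Pl => e e0; rewrite addr0; have e20 := divr_gt0 e0 (ltr0n R 2).
have [N0 HN] := H' _ e20; have [N1 HN1] := (has_csumP _ _).1 H _ e20.
apply: le_trans (cmod_triangle _ (\sum_(n < maxn N0 N1) u n) _) _.
rewrite [e]splitr cmodBC; apply: lerD.
  by apply: HN1; exact: leq_maxr.
by apply: HN; exact: leq_maxl.
Qed.

Lemma eq_has_csum u v s : u =1 v -> has_csum u s -> has_csum v s.
Proof. by move=> /funext ->. Qed.

Lemma has_csumD u v s s' : has_csum u s -> has_csum v s' ->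
  has_csum (fun n => u n + v n) (s + s').
Proof.
move=> H H'; apply: (has_csum_squeeze _ _
  (fun N => cmod (\sum_(n < N) u n - s) + cmod (\sum_(n < N) v n - s'))).
  by rewrite -[X in _ --> X]addr0; exact: cvgD.
by move=> N; rewrite big_split /= opprD addrACA cmodD.
Qed.

Lemma has_csumZ a u s : has_csum u s -> has_csum (fun n => a * u n) (a * s).
Proof.
move=> H; apply: (has_csum_squeeze _ _
  (fun N => cmod a * cmod (\sum_(n < N) u n - s))).
  by rewrite -[X in _ --> X](mulr0 (cmod a)); exact: cvgMr.
by move=> N; rewrite -mulr_sumr -mulrBr cmodM.
Qed.

Lemma has_csum_shift u s : has_csum (fun n => u n.+1) s <-> has_csum u (u 0%N + s).
Proof.
split=> H.
  rewrite /has_csum -cvg_shiftS /=; apply: cvg_trans H; apply: near_eq_cvg.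
  by apply: nearW => N; rewrite big_ord_recl opprD addrACA subrr add0r.
move: H; rewrite /has_csum -cvg_shiftS /=; apply: cvg_trans; apply: near_eq_cvg.
by apply: nearW => N; rewrite big_ord_recl opprD addrACA subrr add0r.
Qed.

Lemma cvg_has_csum u s :
  (fun N => complex.Re (\sum_(n < N) u n)) @ \oo --> complex.Re s ->
  (fun N => complex.Im (\sum_(n < N) u n)) @ \oo --> complex.Im s ->
  has_csum u s.
Proof.
move=> hR hI; apply/has_csumP => e e0; have e20 := divr_gt0 e0 (ltr0n R 2).
move/cvgrPdistC_le : hR => /(_ _ e20)[N0 _ H0].
move/cvgrPdistC_le : hI => /(_ _ e20)[N1 _ H1].
exists (maxn N0 N1) => N; rewrite geq_max => /andP[/H0 h0 /H1 h1].
apply: le_trans (ler_cmod_ReIm _) _; rewrite [e]splitr cReD cReN cImD cImN.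
exact: lerD h0 h1.
Qed.

Lemma has_csum_cmod2 u s : has_csum u s ->
  (fun N => cmod (\sum_(n < N) u n) ^+ 2) @ \oo --> cmod s ^+ 2.
Proof.
move=> H; have h : (fun N => cmod (\sum_(n < N) u n)) @ \oo --> cmod s.
  apply/cvgrPdist_le => e e0; have [N0 HN] := (has_csumP _ _).1 H e e0.
  exists N0 => // N /HN; move: (\sum_(_ < _) _) => x h; apply: le_trans h.
  rewrite ler_norml; apply/andP; split; first by have := cmodB x s; lra.
  by have := cmodB s x; rewrite (cmodBC s); lra.
by rewrite expr2; under eq_fun do rewrite expr2; exact: cvgM.
Qed.

Lemma has_csum_at0 c s : has_csum (fun n => c n * 0 ^+ n) s -> s = c 0%N.
Proof.
move=> H; apply: has_csum_uniq H _.
apply: (has_csum_squeeze _ _ (fun N => (N == 0%N)%:R * cmod (c 0%N))).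
  rewrite -cvg_shiftS /=; under eq_fun do rewrite mul0r; exact: (cvg_cst (0:R)).
case=> [|N]; first by rewrite big_ord0 sub0r cmodN mul1r.
rewrite big_ord_recl expr0 mulr1 big1 ?addr0 ?subrr ?cmod0 ?mul0r // => i _.
by rewrite expr0n mulr0.
Qed.

Lemma cvg_nonneg_series (p : nat -> R) K : (forall n, 0 <= p n) ->
  (forall N, \sum_(n < N) p n <= K) ->
  exists2 l, (fun N => \sum_(n < N) p n) @ \oo --> l &
    forall N, \sum_(n < N) p n <= l.
Proof.
move=> p0 pK; pose S N := \sum_(n < N) p n.
have nd : {homo S : n m / (n <= m)%N >-> n <= m}.
  move=> n m nm; rewrite /S -!(big_mkord xpredT p).
  by rewrite [leRHS](big_cat_nat (leq0n n) nm) //= lerDl sumr_ge0.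
have cv : S @ \oo --> sup (range S).
  by apply: nondecreasing_cvgn => //; exists K => _ [M _ <-]; exact: pK.
exists (sup (range S)) => // N; rewrite -(cvg_lim (@Rhausdorff R) cv).
by apply: nondecreasing_cvgn_le => //; apply/cvg_ex; exists (sup (range S)).
Qed.

(** The real and imaginary parts are dominated by the modulus, so both real series converge
    absolutely. *)
Lemma has_csum_abs u K : (forall N, \sum_(n < N) cmod (u n) <= K) ->
  exists s, has_csum u s.
Proof.
move=> HK.
have aux (p : R[i] -> R) : (forall z, `|p z| <= cmod z) ->
    cvgn (series (fun n => p (u n))).
  move=> hp; apply: normed_cvg; apply: nondecreasing_is_cvgn.
    by apply: nondecreasing_series => n _ _; exact: normr_ge0.
  exists K => _ [N _ <-]; rewrite /= /series /= big_mkord.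
  by apply: le_trans (HK N); apply: ler_sum => n _; exact: hp.
have /cvg_ex[l1 h1] := aux (@complex.Re R) (@ler_Re_cmod R).
have /cvg_ex[l2 h2] := aux (@complex.Im R) (@ler_Im_cmod R).
exists (l1 +i* l2); apply: cvg_has_csum.
  rewrite (_ : (fun N => _) = series (fun n => complex.Re (u n))) //.
  apply/funext => N; rewrite /series /= big_mkord.
  by elim/big_ind2 : _ => // x x' y y' <- <-; rewrite cReD.
rewrite (_ : (fun N => _) = series (fun n => complex.Im (u n))) //.
apply/funext => N; rewrite /series /= big_mkord.
by elim/big_ind2 : _ => // x x' y y' <- <-; rewrite cImD.
Qed.

(** Completeness in the form that a sequence of triangles halving in size requires: the increments
    sum absolutely, and the tail from n on telescopes to at most K / 2^n. *)
Lemma cgeometric_limit (x : nat -> R[i]) (K : R) :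
  (forall n, cmod (x n.+1 - x n) <= K / 2 ^+ n.+1) ->
  exists l, forall n, cmod (x n - l) <= K / 2 ^+ n.
Proof.
move=> H; pose d n := x n.+1 - x n.
have half n : K / 2 ^+ n = K / 2 ^+ n.+1 + K / 2 ^+ n.+1 by rewrite exprS; field.
have K0 : 0 <= K.
  by have := le_trans (cmod_ge0 _) (H 0%N); rewrite pmulr_lge0 // invr_gt0.
have pos n : 0 <= K / 2 ^+ n by rewrite divr_ge0 // exprn_ge0.
have sum0 N : \sum_(n < N) d n = x N - x 0%N.
  elim: N => [|N IH]; first by rewrite big_ord0 subrr.
  by rewrite big_ord_recr /= IH /d addrC addrA subrK.
have [|s hs] := has_csum_abs d K.
  move=> N; suff : \sum_(n < N) cmod (d n) <= K - K / 2 ^+ N by have := pos N; lra.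
  elim: N => [|N IH]; first by rewrite big_ord0 expr0 divr1 subrr.
  by rewrite big_ord_recr /=; have := H N; have := half N; rewrite -/(d N); lra.
exists (s + x 0%N) => n; rewrite cmodBC.
have -> : s + x 0%N - x n = s - (x n - x 0%N) by ring.
apply: (has_csum_bound n _ _ _ _ hs) => N nN; rewrite sum0.
have -> : x N - x 0%N - (x n - x 0%N) = x N - x n by ring.
suff h m : cmod (x (n + m)%N - x n) <= K / 2 ^+ n - K / 2 ^+ (n + m).
  by have := h (N - n)%N; rewrite subnKC //; have := pos N; lra.
elim: m => [|m IH]; first by rewrite addn0 !subrr cmod0.
apply: le_trans (cmod_triangle _ (x (n + m)%N) _) _.
by rewrite addnS; have := H (n + m)%N; have := half (n + m)%N; lra.
Qed.

End ComplexSeries.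

(** * Integrals of complex functions over [0, 1] *)

Section RealFTC.
Context {R : realType}.
Notation mu := (@lebesgue_measure R).

Lemma derive1_epsP (F : R -> R) (t d : R) :
  (derivable F t 1 /\ derive1 F t = d) <->
  (forall e : R, 0 < e -> exists2 r : R, 0 < r & forall s, `|s - t| < r ->
     `|F s - F t - d * (s - t)| <= e * `|s - t|).
Proof.
rewrite -(difference_quotientP R F t d); split=> [[Fd <-]|H]; first by rewrite derive1E.
split; first by apply/cvg_ex; exists d.
by rewrite derive1E; apply: cvg_lim H; exact: norm_hausdorff.
Qed.

Lemma continuous_integrable01_cc (f : R -> R) :
  (forall t, 0 <= t <= 1 -> {for t, continuous f}) ->
  mu.-integrable `[0, 1] (EFin \o f).
Proof.
move=> fc; apply: continuous_compact_integrable; first exact: segment_compact.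
by apply: continuous_in_subspaceT => t; rewrite inE /= in_itv /=; exact: fc.
Qed.

Lemma continuous_integrable01 (f : R -> R) :
  (forall t, 0 <= t <= 1 -> {for t, continuous f}) ->
  mu.-integrable `]0, 1[ (EFin \o f).
Proof.
move=> /continuous_integrable01_cc; apply: integrableS => //.
by apply: subset_itv; rewrite bnd_simp.
Qed.

Lemma Rintegral_FTC01 (f F : R -> R) :
  (forall t, 0 <= t <= 1 -> {for t, continuous f}) ->
  (forall t, 0 <= t <= 1 -> derivable F t 1 /\ derive1 F t = f t) ->
  \int[mu]_(t in `]0, 1[) f t = F 1 - F 0.
Proof.
move=> fc Fd.
have Fc t : 0 <= t <= 1 -> {for t, continuous F}.
  move=> /Fd [+ _]; move=> ?.
  by apply/differentiable_continuous; rewrite -derivable1_diffP.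
have If := continuous_integrable01 _ fc.
have If2 : mu.-integrable `]0, 1] (EFin \o f).
  apply: integrableS (continuous_integrable01_cc _ fc) => //.
  by apply: subset_itv; rewrite bnd_simp.
rewrite Rintegral_itv_bndo_bndc // Rintegral_itv_obnd_cbnd //.
rewrite /Rintegral (@continuous_FTC2 _ f F 0 1) //.
- apply: continuous_in_subspaceT => t; rewrite inE /= in_itv /=; exact: fc.
- split.
  + by move=> t; rewrite in_itv /= => /andP[/ltW t0 /ltW t1]; apply Fd; rewrite t0.
  + by apply: cvg_at_right_filter; apply: Fc; rewrite lexx ler01.
  + by apply: cvg_at_left_filter; apply: Fc; rewrite lexx ler01.
- by move=> t; rewrite in_itv /= => /andP[/ltW t0 /ltW t1]; apply Fd; rewrite t0.
Qed.

Lemma continuous_primitive01 (f : R -> R) : continuous f ->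
  exists F : R -> R, forall t, 0 <= t <= 1 -> derivable F t 1 /\ derive1 F t = f t.
Proof.
(* Integrating from -1, on an interval that ends at 2, puts [0, 1] in the interior, so the
   derivatives at 0 and 1 are two-sided. *)
move=> fc; exists (fun x => \int[mu]_(t in [set` `[-1, x]]) f t).
move=> t /andP[t0 t1].
apply: (@continuous_FTC1_closed _ _ (-1) t 2).
- by rewrite (le_lt_trans t1) // ltr1n.
- apply: continuous_compact_integrable; first exact: segment_compact.
  exact: continuous_subspaceT.
- by rewrite (lt_le_trans _ t0) // ltrN10.
- exact: fc.
Qed.

End RealFTC.

Section ComplexIntegral.
Context {R : realType}.
Notation mu := (@lebesgue_measure R).
Implicit Types (f g h : R -> R[i]) (c d : R[i]) (t : R).

(** For the curve t |-> g (segment a b t) this is [segment_integrable g a b]; general curves are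
    allowed because integrals over circles occur too. *)
Definition cintegrable g : Prop :=
  mu.-integrable `]0, 1[ (fun t => (complex.Re (g t))%:E) /\
  mu.-integrable `]0, 1[ (fun t => (complex.Im (g t))%:E).

Definition cI g : R[i] :=
  (\int[mu]_(t in `]0, 1[) complex.Re (g t)) +i*
  (\int[mu]_(t in `]0, 1[) complex.Im (g t)).

Lemma eq_cI f g : (forall t, 0 < t < 1 -> f t = g t) -> cI f = cI g.
Proof.
move=> fg; rewrite /cI; congr (_ +i* _); apply: eq_Rintegral => t;
  by rewrite inE /= in_itv /= => /fg ->.
Qed.

Lemma eq_cintegrable f g : (forall t, 0 < t < 1 -> f t = g t) ->
  cintegrable f -> cintegrable g.
Proof.
move=> fg [If Jf]; split; [move: If|move: Jf]; apply: eq_integrable => // t;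
  by rewrite inE /= in_itv /= => /fg ->.
Qed.

Lemma cintegrableD f g : cintegrable f -> cintegrable g ->
  cintegrable (fun t => f t + g t).
Proof.
move=> [If Jf] [Ig Jg]; split.
- apply: eq_integrable (integrableD _ If Ig) => // t _ /=; by rewrite cReD.
- apply: eq_integrable (integrableD _ Jf Jg) => // t _ /=; by rewrite cImD.
Qed.

Lemma cintegrableZ c f : cintegrable f -> cintegrable (fun t => c * f t).
Proof.
move=> [If Jf]; split.
- apply: eq_integrable (integrableB _ (integrableZl _ (complex.Re c) If)
    (integrableZl _ (complex.Im c) Jf)) => // t _ /=; by rewrite cReM.
- apply: eq_integrable (integrableD _ (integrableZl _ (complex.Re c) Jf)
    (integrableZl _ (complex.Im c) If)) => // t _ /=; by rewrite cImM.
Qed.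

Lemma cID f g : cintegrable f -> cintegrable g ->
  cI (fun t => f t + g t) = cI f + cI g.
Proof.
move=> [If Jf] [Ig Jg]; apply: eq_ReIm; rewrite ?cReD ?cImD /=.
- by under eq_Rintegral do rewrite cReD; rewrite RintegralD.
- by under eq_Rintegral do rewrite cImD; rewrite RintegralD.
Qed.

Lemma integrable01_scale (x : R) (u : R -> R) :
  mu.-integrable `]0, 1[ (EFin \o u) ->
  mu.-integrable `]0, 1[ (EFin \o (fun t => x * u t)).
Proof.
by move=> Iu; apply: eq_integrable (integrableZl _ x Iu).
Qed.

Lemma cIZ c f : cintegrable f -> cI (fun t => c * f t) = c * cI f.
Proof.
move=> [If Jf]; apply: eq_ReIm; rewrite ?cReM ?cImM /=.
- under eq_Rintegral do rewrite cReM.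
  by rewrite RintegralB ?RintegralZl //; apply: integrable01_scale.
- under eq_Rintegral do rewrite cImM.
  by rewrite RintegralD ?RintegralZl //; apply: integrable01_scale.
Qed.

Lemma cintegrable0 : cintegrable (fun=> 0).
Proof. by split; exact: integrable0. Qed.

Lemma cI0 : cI (fun=> 0) = 0.
Proof. by apply: eq_ReIm => /=; rewrite /Rintegral integral0. Qed.

Lemma cintegrable_sum n (F : nat -> R -> R[i]) :
  (forall k, cintegrable (F k)) -> cintegrable (fun t => \sum_(k < n) F k t).
Proof.
move=> IF; elim: n => [|n IH].
  by apply: eq_cintegrable cintegrable0 => t _; rewrite big_ord0.
by apply: eq_cintegrable (cintegrableD _ _ IH (IF n)) => t _; rewrite big_ord_recr /=.
Qed.

Lemma cI_sum n (F : nat -> R -> R[i]) :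
  (forall k, cintegrable (F k)) ->
  cI (fun t => \sum_(k < n) F k t) = \sum_(k < n) cI (F k).
Proof.
move=> IF; elim: n => [|n IH].
  by rewrite big_ord0 -[RHS]cI0; apply: eq_cI => t _; rewrite big_ord0.
rewrite big_ord_recr /= -IH -cID //; last exact: cintegrable_sum.
by apply: eq_cI => t _; rewrite big_ord_recr /=.
Qed.

(* The factor 2 comes from bounding the real and imaginary parts separately. *)
Lemma ler_cmod_cI g (H : R -> R) : cintegrable g ->
  mu.-integrable `]0, 1[ (EFin \o H) ->
  (forall t, 0 < t < 1 -> cmod (g t) <= H t) ->
  cmod (cI g) <= 2 * \int[mu]_(t in `]0, 1[) H t.
Proof.
move=> [Ig Jg] IH gH; apply: le_trans (ler_cmod_ReIm _) _.
rewrite mulr_natl mulr2n /=; apply: lerD.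
- apply: le_trans (le_normr_Rintegral _ Ig) _ => //.
  apply: le_Rintegral => //; first exact: integrable_norm Ig.
  move=> t /=; rewrite in_itv /= => /gH; apply: le_trans; exact: ler_Re_cmod.
- apply: le_trans (le_normr_Rintegral _ Jg) _ => //.
  apply: le_Rintegral => //; first exact: integrable_norm Jg.
  move=> t /=; rewrite in_itv /= => /gH; apply: le_trans; exact: ler_Im_cmod.
Qed.

Lemma Rintegral01_cst (K : R) : \int[mu]_(t in `]0, 1[) K = K.
Proof.
rewrite Rintegral_cst //=. rewrite lebesgue_measure_itv /= lte_fin ltr01.
by rewrite -EFinB subr0 mulr1.
Qed.

Lemma integrable01_cst (K : R) : mu.-integrable `]0, 1[ (EFin \o (fun=> K)).
Proof. apply: continuous_integrable01 => t _; exact: cst_continuous. Qed.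

Lemma ler_cmod_cI_cst g (K : R) : cintegrable g ->
  (forall t, 0 < t < 1 -> cmod (g t) <= K) -> cmod (cI g) <= 2 * K.
Proof.
move=> Ig gK; rewrite -[K in leRHS]Rintegral01_cst.
apply: ler_cmod_cI => //; exact: integrable01_cst.
Qed.

Definition rcont g t := forall e : R, 0 < e -> exists2 r : R, 0 < r &
  forall s, `|s - t| < r -> cmod (g s - g t) <= e.

Definition rdiff g t d := forall e : R, 0 < e -> exists2 r : R, 0 < r &
  forall s, `|s - t| < r ->
    cmod (g s - g t - d * (s - t)%:C) <= e * `|s - t|.

Lemma rcont_Re g t : rcont g t -> {for t, continuous (fun s => complex.Re (g s))}.
Proof.
move=> H; apply/cvgrPdist_le => e /H[r r0 Hr]; exists r => // s /= st.
rewrite -cReN -cReD distrC in st *.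
apply: le_trans (ler_Re_cmod _) _; rewrite cmodBC; exact: Hr.
Qed.

Lemma rcont_Im g t : rcont g t -> {for t, continuous (fun s => complex.Im (g s))}.
Proof.
move=> H; apply/cvgrPdist_le => e /H[r r0 Hr]; exists r => // s /= st.
rewrite -cImN -cImD distrC in st *.
apply: le_trans (ler_Im_cmod _) _; rewrite cmodBC; exact: Hr.
Qed.

Lemma rcont_cintegrable g : (forall t, 0 <= t <= 1 -> rcont g t) ->
  cintegrable g.
Proof.
by move=> gc; split; apply: continuous_integrable01 => t /gc; [exact: rcont_Re|exact: rcont_Im].
Qed.

Lemma rdiff_Re g t d : rdiff g t d ->
  derivable (fun s => complex.Re (g s)) t 1 /\
  derive1 (fun s => complex.Re (g s)) t = complex.Re d.
Proof.
move=> H; apply/derive1_epsP => e /H[r r0 Hr]; exists r => // s /Hr.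
apply: le_trans; apply: le_trans (ler_Re_cmod _).
by rewrite !cReD !cReN cReM /= mulr0 subr0.
Qed.

Lemma rdiff_Im g t d : rdiff g t d ->
  derivable (fun s => complex.Im (g s)) t 1 /\
  derive1 (fun s => complex.Im (g s)) t = complex.Im d.
Proof.
move=> H; apply/derive1_epsP => e /H[r r0 Hr]; exists r => // s /Hr.
apply: le_trans; apply: le_trans (ler_Im_cmod _).
by rewrite !cImD !cImN cImM /= mulr0 add0r.
Qed.

Lemma cI_FTC G g : (forall t, 0 <= t <= 1 -> rcont g t) ->
  (forall t, 0 <= t <= 1 -> rdiff G t (g t)) -> cI g = G 1 - G 0.
Proof.
move=> gc Gd; apply: eq_ReIm; rewrite ?cReD ?cImD ?cReN ?cImN /=.
- apply: (Rintegral_FTC01 (fun t => complex.Re (g t)) (fun t => complex.Re (G t))) => t t01.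
  + exact/rcont_Re/gc.
  + exact/rdiff_Re/Gd.
- apply: (Rintegral_FTC01 (fun t => complex.Im (g t)) (fun t => complex.Im (G t))) => t t01.
  + exact/rcont_Im/gc.
  + exact/rdiff_Im/Gd.
Qed.

Lemma rdiff_ReIm g t d :
  derivable (fun s => complex.Re (g s)) t 1 /\
    derive1 (fun s => complex.Re (g s)) t = complex.Re d ->
  derivable (fun s => complex.Im (g s)) t 1 /\
    derive1 (fun s => complex.Im (g s)) t = complex.Im d ->
  rdiff g t d.
Proof.
move=> /derive1_epsP HR /derive1_epsP HI e e0.
have e20 : 0 < e / 2 by rewrite divr_gt0.
have [r r0 Hr] := HR _ e20; have [r' r'0 Hr'] := HI _ e20.
exists (Num.min r r'); first by rewrite lt_min r0.
move=> s; rewrite lt_min => /andP[/Hr {}Hr /Hr' {}Hr'].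
apply: le_trans (ler_cmod_ReIm _) _.
rewrite !cReD !cReN cReM !cImD !cImN cImM /= mulr0 subr0 mulr0 add0r.
by rewrite [e]splitr mulrDl; exact: lerD.
Qed.

Lemma rcont_primitive g : (forall t, rcont g t) ->
  exists G, forall t, 0 <= t <= 1 -> rdiff G t (g t).
Proof.
move=> gc.
have [G1 H1] := continuous_primitive01 _ (fun t => rcont_Re _ _ (gc t)).
have [G2 H2] := continuous_primitive01 _ (fun t => rcont_Im _ _ (gc t)).
exists (fun t => G1 t +i* G2 t) => t t01.
by apply: rdiff_ReIm => /=; [exact: H1|exact: H2].
Qed.

Lemma rdiff_cont g t d : rdiff g t d -> rcont g t.
Proof.
move=> H e e0; have [r r0 Hr] := H 1 ltr01.
have K0 : 0 < 1 + cmod d by rewrite ltr_pwDl ?cmod_ge0.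
exists (Num.min r (e / (1 + cmod d))); first by rewrite lt_min r0 divr_gt0.
move=> w; rewrite lt_min => /andP[wr we].
rewrite -(subrK (d * (w - t)%:C) (g w - g t)).
apply: le_trans (cmodD _ _) _.
apply: (@le_trans _ _ ((1 + cmod d) * `|w - t|)).
  by rewrite mulrDl cmodM cmodR lerD2r Hr.
by rewrite mulrC -ler_pdivlMr // ltW.
Qed.

Lemma rcont_comp (F : R[i] -> R[i]) g t : ccont_at F (g t) -> rcont g t ->
  rcont (fun s => F (g s)) t.
Proof.
move=> Fc gc e /Fc[r r0 Hr].
have [r' r'0 Hr'] := gc (r / 2) (divr_gt0 r0 (ltr0n _ 2)).
exists r' => // s /Hr' h; apply: Hr; apply: le_lt_trans h _.
by rewrite ltr_pdivrMr // ltr_pMr // ltr1n.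
Qed.

Lemma rdiff_comp (F : R[i] -> R[i]) g t d d' : cdiff F (g t) d ->
  rdiff g t d' -> rdiff (fun s => F (g s)) t (d * d').
Proof.
move=> Fd gd e e0.
set K := cmod d + cmod d' + 1.
have K0 : 0 < K by rewrite ltr_wpDl ?addr_ge0 ?cmod_ge0.
set e1 := Num.min 1 (e / (2 * K)).
have e10 : 0 < e1 by rewrite lt_min ltr01 divr_gt0 ?mulr_gt0.
have [r r0 Hr] := Fd _ e10; have [r1 r10 Hr1] := gd _ e10.
have [r2 r20 Hr2] := rdiff_cont _ _ _ gd _ (divr_gt0 r0 (ltr0n R 2)).
exists (Num.min r1 r2); first by rewrite lt_min r10.
move=> s; rewrite lt_min => /andP[sr1 sr2].
have {Hr2}sr : cmod (g s - g t) < r.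
  by apply: le_lt_trans (Hr2 _ sr2) _; rewrite ltr_pdivrMr // ltr_pMr // ltr1n.
have {}Hr := Hr _ sr; have {}Hr1 := Hr1 _ sr1.
set m := `|s - t| in Hr1 *.
have m0 : 0 <= m := normr_ge0 _.
have gm : cmod (g s - g t) <= (1 + cmod d') * m.
  rewrite -(subrK (d' * (s - t)%:C) (g s - g t)).
  apply: le_trans (cmodD _ _) _; rewrite cmodM cmodR -/m mulrDl lerD2r.
  by apply: le_trans Hr1 _; rewrite ler_wpM2r // ge_min lexx.
have -> : F (g s) - F (g t) - d * d' * (s - t)%:C =
  (F (g s) - F (g t) - d * (g s - g t)) + d * (g s - g t - d' * (s - t)%:C) by ring.
apply: le_trans (cmodD _ _) _; rewrite cmodM.
apply: (@le_trans _ _ (e1 * ((1 + cmod d') * m) + cmod d * (e1 * m))).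
  apply: lerD; last by rewrite ler_wpM2l ?cmod_ge0.
  by apply: le_trans Hr _; rewrite ler_wpM2l // ltW.
have -> : e1 * ((1 + cmod d') * m) + cmod d * (e1 * m) = e1 * K * m by rewrite /K; ring.
rewrite ler_wpM2r // -ler_pdivlMr //.
apply: (@le_trans _ _ (e / (2 * K))); first by rewrite ge_min lexx orbT.
rewrite ler_pM2l // lef_pV2 ?posrE ?mulr_gt0 //; lra.
Qed.

Lemma rdiff_affine (a b : R[i]) t : rdiff (fun s => a + s%:C * b) t b.
Proof.
move=> e e0; exists 1 => // s _.
have -> : a + s%:C * b - (a + t%:C * b) - b * (s - t)%:C = 0.
  by rewrite rmorphB /=; ring.
by rewrite cmod0 mulr_ge0 // ltW.
Qed.

Lemma rdiff_comp_affine g (p q : R) t d : rdiff g (p + q * t) d ->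
  rdiff (fun s => g (p + q * s)) t (q%:C * d).
Proof.
move=> gd e e0.
(* The added 1 keeps the quotients meaningful when q = 0. *)
have q0 : 0 < `|q| + 1 by rewrite ltr_wpDl.
have [r r0 Hr] := gd _ (divr_gt0 e0 q0).
exists (r / (`|q| + 1)); first by rewrite divr_gt0.
move=> s sr.
have E : p + q * s - (p + q * t) = q * (s - t) by ring.
have sr' : `|q| * `|s - t| < r.
  apply: le_lt_trans (_ : (`|q| + 1) * `|s - t| < r).
    by rewrite ler_wpM2r // lerDl.
  by rewrite mulrC -ltr_pdivlMr.
have := Hr (p + q * s); rewrite E normrM => /(_ sr').
rewrite rmorphM /= => H.
have -> : q%:C * d * (s - t)%:C = d * (q%:C * (s - t)%:C) by ring.
apply: le_trans H _; rewrite mulrA ler_wpM2r // -mulrA ler_piMr ?ltW //.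
by rewrite mulrC ltr_pdivrMr // mul1r ltrDl.
Qed.

Lemma rdiffZ c g t d : rdiff g t d -> rdiff (fun s => c * g s) t (c * d).
Proof.
move=> gd; apply: (rdiff_comp (fun w => c * w)) => //.
rewrite -[c in cdiff _ _ c]mulr1 -[c * 1]add0r -[0](mul0r (g t)).
exact: cdiffM (cdiff_cst _ _) (cdiff_id _).
Qed.

End ComplexIntegral.

(** * Goursat's lemma and Cauchy's formula *)

Section Goursat.
Context {R : realType}.
Implicit Types (f g : R[i] -> R[i]) (z w a b c d : R[i]) (rho t : R).

Notation S := segment_integral.

Lemma segment_integralE f a b :
  S f a b = (b - a) * cI (fun t => f (segment a b t)).
Proof. by []. Qed.

Lemma segment0 a b : segment a b 0 = a.
Proof. by rewrite /segment mul0r addr0. Qed.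

Lemma segment1 a b : segment a b 1 = b.
Proof. by rewrite /segment mul1r addrC subrK. Qed.

Lemma cmod_convex a b rho t : 0 <= t <= 1 -> cmod a <= rho -> cmod b <= rho ->
  cmod (segment a b t) <= rho.
Proof.
move=> /andP[t0 t1] ha hb.
have -> : segment a b t = (1 - t)%:C * a + t%:C * b.
  by rewrite /segment rmorphB /= rmorph1; ring.
apply: le_trans (cmodD _ _) _; rewrite !cmodM !cmodR ger0_norm ?subr_ge0 //.
rewrite ger0_norm //.
have := ler_wpM2l t0 hb.
have : (1 - t) * cmod a <= (1 - t) * rho by rewrite ler_wpM2l // subr_ge0.
lra.
Qed.

Lemma disc_segment a b t : unit_disc a -> unit_disc b -> 0 <= t <= 1 ->
  unit_disc (segment a b t).
Proof.
rewrite /unit_disc /= => ha hb t01.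
apply: (@le_lt_trans _ _ (Num.max (cmod a) (cmod b))).
  by apply: cmod_convex => //; rewrite le_max lexx ?orbT.
by rewrite gt_max ha.
Qed.

Lemma unit_disc0 : unit_disc (0 : R[i]).
Proof. by rewrite /unit_disc /= cmod0. Qed.

Definition ccont_disc f := forall z, unit_disc z -> ccont_at f z.

Lemma rcont_segment f a b t : ccont_disc f -> unit_disc a -> unit_disc b ->
  0 <= t <= 1 -> rcont (fun s => f (segment a b s)) t.
Proof.
move=> fc ha hb t01; apply: rcont_comp; first exact/fc/disc_segment.
exact: rdiff_cont (rdiff_affine _ _ _).
Qed.

Lemma cintegrable_segment f a b : ccont_disc f -> unit_disc a -> unit_disc b ->
  cintegrable (fun s => f (segment a b s)).
Proof. by move=> fc ha hb; apply: rcont_cintegrable => t; exact: rcont_segment. Qed.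

Lemma segment_integral_FTC f F a b : ccont_disc f -> unit_disc a -> unit_disc b ->
  (forall w, unit_disc w -> cdiff F w (f w)) -> S f a b = F b - F a.
Proof.
move=> fc ha hb Fd.
rewrite segment_integralE -cIZ; last exact: cintegrable_segment.
rewrite (cI_FTC (fun t => F (segment a b t))).
- by rewrite segment1 segment0.
- move=> t t01; apply: (rcont_comp (fun w => (b - a) * w)).
    apply: (@cdiff_cont _ _ _ (0 * f (segment a b t) + (b - a) * 1)).
    exact: cdiffM (cdiff_cst _ _) (cdiff_id _).
  exact: rcont_segment.
- move=> t t01; rewrite mulrC; apply: rdiff_comp; first exact/Fd/disc_segment.
  exact: rdiff_affine.
Qed.

(* Clamping the parameter extends the integrand continuously to the real line, as
   [rcont_primitive] requires. *)
Lemma segment_integral_sub f a b : ccont_disc f -> unit_disc a -> unit_disc b ->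
  exists Phi : R -> R[i], forall p q, 0 <= p <= 1 -> 0 <= q <= 1 ->
    S f (segment a b p) (segment a b q) = (b - a) * (Phi q - Phi p).
Proof.
move=> fc ha hb.
pose clamp (t : R) := Num.max 0 (Num.min 1 t).
have clamp01 t : 0 <= clamp t <= 1.
  by rewrite /clamp le_max lexx ge_max ler01 ge_min lexx.
have clampE t : 0 <= t <= 1 -> clamp t = t.
  by move=> /andP[t0 t1]; rewrite /clamp min_r // max_r.
have clampL s t : `|clamp s - clamp t| <= `|s - t|.
  have h x y : x <= y -> `|clamp x - clamp y| <= `|x - y|.
    move=> xy; have h1 := ltP 1 x; have h2 := ltP 1 y.
    have h3 := ltP 0 x; have h4 := ltP 0 y; have h5 := @ltr01 R.
    rewrite distrC (distrC x) [leRHS]ger0_norm ?subr_ge0 //.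
    rewrite ger0_norm ?subr_ge0 /clamp.
      by case: h1; case: h2; rewrite ?(max_r ler01); case: h3; case: h4 => *; lra.
    by case: h1; case: h2; rewrite ?(max_r ler01); case: h3; case: h4 => *; lra.
  by case: (leP s t) => [/h//|/ltW/h]; rewrite distrC (distrC t).
have cc t : rcont (fun s => segment a b (clamp s)) t.
  move=> e e0; have K0 : 0 < 1 + cmod (b - a) by rewrite ltr_pwDl ?cmod_ge0.
  exists (e / (1 + cmod (b - a))); first by rewrite divr_gt0.
  move=> s st; have -> : segment a b (clamp s) - segment a b (clamp t) =
    (clamp s - clamp t)%:C * (b - a) by rewrite /segment rmorphB /=; ring.
  rewrite cmodM cmodR; apply: (@le_trans _ _ (`|s - t| * (1 + cmod (b - a)))).
    by apply: ler_pM; rewrite ?cmod_ge0 // lerDr.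
  by rewrite -ler_pdivlMr // ltW.
have [Phi HPhi] : exists G, forall t, 0 <= t <= 1 ->
    rdiff G t (f (segment a b (clamp t))).
  apply: rcont_primitive => t; apply: rcont_comp => //.
  exact/fc/disc_segment.
exists Phi => p q p01 q01.
have pq01 t : 0 <= t <= 1 -> 0 <= p + (q - p) * t <= 1.
  move: p01 q01 => /andP[p0 p1] /andP[q0 q1] /andP[t0 t1]; nra.
have segE t : segment (segment a b p) (segment a b q) t = segment a b (p + (q - p) * t).
  by rewrite /segment rmorphD rmorphM rmorphB /=; ring.
have hp := disc_segment _ _ _ ha hb p01; have hq := disc_segment _ _ _ ha hb q01.
rewrite segment_integralE.
have -> : segment a b q - segment a b p = (b - a) * (q - p)%:C.
  by rewrite /segment rmorphB /=; ring.
rewrite -mulrA; congr (_ * _); rewrite -cIZ; last exact: cintegrable_segment.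
rewrite (cI_FTC (fun t => Phi (p + (q - p) * t))).
- by congr (Phi _ - Phi _); ring.
- move=> t t01; apply: (rcont_comp (fun w => (q - p)%:C * w)); last exact: rcont_segment.
  exact: cdiff_cont (cdiffM _ _ _ _ _ (cdiff_cst _ _) (cdiff_id _)).
- move=> t t01; rewrite segE -[X in segment a b X]clampE ?pq01 //.
  by apply: rdiff_comp_affine; exact/HPhi/pq01.
Qed.

(** Both orientations are increments of the same antiderivative along the segment; the splitting at
    the midpoint below has the same origin. *)
Lemma segment_integral_rev f a b : ccont_disc f -> unit_disc a ->
  unit_disc b -> S f b a = - S f a b.
Proof.
move=> fc ha hb; have [P HP] := segment_integral_sub f a b fc ha hb.
have z01 : 0 <= (0 : R) <= 1 by rewrite lexx ler01.
have o01 : 0 <= (1 : R) <= 1 by rewrite lexx ler01.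
have := HP _ _ z01 o01; have := HP _ _ o01 z01.
by rewrite segment0 segment1 => -> ->; ring.
Qed.

Lemma segment_half a b : segment a b (2^-1) = (a + b) / 2.
Proof. by rewrite /segment fmorphV /= rmorph_nat; field. Qed.

Lemma segment_integral_mid f a b : ccont_disc f -> unit_disc a ->
  unit_disc b -> S f a b = S f a ((a + b) / 2) + S f ((a + b) / 2) b.
Proof.
move=> fc ha hb; have [P HP] := segment_integral_sub f a b fc ha hb.
have z01 : 0 <= (0 : R) <= 1 by rewrite lexx ler01.
have o01 : 0 <= (1 : R) <= 1 by rewrite lexx ler01.
have h01 : 0 <= (2^-1 : R) <= 1 by rewrite invr_ge0 ler0n invf_le1 // ler1n.
have := HP _ _ z01 o01; have := HP _ _ z01 h01; have := HP _ _ h01 o01.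
by rewrite segment0 segment1 segment_half => -> -> ->; ring.
Qed.

Lemma segment_integralB f g a b : ccont_disc f -> ccont_disc g ->
  unit_disc a -> unit_disc b -> S (fun w => f w + g w) a b = S f a b + S g a b.
Proof.
move=> fc gc ha hb; rewrite !segment_integralE -mulrDr -cID //;
  exact: cintegrable_segment.
Qed.

Lemma ler_segment_integral f a b K : ccont_disc f -> unit_disc a -> unit_disc b ->
  (forall t, 0 <= t <= 1 -> cmod (f (segment a b t)) <= K) ->
  cmod (S f a b) <= 2 * K * cmod (b - a).
Proof.
move=> fc ha hb fK; rewrite segment_integralE cmodM mulrC ler_wpM2r ?cmod_ge0 //.
apply: ler_cmod_cI_cst; first exact: cintegrable_segment.
by move=> t /andP[t0 t1]; apply: fK; rewrite !ltW.
Qed.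

Definition triangle_integral f (T : R[i] * R[i] * R[i]) : R[i] :=
  S f T.1.1 T.1.2 + S f T.1.2 T.2 + S f T.2 T.1.1.

Definition perimeter (T : R[i] * R[i] * R[i]) : R :=
  cmod (T.1.1 - T.1.2) + cmod (T.1.2 - T.2) + cmod (T.2 - T.1.1).

Definition in_ball rho (T : R[i] * R[i] * R[i]) : Prop :=
  [/\ cmod T.1.1 <= rho, cmod T.1.2 <= rho & cmod T.2 <= rho].

Lemma cmod_half z : cmod (z / 2) = cmod z / 2.
Proof. by rewrite cmodM cmodV cmodn. Qed.

(** Cut along the midpoints of the edges: the inner edges cancel in pairs, so one of the four
    similar triangles carries at least a quarter of the integral. The control of the first vertex
    makes the vertices of iterated subdivisions converge, and the ball of radius rho < 1 keeps their
    limit inside the open disc. *)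
Lemma triangle_subdivision f rho T : ccont_disc f -> rho < 1 -> in_ball rho T ->
  exists T', [/\ in_ball rho T', perimeter T' = perimeter T / 2,
    cmod (T'.1.1 - T.1.1) <= perimeter T / 2 &
    cmod (triangle_integral f T) <= 4 * cmod (triangle_integral f T')].
Proof.
case: T => [[a b] c] fc rho1 [/= ha hb hc].
have D z : cmod z <= rho -> unit_disc z.
  by move=> h; rewrite /unit_disc /=; apply: le_lt_trans rho1.
have M z w : cmod z <= rho -> cmod w <= rho -> cmod ((z + w) / 2) <= rho.
  move=> hz hw; rewrite cmod_half ler_pdivrMr //.
  apply: le_trans (cmodD _ _) _; lra.
set ab := (a + b) / 2; set bc := (b + c) / 2; set ca := (c + a) / 2.
have hab : cmod ab <= rho by exact: M.
have hbc : cmod bc <= rho by exact: M.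
have hca : cmod ca <= rho by exact: M.
pose T1 := (a, ab, ca); pose T2 := (ab, b, bc); pose T3 := (ca, bc, c).
pose T4 := (bc, ca, ab).
have E : triangle_integral f (a, b, c) =
  triangle_integral f T1 + triangle_integral f T2 + triangle_integral f T3 +
  triangle_integral f T4.
  rewrite /triangle_integral /=.
  rewrite (segment_integral_mid _ a b) ?(segment_integral_mid _ b c)
    ?(segment_integral_mid _ c a) //; try exact: D.
  rewrite -/ab -/bc -/ca.
  rewrite (segment_integral_rev f ab ca) ?(segment_integral_rev f bc ab)
     ?(segment_integral_rev f ca bc) //; try exact: D.
  by ring.
have sc z w z' w' : z - w = (z' - w') / 2 -> cmod (z - w) = cmod (z' - w') / 2.
  by move=> ->; exact: cmod_half.
have Eab : cmod (a - ab) = cmod (a - b) / 2 by apply: sc; rewrite /ab; field.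
have Eab' : cmod (ab - b) = cmod (a - b) / 2 by apply: sc; rewrite /ab; field.
have Ebc : cmod (b - bc) = cmod (b - c) / 2 by apply: sc; rewrite /bc; field.
have Ebc' : cmod (bc - c) = cmod (b - c) / 2 by apply: sc; rewrite /bc; field.
have Eca : cmod (c - ca) = cmod (c - a) / 2 by apply: sc; rewrite /ca; field.
have Eca' : cmod (ca - a) = cmod (c - a) / 2 by apply: sc; rewrite /ca; field.
have Em1 : cmod (ab - ca) = cmod (b - c) / 2 by apply: sc; rewrite /ca /ab; field.
have Em2 : cmod (bc - ab) = cmod (c - a) / 2 by apply: sc; rewrite /bc /ab; field.
have Em3 : cmod (ca - bc) = cmod (a - b) / 2 by apply: sc; rewrite /ca /bc; field.
have n1 := cmod_ge0 (a - b); have n2 := cmod_ge0 (b - c).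
have n3 := cmod_ge0 (c - a).
have big : exists2 T', T' \in [:: T1; T2; T3; T4] &
    cmod (triangle_integral f (a, b, c)) <= 4 * cmod (triangle_integral f T').
  (* If all four pieces were smaller than a quarter, the triangle inequality applied to E would
     fail. *)
  apply: contrapT => H.
  have H' T' : T' \in [:: T1; T2; T3; T4] ->
      4 * cmod (triangle_integral f T') < cmod (triangle_integral f (a, b, c)).
    by move=> h; rewrite ltNge; apply/negP => h'; apply: H; exists T'.
  have h1 := H' T1; rewrite !inE eqxx /= in h1; have {}h1 := h1 isT.
  have h2 := H' T2; rewrite !inE eqxx !orbT /= in h2; have {}h2 := h2 isT.
  have h3 := H' T3; rewrite !inE eqxx !orbT /= in h3; have {}h3 := h3 isT.
  have h4 := H' T4; rewrite !inE eqxx !orbT /= in h4; have {}h4 := h4 isT.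
  have h5 := cmodD (triangle_integral f T1 + triangle_integral f T2 +
     triangle_integral f T3) (triangle_integral f T4).
  have h6 := cmodD (triangle_integral f T1 + triangle_integral f T2)
     (triangle_integral f T3).
  have h7 := cmodD (triangle_integral f T1) (triangle_integral f T2).
  rewrite -E in h5; lra.
have [T' T'in hT'] := big; exists T'.
move: T'in; rewrite !inE => /or4P[] /eqP ET; rewrite ET in hT' *;
  split => //; rewrite /perimeter /in_ball /=.
- by rewrite Eab Em1 Eca'; field.
- by rewrite subrr cmod0; lra.
- by rewrite Eab' Ebc Em2; field.
- by rewrite cmodBC Eab; lra.
- by rewrite Em3 Ebc' Eca; field.
- by rewrite Eca'; lra.
- rewrite [cmod (bc - ca)]cmodBC [cmod (ca - ab)]cmodBC [cmod (ab - bc)]cmodBC.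
  by rewrite Em3 Em1 Em2; field.
- have -> : bc - a = (b - a) / 2 + (c - a) / 2 by rewrite /bc; field.
  apply: le_trans (cmodD _ _) _; rewrite !cmod_half (cmodBC b a); lra.
Qed.

End Goursat.

Section Cauchy.
Context {R : realType}.
Implicit Types (f g F : R[i] -> R[i]) (z w a b c d : R[i]) (rho t : R).

Notation S := segment_integral.

Definition holo f := forall z, unit_disc z -> exists d, cdiff f z d.

Lemma holo_ccont f : holo f -> ccont_disc f.
Proof. by move=> fh z /fh[d]; exact: cdiff_cont. Qed.

Lemma ccont_ext f g z : f =1 g -> ccont_at f z -> ccont_at g z.
Proof.
by move=> fg H e /H[r r0 Hr]; exists r => // w /Hr; rewrite !fg.
Qed.

Lemma cdiffZ c f z d : cdiff f z d -> cdiff (fun w => c * f w) z (c * d).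
Proof.
move=> H; rewrite -[c * d]add0r -[0](mul0r (f z)).
exact: cdiffM (cdiff_cst _ _) H.
Qed.

Lemma cdiff_shift z w : cdiff (fun w => w - z) w 1.
Proof. by rewrite -[1]addr0; exact: cdiffD (cdiff_id _) (cdiff_cst _ _). Qed.

Lemma cdiff_eq f z d d' : d = d' -> cdiff f z d -> cdiff f z d'.
Proof. by move=> ->. Qed.

Lemma triangle_integral_affine z p q a b c : unit_disc a -> unit_disc b ->
  unit_disc c -> triangle_integral (fun w => p + q * (w - z)) (a, b, c) = 0.
Proof.
move=> ha hb hc; rewrite /triangle_integral /=.
have D w : cdiff (fun w => p * w + (q / 2) * ((w - z) * (w - z))) w
    (p + q * (w - z)).
  apply: cdiff_eq (cdiffD _ _ _ _ _ (cdiffZ p _ _ _ (cdiff_id w))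
    (cdiffZ (q / 2) _ _ _ (cdiffM _ _ _ _ _ (cdiff_shift z w) (cdiff_shift z w)))).
  by field.
have C : ccont_disc (fun w => p + q * (w - z)).
  move=> w _; apply: ccontD; first exact: cdiff_cont (cdiff_cst _ _).
  exact: cdiff_cont (cdiffZ _ _ _ _ (cdiff_shift _ _)).
rewrite !(segment_integral_FTC _ _ _ _ C _ _ (fun w _ => D w)) //; ring.
Qed.

(** Repeated subdivision shrinks the triangles to a point z of the disc. Near z the function is
    affine up to e |w - z|; the affine part has a primitive and integrates to 0, and the remainder
    contributes O(e) times the squared perimeter, which compensates the factor 4^n. *)
Theorem goursat f a b c : holo f -> unit_disc a -> unit_disc b -> unit_disc c ->
  triangle_integral f (a, b, c) = 0.
Proof.
move=> fh ha hb hc; have fc := holo_ccont _ fh.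
pose rho := Num.max (cmod a) (Num.max (cmod b) (cmod c)).
have rho1 : rho < 1 by rewrite !gt_max; apply/and3P.
have T0in : in_ball rho (a, b, c).
  by split; rewrite /= !le_max lexx ?orbT.
have [step Hstep] : exists step, forall T, in_ball rho T ->
    [/\ in_ball rho (step T), perimeter (step T) = perimeter T / 2,
    cmod ((step T).1.1 - T.1.1) <= perimeter T / 2 &
    cmod (triangle_integral f T) <= 4 * cmod (triangle_integral f (step T))].
  have [|step ?] := @choice _ _ (fun T T' => in_ball rho T ->
    [/\ in_ball rho T', perimeter T' = perimeter T / 2,
    cmod (T'.1.1 - T.1.1) <= perimeter T / 2 &
    cmod (triangle_integral f T) <= 4 * cmod (triangle_integral f T')]).
    move=> T; have [Tin|Tn] := pselect (in_ball rho T); last by exists T => /Tn.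
    by have [T' HT'] := triangle_subdivision f rho T fc rho1 Tin; exists T'.
  by exists step.
pose T n := iter n step (a, b, c).
pose K := perimeter (a, b, c).
have K0 : 0 <= K by rewrite /K /perimeter !addr_ge0 ?cmod_ge0.
have Tin n : in_ball rho (T n).
  by elim: n => [//|n /Hstep[]].
have perT n : perimeter (T n) = K / 2 ^+ n.
  elim: n => [|n IH]; first by rewrite expr0 divr1.
  by have [_ -> _ _] := Hstep _ (Tin n); rewrite -/(T n) IH exprS; field.
have ITn n : cmod (triangle_integral f (a, b, c)) <=
    4 ^+ n * cmod (triangle_integral f (T n)).
  elim: n => [|n IH]; first by rewrite expr0 mul1r.
  have [_ _ _ h] := Hstep _ (Tin n); apply: le_trans IH _.
  by rewrite exprSr -mulrA ler_wpM2l // exprn_ge0.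
have [z Hz] : exists z, forall n, cmod ((T n).1.1 - z) <= K / 2 ^+ n.
  apply: cgeometric_limit => n; have [_ _ h _] := Hstep _ (Tin n).
  apply: le_trans h _; rewrite -/(T n) perT exprS.
  by rewrite le_eqVlt; apply/orP; left; apply/eqP; field.
have small e : 0 < e -> exists n, K / 2 ^+ n < e.
  move=> e0.
  have [n _ Hn] : \forall n \near \oo, `|0 - K * (2^-1 ^+ n)| < e.
    have : (fun n => K * (2^-1 : R) ^+ n) @ \oo --> K * 0.
      by apply: cvgMr; apply: cvg_expr; rewrite ger0_norm ?invr_ge0 // invf_lt1 // ltr1n.
    by rewrite mulr0 => /cvgrPdist_lt /(_ _ e0).
  exists n; have := Hn n (leqnn n); rewrite /= sub0r normrN exprVn ger0_norm //.
  by rewrite divr_ge0 // exprn_ge0.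
have zD : unit_disc z.
  rewrite /unit_disc /=.
  have [n Hn] : exists n, K / 2 ^+ n < (1 - rho) / 2.
    by apply: small; rewrite divr_gt0 // subr_gt0.
  have [h _ _] := Tin n.
  have := cmodB z (T n).1.1; have := Hz n; rewrite cmodBC; lra.
have [d Hd] := fh _ zD.
(* The constant 6 is 2, from bounding real and imaginary parts separately, times 3, from |w - z| <=
   3k on a triangle of perimeter k = K / 2^n. *)
suff H e : 0 < e -> cmod (triangle_integral f (a, b, c)) <= 6 * e * K ^+ 2.
  apply/eqP; rewrite -cmod_eq0 eq_le cmod_ge0 andbT.
  apply/ler_addgt0Pl => e e0; rewrite addr0.
  have K1 : 0 < 6 * (K ^+ 2 + 1) by rewrite mulr_gt0 // ltr_wpDl // sqr_ge0.
  apply: le_trans (H (e / (6 * (K ^+ 2 + 1))) (divr_gt0 e0 K1)) _.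
  rewrite [leLHS](_ : _ = e * (6 * K ^+ 2 / (6 * (K ^+ 2 + 1)))); last by ring.
  apply: ler_piMr; first exact: ltW.
  by rewrite ler_pdivrMr // mul1r; lra.
move=> e0; have [r r0 Hr] := Hd _ e0.
have [n Hn] : exists n, K / 2 ^+ n < r / 3 by apply: small; rewrite divr_gt0.
apply: le_trans (ITn n) _.
set k := K / 2 ^+ n in Hn.
have k0 : 0 <= k by rewrite divr_ge0 // exprn_ge0.
have := Tin n; have := perT n; have := Hz n; rewrite -/k.
case: (T n) => [[a' b'] c'] /= za per [/= ha' hb' hc'].
have D w : cmod w <= rho -> unit_disc w.
  by move=> h; rewrite /unit_disc /=; apply: le_lt_trans rho1.
have {}ha' := D _ ha'; have {}hb' := D _ hb'; have {}hc' := D _ hc'.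
pose aff w := f z + d * (w - z); pose rem w := f w - aff w.
have affc : ccont_disc aff.
  move=> w _; apply: ccontD; first exact: cdiff_cont (cdiff_cst _ _).
  exact: cdiff_cont (cdiffZ _ _ _ _ (cdiff_shift _ _)).
have remc : ccont_disc rem.
  move=> w hw; apply: ccontD; first exact: fc.
  apply: (ccont_ext (fun w => -1 * aff w)); first by move=> v; rewrite mulN1r.
  rewrite /aff.
  apply: cdiff_cont (cdiffZ _ _ _ _ (cdiffD _ _ _ _ _ (cdiff_cst _ _)
    (cdiffZ _ _ _ _ (cdiff_shift _ _)))).
have -> : triangle_integral f (a', b', c') = triangle_integral rem (a', b', c').
  have E u v : unit_disc u -> unit_disc v -> S f u v = S aff u v + S rem u v.
    move=> hu hv; rewrite -segment_integralB // !segment_integralE.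
    by congr (_ * _); apply: eq_cI => t _; rewrite /rem addrC subrK.
  rewrite -[RHS]add0r.
  rewrite -(triangle_integral_affine z (f z) d _ _ _ ha' hb' hc').
  by rewrite /triangle_integral /= !E // -/aff; ring.
have n1 := cmod_ge0 (a' - b'); have n2 := cmod_ge0 (b' - c').
have n3 := cmod_ge0 (c' - a').
rewrite /perimeter /= in per.
have edge u v : unit_disc u -> unit_disc v -> cmod (u - a') <= k ->
    cmod (v - a') <= k -> cmod (S rem u v) <= 2 * (3 * e * k) * cmod (v - u).
  move=> hu hv uk vk; apply: ler_segment_integral => // t t01.
  have wa : cmod (segment u v t - a') <= k.
    have -> : segment u v t - a' = segment (u - a') (v - a') t.
      by rewrite /segment; ring.
    exact: cmod_convex.
  have wz : cmod (segment u v t - z) <= 3 * k.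
    apply: le_trans (cmod_triangle _ a' _) _; lra.
  have wr : cmod (segment u v t - z) < r by lra.
  have := Hr _ wr; rewrite /rem /aff => h.
  rewrite opprD addrA; apply: le_trans h _.
  by rewrite mulrAC [_ * e]mulrC ler_wpM2l // ltW.
have aa : cmod (a' - a') <= k by rewrite subrr cmod0.
have bb : cmod (b' - a') <= k by rewrite cmodBC; lra.
have cc : cmod (c' - a') <= k by lra.
have h : cmod (triangle_integral rem (a', b', c')) <= 6 * e * k ^+ 2.
  have e1 := edge _ _ ha' hb' aa bb; have e2 := edge _ _ hb' hc' bb cc.
  have e3 := edge _ _ hc' ha' cc aa.
  rewrite /triangle_integral /=.
  apply: le_trans (cmodD _ _) _; apply: le_trans (lerD (cmodD _ _) (lexx _)) _.
  apply: le_trans (lerD (lerD e1 e2) e3) _.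
  rewrite -!mulrDr (cmodBC b' a') (cmodBC c' b') (cmodBC a' c') per.
  by rewrite le_eqVlt; apply/orP; left; apply/eqP; ring.
apply: (@le_trans _ _ (4 ^+ n * (6 * e * k ^+ 2))).
  by rewrite ler_wpM2l // exprn_ge0.
have -> : (4 : R) ^+ n = (2 ^+ n) ^+ 2.
  by rewrite -exprM mulnC exprM; congr (_ ^+ _); ring.
rewrite /k le_eqVlt; apply/orP; left; apply/eqP; field.
by rewrite expf_neq0.
Qed.

(** The primitive is the integral from 0 to z: Goursat on the triangle 0, z, w turns its increment
    into the integral over [z, w], where f is close to f z. *)
Theorem holo_primitive f : holo f ->
  exists F, forall z, unit_disc z -> cdiff F z (f z).
Proof.
move=> fh; have fc := holo_ccont _ fh.
exists (fun z => S f 0 z) => z hz e e0.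
have [r r0 Hr] := fc _ hz _ (divr_gt0 e0 (ltr0n R 2)).
have rz : 0 < 1 - cmod z by rewrite subr_gt0.
exists (Num.min r (1 - cmod z)); first by rewrite lt_min r0.
move=> w; rewrite lt_min => /andP[wr wz].
have hw : unit_disc w.
  by rewrite /unit_disc /=; have := cmodB w z; lra.
have D0 := @unit_disc0 R.
have : S f 0 w - S f 0 z = S f z w.
  have := goursat f 0 z w fh D0 hz hw; rewrite /triangle_integral /=.
  rewrite (segment_integral_rev f 0 w) // => /eqP; rewrite subr_eq0 => /eqP <-.
  by ring.
move=> ->.
have cc : ccont_disc (fun=> - f z) by move=> v _; exact: cdiff_cont (cdiff_cst _ _).
have E : S f z w - f z * (w - z) = S (fun v => f v + - f z) z w.
  rewrite segment_integralB //; congr (_ + _).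
  rewrite (segment_integral_FTC _ (fun v => - f z * v) _ _ cc) //; first by ring.
  move=> v _; apply: cdiff_eq (cdiffZ _ _ _ _ (cdiff_id _)); exact: mulr1.
rewrite E; have -> : e * cmod (w - z) = 2 * (e / 2) * cmod (w - z) by field.
apply: ler_segment_integral => //.
  by move=> v hv; apply: ccontD; [exact: fc|exact: cc].
move=> t t01; apply: Hr.
have -> : segment z w t - z = t%:C * (w - z) by rewrite /segment; ring.
rewrite cmodM cmodR; move: t01 => /andP[t0 t1]; rewrite ger0_norm //.
by apply: le_lt_trans wr; rewrite ler_piMl ?cmod_ge0.
Qed.

End Cauchy.

(** * Power series and termwise differentiation *)

Section PowerSeries.
Context {R : realType}.
Implicit Types (u v c : nat -> R[i]) (s z w : R[i]) (r rho : R).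

Lemma geometric_sum_le (q : R) N : 0 <= q -> q < 1 ->
  \sum_(n < N) q ^+ n <= (1 - q)^-1.
Proof.
move=> q0 q1; have h : 0 < 1 - q by rewrite subr_gt0.
rewrite -[leRHS]mul1r ler_pdivlMr //.
have -> : (\sum_(n < N) q ^+ n) * (1 - q) = 1 - q ^+ N.
  by rewrite -opprB mulrN mulrC -subrX1 opprB.
by rewrite gerBl exprn_ge0.
Qed.

(** q^n is the smallest of the n+1 terms of the geometric sum up to n. *)
Lemma muln_expr_le (q : R) n : 0 <= q -> q < 1 -> n.+1%:R * q ^+ n <= (1 - q)^-1.
Proof.
move=> q0 q1; apply: le_trans (geometric_sum_le q n.+1 q0 q1).
rewrite -[n.+1 in leLHS]card_ord -sum1_card natr_sum mulr_suml.
apply: ler_sum => i _; rewrite mul1r.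
by apply: ler_wiXn2l => //; [exact: ltW|rewrite -ltnS].
Qed.

(** Says that the radius of convergence is at least rho, through Abel's boundedness criterion.
    Boundedness passes more easily than summability to n c_n and to derivatives. *)
Definition tempered rho c : Prop :=
  forall r, 0 <= r < rho -> exists B, forall n, cmod (c n) * r ^+ n <= B.

(** Room between r and rho: boundedness at the intermediate radius r' (the midpoint) gives geometric
    decay with ratio q at r. *)
Lemma tempered_ratio rho r : 0 <= r < rho -> exists r' q,
  [/\ 0 < r', r < r' < rho, 0 <= q, q < 1 & r = r' * q].
Proof.
move=> /andP[r0 rr]; exists ((r + rho) / 2), (r / ((r + rho) / 2)).
have r'0 : 0 < (r + rho) / 2 by lra.
split => //; first by apply/andP; split; lra.
- by rewrite divr_ge0 // ltW.
- by rewrite ltr_pdivrMr // mul1r; lra.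
- by rewrite mulrC divfK // gt_eqF.
Qed.

Lemma tempered_summable rho c r : tempered rho c -> 0 <= r < rho ->
  exists K, forall N, \sum_(n < N) cmod (c n) * r ^+ n <= K.
Proof.
move=> tc /tempered_ratio[r' [q [r'0 /andP[rr' r'rho] q0 q1 ->]]].
have [B HB] := tc r' (introT andP (conj (ltW r'0) r'rho)).
have B0 : 0 <= B by apply: le_trans (HB 0%N); rewrite mulr_ge0 ?cmod_ge0 ?exprn_ge0 ?ltW.
exists (B * (1 - q)^-1) => N.
apply: (@le_trans _ _ (B * \sum_(n < N) q ^+ n)).
  rewrite mulr_sumr; apply: ler_sum => n _.
  by rewrite exprMn mulrA ler_wpM2r ?exprn_ge0.
by rewrite ler_wpM2l // geometric_sum_le.
Qed.

Lemma tempered_muln rho c : tempered rho c ->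
  tempered rho (fun n => n%:R * c n).
Proof.
move=> tc r /tempered_ratio[r' [q [r'0 /andP[rr' r'rho] q0 q1 ->]]].
have [B HB] := tc r' (introT andP (conj (ltW r'0) r'rho)).
have B0 : 0 <= B by apply: le_trans (HB 0%N); rewrite mulr_ge0 ?cmod_ge0 ?exprn_ge0 ?ltW.
exists (B * (1 - q)^-1) => n.
rewrite cmodM cmodn exprMn.
have -> : n%:R * cmod (c n) * (r' ^+ n * q ^+ n) =
  (cmod (c n) * r' ^+ n) * (n%:R * q ^+ n) by ring.
apply: ler_pM => //; first by rewrite mulr_ge0 ?cmod_ge0 ?exprn_ge0 ?ltW.
  by rewrite mulr_ge0 ?exprn_ge0.
apply: le_trans (muln_expr_le _ n q0 q1).
by rewrite ler_wpM2r ?exprn_ge0 // ler_nat.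
Qed.

Definition pderiv c : nat -> R[i] := fun n => n.+1%:R * c n.+1.

Lemma tempered_pderiv rho c : tempered rho c -> tempered rho (pderiv c).
Proof.
move=> tc r rr; have [r' [q [r'0 /andP[rr' r'rho] q0 q1 _]]] := tempered_ratio _ _ rr.
have [B HB] := tempered_muln _ _ tc r' (introT andP (conj (ltW r'0) r'rho)).
exists (B / r') => n; rewrite ler_pdivlMr //; apply: le_trans (HB n.+1).
rewrite exprSr mulrA ler_wpM2r ?(ltW r'0) // ler_wpM2l ?cmod_ge0 //.
by apply: lerXn2r; rewrite ?nnegrE ?(ltW r'0) ?(ltW rr') //; case/andP: rr.
Qed.

Lemma has_csum_tempered rho c z : tempered rho c -> cmod z < rho ->
  exists s, has_csum (fun n => c n * z ^+ n) s.
Proof.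
move=> tc zr.
have [|K HK] := tempered_summable _ _ (cmod z) tc; first by rewrite cmod_ge0.
apply: (has_csum_abs _ K) => N; apply: le_trans (HK N).
by apply: ler_sum => n _; rewrite cmodM cmodX.
Qed.

(** Second-order remainder of w^n, by induction on n. The factor r^2 stands on the left to avoid the
    exponent n - 2. *)
Lemma expr_taylor1 r z w n : 0 <= r -> cmod z <= r -> cmod w <= r ->
  r ^+ 2 * cmod (w ^+ n - z ^+ n - n%:R * z ^+ n.-1 * (w - z)) <=
  n%:R ^+ 2 * r ^+ n * cmod (w - z) ^+ 2.
Proof.
move=> r0 zr wr; set h := cmod (w - z).
have h0 : 0 <= h := cmod_ge0 _.
elim: n => [|n IH].
  by rewrite !expr0 subrr !mul0r subrr cmod0 mulr0 expr0n !mul0r.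
have E : w ^+ n.+1 - z ^+ n.+1 - n.+1%:R * z ^+ n * (w - z) =
  w * (w ^+ n - z ^+ n - n%:R * z ^+ n.-1 * (w - z)) +
  n%:R * z ^+ n.-1 * (w - z) ^+ 2.
  case: n {IH} => [|n]; first by rewrite !expr1 !expr0; ring.
  have -> : n.+2%:R = n.+1%:R + 1 :> R[i] by rewrite natr1.
  rewrite /= !(exprS _ n.+1) !(exprS _ n); set k := n.+1%:R; ring.
rewrite /= E.
have r20 : 0 <= r ^+ 2 by rewrite exprn_ge0.
apply: le_trans (ler_wpM2l r20 (cmodD _ _)) _.
rewrite mulrDr !cmodM cmodn !cmodX -/h.
have h1 : r ^+ 2 * (cmod w * cmod (w ^+ n - z ^+ n - n%:R * z ^+ n.-1 * (w - z)))
    <= r * (n%:R ^+ 2 * r ^+ n * h ^+ 2).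
  rewrite mulrCA; apply: ler_pM => //; rewrite ?cmod_ge0 // mulr_ge0 ?cmod_ge0 //.
have h2 : r ^+ 2 * (n%:R * cmod z ^+ n.-1 * h ^+ 2) <= r ^+ n.+1 * n%:R * h ^+ 2.
  case: n {IH E h1} => [|n]; first by rewrite !(mul0r, mulr0).
  rewrite /= mulrA ler_wpM2r ?exprn_ge0 // mulrCA mulrC ler_wpM2r //.
  have -> : r ^+ n.+2 = r ^+ 2 * r ^+ n by rewrite -exprD.
  by rewrite ler_wpM2l //; apply: lerXn2r => //; rewrite nnegrE ?cmod_ge0.
apply: le_trans (lerD h1 h2) _.
have -> : r * (n%:R ^+ 2 * r ^+ n * h ^+ 2) + r ^+ n.+1 * n%:R * h ^+ 2 =
  (n%:R ^+ 2 + n%:R) * (r ^+ n.+1 * h ^+ 2) by rewrite (exprS r n); ring.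
rewrite -[leRHS]mulrA ler_wpM2r ?mulr_ge0 ?exprn_ge0 //.
rewrite -natr1 sqrrD; have : 0 <= (n%:R : R) by []. by lra.
Qed.

(** On a disc of radius r < rho the termwise remainders add up to at most |w - z|^2 / r^2 times sum
    n^2 |c_n| r^n, which is finite because multiplying the coefficients by n twice preserves the
    radius. *)
Lemma cdiff_power_series rho c (g : R[i] -> R[i]) z s : tempered rho c ->
  cmod z < rho ->
  (forall w, cmod w < rho -> has_csum (fun n => c n * w ^+ n) (g w)) ->
  has_csum (fun n => pderiv c n * z ^+ n) s -> cdiff g z s.
Proof.
move=> tc zrho Hg Hs.
have [|r [q [r0 /andP[zr rrho] _ _ _]]] := tempered_ratio rho (cmod z).
  by rewrite cmod_ge0.
have [K HK] := tempered_summable _ _ r (tempered_muln _ _ (tempered_muln _ _ tc))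
  (introT andP (conj (ltW r0) rrho)).
have K0 : 0 <= K by apply: le_trans (HK 0%N); rewrite big_ord0.
(* Back to the unshifted index; the term n = 0 vanishes because of its factor 0, whatever [0.-1]
   is. *)
have {}Hs : has_csum (fun n => c n * (n%:R * z ^+ n.-1)) s.
  rewrite -[s](add0r s); have -> : 0 = c 0%N * (0%:R * z ^+ 0.-1) by rewrite mul0r mulr0.
  apply/(has_csum_shift (fun n => c n * (n%:R * z ^+ n.-1))).
  by apply: eq_has_csum Hs => n; rewrite /pderiv /=; ring.
move=> e e0.
have A0 : 0 < (K + 1) / r ^+ 2 by rewrite divr_gt0 ?exprn_gt0 // ltr_wpDl.
exists (Num.min (r - cmod z) (e / ((K + 1) / r ^+ 2))).
  by rewrite lt_min subr_gt0 zr divr_gt0.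
move=> w; rewrite lt_min => /andP[wr we].
have {}wr : cmod w < r by have := cmodB w z; lra.
have H : has_csum (fun n => c n * (w ^+ n - z ^+ n - n%:R * z ^+ n.-1 * (w - z)))
    (g w - g z - s * (w - z)).
  have H1 := Hg w (lt_trans wr rrho); have H2 := Hg z zrho.
  have := has_csumD _ _ _ _ H1 (has_csumD _ _ _ _ (has_csumZ (-1) _ _ H2)
     (has_csumZ (- (w - z)) _ _ Hs)).
  have -> : g w + (-1 * g z + - (w - z) * s) = g w - g z - s * (w - z) by ring.
  by apply: eq_has_csum => n; ring.
apply: (@le_trans _ _ (K / r ^+ 2 * cmod (w - z) ^+ 2)).
  apply: has_csum_le H _ => N.
  have r20 : 0 < r ^+ 2 by rewrite exprn_gt0.
  rewrite mulrAC ler_pdivlMr //.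
  apply: (@le_trans _ _ ((\sum_(n < N) cmod (n%:R * (n%:R * c n)) * r ^+ n)
     * cmod (w - z) ^+ 2)); last by rewrite ler_wpM2r // exprn_ge0 // cmod_ge0.
  rewrite !mulr_suml; apply: ler_sum => n _; rewrite !cmodM !cmodn.
  have := expr_taylor1 r z w n (ltW r0) (ltW zr) (ltW wr).
  move=> /(ler_wpM2l (cmod_ge0 (c n))) h; apply: le_trans (_ : _ <= _) (le_trans h _).
    by rewrite le_eqVlt; apply/orP; left; apply/eqP; ring.
  by rewrite le_eqVlt; apply/orP; left; apply/eqP; ring.
rewrite [cmod _ ^+ 2]expr2 mulrA ler_wpM2r ?cmod_ge0 //.
apply: (@le_trans _ _ ((K + 1) / r ^+ 2 * cmod (w - z))).
  apply: ler_wpM2r; first exact: cmod_ge0.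
  apply: ler_wpM2r; first by rewrite invr_ge0 exprn_ge0 // ltW.
  by rewrite lerDl.
by rewrite mulrC -ler_pdivlMr // ltW.
Qed.

End PowerSeries.

(** * Removable singularities and integration over circles *)

Section CauchyFormula.
Context {R : realType}.
Implicit Types (f g F : R[i] -> R[i]) (z w d : R[i]) (rho t : R).

Notation S := segment_integral.

Lemma cdiff_invB z w : w != z ->
  cdiff (fun v => (v - z)^-1) w (- (w - z)^-1 ^+ 2).
Proof.
move=> wz e e0; have u0 : w - z != 0 by rewrite subr_eq0.
set m := cmod (w - z); have m0 : 0 < m by rewrite cmod_gt0.
have m3 : 0 < m ^+ 3 by rewrite exprn_gt0.
(* Within m / 2 of w the distance to z stays at least m / 2, so the error |v - w|^2 / (|v - z| m^2)
   is at most 2 |v - w|^2 / m^3. *)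
exists (Num.min (m / 2) (e * (m ^+ 3 / 2))).
  by rewrite lt_min divr_gt0 //= mulr_gt0 // divr_gt0.
move=> v; rewrite lt_min => /andP[v1 v2].
have vm : m / 2 <= cmod (v - z).
  have := cmod_triangle w v z; rewrite (cmodBC w v) -/m; lra.
have v0 : v - z != 0 by rewrite -cmod_gt0; apply: lt_le_trans vm; lra.
have -> : (v - z)^-1 - (w - z)^-1 - - (w - z)^-1 ^+ 2 * (v - w) =
  (v - w) * ((v - w) * ((v - z)^-1 * (w - z)^-1 ^+ 2)) by field; rewrite u0.
rewrite cmodM mulrC; apply: ler_wpM2r; first exact: cmod_ge0.
rewrite cmodM cmodM cmodX !cmodV -/m.
have h : (cmod (v - z))^-1 <= 2 / m.
  by rewrite -[2 / m]invf_div lef_pV2 // posrE; lra.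
apply: (@le_trans _ _ (e * (m ^+ 3 / 2) * (2 / m * m^-1 ^+ 2))).
  apply: ler_pM; rewrite ?cmod_ge0 ?(ltW v2) //.
    by rewrite mulr_ge0 ?invr_ge0 ?cmod_ge0 ?exprn_ge0 // invr_ge0 ltW.
  by rewrite ler_wpM2r // exprn_ge0 // invr_ge0 ltW.
rewrite le_eqVlt; apply/orP; left; apply/eqP; field; exact: lt0r_neq0.
Qed.

Lemma cdiffX f z d n : cdiff f z d ->
  cdiff (fun w => f w ^+ n) z (n%:R * f z ^+ n.-1 * d).
Proof.
move=> fd; elim: n => [|n IH].
  rewrite mul0r mul0r; exact: cdiff_cst.
apply: (cdiff_ext (fun w => f w * f w ^+ n) _ _ _ 1 ltr01).
  by move=> w _; rewrite exprS.
apply: cdiff_eq (cdiffM _ _ _ _ _ fd IH); rewrite /= -natr1.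
case: n {IH} => [|n]; first by rewrite expr0; ring.
by rewrite /= exprS; ring.
Qed.

Lemma cI_id c : cI (fun t => t%:C * c) = c / 2 :> R[i].
Proof.
have D t : rdiff (fun s : R => c / 2 * ((0 + s%:C * 1) ^+ 2)) t (t%:C * c).
  have := rdiffZ (c / 2) _ _ _ (rdiff_comp _ _ _ _ _ (cdiffX _ _ _ 2 (cdiff_id _))
     (rdiff_affine 0 1 t)).
  by congr rdiff; rewrite /=; field.
rewrite (cI_FTC _ _ _ (fun t _ => D t)); first by rewrite /= rmorph0 rmorph1; field.
move=> t _; apply: rdiff_cont.
have := rdiff_affine 0 c t; congr rdiff; apply/funext => s; exact: add0r.
Qed.

(* [g w = \int_0^1 f(z + t (w - z)) dt] is the difference quotient of F with its
   singularity at z already removed. *)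
Lemma holo_quotient f F z : holo f ->
  (forall w, unit_disc w -> cdiff F w (f w)) -> unit_disc z ->
  exists2 g, holo g & forall w, unit_disc w -> (w - z) * g w = F w - F z.
Proof.
move=> fh Fd hz; have fc := holo_ccont _ fh.
pose g w := cI (fun t => f (segment z w t)).
have gE w : unit_disc w -> (w - z) * g w = F w - F z.
  by move=> hw; rewrite -(segment_integral_FTC f F z w fc hz hw Fd).
exists g => // w hw.
have rw : 0 < 1 - cmod w by rewrite subr_gt0.
have near_disc v : cmod (v - w) < 1 - cmod w -> unit_disc v.
  by move=> h; rewrite /unit_disc /=; have := cmodB v w; lra.
have [->|wz] := eqVneq w z; last first.
  have wz0 : 0 < cmod (w - z) by rewrite cmod_gt0 subr_eq0.
  eexists; apply: (cdiff_ext (fun v => (v - z)^-1 * (F v + - F z)) _ _ _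
     (Num.min (1 - cmod w) (cmod (w - z)))).
  - by rewrite lt_min rw.
  - move=> v; rewrite lt_min => /andP[/near_disc hv vz].
    rewrite -gE // mulKf // subr_eq0; apply/eqP => E.
    by move: vz; rewrite E cmodBC ltxx.
  - apply: cdiffM; first exact: cdiff_invB.
    apply: cdiffD; [exact: Fd|exact: cdiff_cst].
(* At z itself f (z + t (w - z)) = f z + t d (w - z) + o(w - z), and the integral of t over [0, 1]
   is 1/2. *)
have [d Hd] := fh _ hz; exists (d / 2) => e e0.
have [r r0 Hr] := Hd _ (divr_gt0 e0 (ltr0n R 2)).
have rz : 0 < 1 - cmod z by rewrite subr_gt0.
exists (Num.min r (1 - cmod z)); first by rewrite lt_min r0.
move=> v; rewrite lt_min => /andP[vr vz].
have hv : unit_disc v.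
  by rewrite /unit_disc /=; have := cmodB v z; lra.
have gzz : g z = cI (fun=> f z).
  by apply: eq_cI => t _; rewrite /segment subrr mulr0 addr0.
have Ic (c : R[i]) : cintegrable (fun=> c : R[i]).
  by apply: rcont_cintegrable => t _ e' e'0; exists 1 => // s _; rewrite subrr cmod0 ltW.
have It (c : R[i]) : cintegrable (fun t : R => t%:C * c).
  apply: rcont_cintegrable => t _; apply: rdiff_cont.
  have := rdiff_affine 0 c t; congr rdiff; apply/funext => s; exact: add0r.
have If : cintegrable (fun t => f (segment z v t)) by exact: cintegrable_segment.
have -> : g v - g z - d / 2 * (v - z) =
    cI (fun t => f (segment z v t) + (-1 * f z + -1 * (t%:C * (d * (v - z))))).
  rewrite cID // ?cID ?cIZ ?cI_id -?gzz //.
  - by rewrite /g; field.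
  - exact: (cintegrableZ _ _ (It _)).
  - exact: (cintegrableD _ _ (Ic _) (cintegrableZ _ _ (It _))).
have -> : e * cmod (v - z) = 2 * (e / 2 * cmod (v - z)) by field.
apply: ler_cmod_cI_cst.
  exact: (cintegrableD _ _ If (cintegrableD _ _ (Ic _) (cintegrableZ _ _ (It _)))).
move=> t /andP[t0 t1].
have sE : segment z v t - z = t%:C * (v - z) by rewrite /segment; ring.
have -> : f (segment z v t) + (-1 * f z + -1 * (t%:C * (d * (v - z)))) =
  f (segment z v t) - f z - d * (segment z v t - z) by rewrite sE; ring.
have le : cmod (segment z v t - z) <= cmod (v - z).
  by rewrite sE cmodM cmodR ger0_norm ?(ltW t0) // ler_piMl ?cmod_ge0 // ltW.
apply: le_trans (Hr _ _) _; first exact: le_lt_trans le vr.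
by rewrite ler_wpM2l // divr_ge0 // ltW.
Qed.

(** Parametrized by [0, 1], so that [cI] over the circle is a mean value and Cauchy's formula
    carries no factor 2 pi i. *)
Definition circle rho t : R[i] := rho%:C * (cos (2 * pi * t) +i* sin (2 * pi * t)).

Lemma cmod_circle rho t : 0 <= rho -> cmod (circle rho t) = rho.
Proof.
move=> r0; rewrite /circle cmodM cmodR ger0_norm //.
have -> : cmod (cos (2 * pi * t) +i* sin (2 * pi * t)) = 1; last by rewrite mulr1.
apply/eqP; rewrite -(eqrXn2 (n := 2)) ?cmod_ge0 //.
by rewrite cmod_sqr /= cos2Dsin2 expr1n.
Qed.

Lemma rdiff_circle rho t :
  rdiff (circle rho) t ((0 +i* (2 * pi)) * circle rho t).
Proof.
suff : rdiff (fun t : R => cos (2 * pi * t) +i* sin (2 * pi * t)) t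
    ((0 +i* (2 * pi)) * (cos (2 * pi * t) +i* sin (2 * pi * t))).
  by move=> /(rdiffZ rho%:C); congr rdiff; rewrite /circle; ring.
have D : derivable (fun s : R => 2 * pi * s) t 1 by exact: derivableM.
have DE : derive1 (fun s : R => 2 * pi * s) t = 2 * pi.
  by rewrite derive1E deriveMl // derive_id /GRing.scale /= mulr1.
apply: rdiff_ReIm => /=.
- have Dc : derivable (@cos R) (2 * pi * t) 1 by exact: derivable_cos.
  split; first by apply/derivable1_diffP; apply: (@differentiable_comp _ _ _ _ (fun s : R => 2 * pi * s) cos); apply/derivable1_diffP.
  rewrite -[LHS]/(derive1 (cos \o (fun s : R => 2 * pi * s)) t).
  by rewrite derive1_comp // DE derive1E derive_val; ring.
- have Dc : derivable (@sin R) (2 * pi * t) 1 by exact: derivable_sin.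
  split; first by apply/derivable1_diffP; apply: (@differentiable_comp _ _ _ _ (fun s : R => 2 * pi * s) sin); apply/derivable1_diffP.
  rewrite -[LHS]/(derive1 (sin \o (fun s : R => 2 * pi * s)) t).
  by rewrite derive1_comp // DE derive1E derive_val; ring.
Qed.

Lemma circle01 rho : circle rho 1 = circle rho 0.
Proof.
rewrite /circle mulr1 mulr0 cos0 sin0; congr (_ * (_ +i* _)).
  by rewrite mulr_natl cos2pi.
by rewrite mulr_natl sin2pi.
Qed.

Lemma rcont_bounded (g : R -> R[i]) : (forall t, 0 <= t <= 1 -> rcont g t) ->
  exists K, forall t, 0 <= t <= 1 -> cmod (g t) <= K.
Proof.
move=> gc.
have [c _ Hc] : exists2 c, c \in `[0 : R, 1] & forall t, t \in `[0 : R, 1] ->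
    cmod (g t) <= cmod (g c).
  apply: EVT_max => //; apply: continuous_in_subspaceT => t.
  rewrite inE /= in_itv /= => /gc H.
  apply/cvgrPdist_le => e /H[r r0 Hr]; exists r => // s /=.
  rewrite distrC => /Hr; apply: le_trans.
  rewrite ler_norml; apply/andP; split.
    by have := cmodB (g s) (g t); lra.
  by have := cmodB (g t) (g s); rewrite (cmodBC (g t)); lra.
by exists (cmod (g c)) => t t01; apply: Hc; rewrite in_itv.
Qed.

End CauchyFormula.

(** * Expansion of integrals with a geometric kernel *)

Section GeometricKernel.
Context {R : realType}.
Implicit Types (f g F B r : R[i] -> R[i]) (z w c : R[i]).

Lemma ccontM f g w : ccont_at f w -> ccont_at g w ->
  ccont_at (fun v => f v * g v) w.
Proof.
move=> fc gc e e0.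
set M := cmod (f w) + cmod (g w) + 1.
have M0 : 0 < M by rewrite ltr_wpDl ?addr_ge0 ?cmod_ge0.
set e' := Num.min 1 (e / M).
have e'0 : 0 < e' by rewrite lt_min ltr01 divr_gt0.
have e'1 : e' <= 1 by rewrite ge_min lexx.
have e'M : e' * M <= e by rewrite -ler_pdivlMr // ge_min lexx orbT.
have [r r0 Hr] := fc _ e'0; have [r1 r10 Hr1] := gc _ e'0.
exists (Num.min r r1); first by rewrite lt_min r0.
move=> v; rewrite lt_min => /andP[/Hr {}Hr /Hr1 {}Hr1].
have -> : f v * g v - f w * g w = (f v - f w) * (g v - g w) +
  ((f v - f w) * g w + f w * (g v - g w)) by ring.
apply: le_trans (cmodD _ _) _; apply: le_trans (lerD (lexx _) (cmodD _ _)) _.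
rewrite !cmodM.
have h1 : cmod (f v - f w) * cmod (g v - g w) <= e' * 1.
  by apply: ler_pM; rewrite ?cmod_ge0 // (le_trans Hr1).
have h2 : cmod (f v - f w) * cmod (g w) <= e' * cmod (g w).
  by apply: ler_wpM2r; rewrite ?cmod_ge0.
have h3 : cmod (f w) * cmod (g v - g w) <= cmod (f w) * e'.
  by apply: ler_wpM2l; rewrite ?cmod_ge0.
apply: le_trans e'M; rewrite /M; lra.
Qed.

Lemma ccont_comp F f z : ccont_at F (f z) -> ccont_at f z ->
  ccont_at (fun w => F (f w)) z.
Proof.
move=> Fc fc e /Fc[d d0 Hd]; have [d' d'0 Hd'] := fc (d / 2) (divr_gt0 d0 (ltr0n R 2)).
by exists d' => // w /Hd' h; apply: Hd; apply: le_lt_trans h _; lra.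
Qed.

Lemma ccont_cst c z : ccont_at (fun=> c) z.
Proof. exact: cdiff_cont (cdiff_cst c z). Qed.

Lemma ccont_id z : ccont_at id z.
Proof. exact: cdiff_cont (cdiff_id z). Qed.

Lemma ccontX n z : ccont_at (fun w => w ^+ n) z.
Proof. exact: cdiff_cont (cdiffX _ _ _ n (cdiff_id z)). Qed.

Lemma ccontV f z : ccont_at f z -> f z != 0 -> ccont_at (fun w => (f w)^-1) z.
Proof.
move=> fc fz; apply: (ccont_comp (fun w => w^-1)) => //.
by have := cdiff_cont _ _ _ (cdiff_invB 0 _ fz); under eq_fun do rewrite subr0.
Qed.

Lemma ccont_affine a c z : ccont_at (fun w => a + c * w) z.
Proof. exact: ccontD (ccont_cst a z) (ccontM _ _ _ (ccont_cst c z) (ccont_id z)). Qed.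

(** After N terms the remainder of the geometric series is the full integrand times (r z)^N, hence
    at most a constant times q^N. This produces the coefficients in z both of Cauchy's kernel and of
    the kernels of the operators. *)
Lemma has_csum_geometric (g : R -> R[i]) B r z (q : R) :
  (forall t, 0 <= t <= 1 -> rcont g t) ->
  (forall t, 0 <= t <= 1 -> ccont_at B (g t)) ->
  (forall t, 0 <= t <= 1 -> ccont_at r (g t)) ->
  (forall t, 0 <= t <= 1 -> cmod (r (g t)) * cmod z <= q) -> q < 1 ->
  has_csum (fun n => cI (fun t => B (g t) * r (g t) ^+ n) * z ^+ n)
    (cI (fun t => B (g t) * (1 - r (g t) * z)^-1)).
Proof.
move=> gc Bc rc rq q1.
have nz t : 0 <= t <= 1 -> 1 - r (g t) * z != 0.
  move=> t01; rewrite -cmod_gt0; have := cmodB 1 (r (g t) * z).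
  by rewrite cmod1 cmodM; have := rq t t01; lra.
have Bn n t : 0 <= t <= 1 -> rcont (fun t => B (g t) * r (g t) ^+ n) t.
  move=> t01; apply: (rcont_comp (fun w => B w * r w ^+ n)); last exact: gc.
  apply: ccontM; first exact: Bc.
  by apply: (ccont_comp (fun w => w ^+ n)); [exact: ccontX|exact: rc].
have Bi t : 0 <= t <= 1 -> rcont (fun t => B (g t) * (1 - r (g t) * z)^-1) t.
  move=> t01; apply: (rcont_comp (fun w => B w * (1 - r w * z)^-1)); last exact: gc.
  apply: ccontM; first exact: Bc.
  apply: ccontV; last exact: nz.
  have -> : (fun w => 1 - r w * z) = (fun w => 1 + (- z) * r w) by apply/funext => w; ring.
  by apply: (ccont_comp (fun w => 1 + (- z) * w)); [exact: ccont_affine|exact: rc].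
have [K HK] := rcont_bounded _ Bi.
have K0 : 0 <= K.
  by apply: le_trans (cmod_ge0 _) (HK 0 _); rewrite lexx ler01.
apply: (has_csum_squeeze _ _ (fun N => 2 * K * q ^+ N)).
  rewrite -[X in _ --> X](mulr0 (2 * K)); apply: cvgMr; apply: cvg_expr.
  rewrite ger0_norm //; apply: le_trans (rq 0 _); last by rewrite lexx ler01.
  by rewrite mulr_ge0 ?cmod_ge0.
move=> N.
pose h n t := z ^+ n * (B (g t) * r (g t) ^+ n).
have hI n : cintegrable (h n).
  by apply: cintegrableZ; apply: rcont_cintegrable => t; exact: Bn.
have -> : \sum_(n < N) cI (fun t => B (g t) * r (g t) ^+ n) * z ^+ n =
    cI (fun t => \sum_(n < N) h n t).
  rewrite (cI_sum N h hI); apply: eq_bigr => n _; rewrite /h cIZ 1?mulrC //.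
  by apply: rcont_cintegrable => t; exact: Bn.
have BI : cintegrable (fun t => (-1) * (B (g t) * (1 - r (g t) * z)^-1)).
  by apply: cintegrableZ; apply: rcont_cintegrable => t; exact: Bi.
rewrite -[X in _ - X]mul1r -mulNr -cIZ -?cID //; first last.
- by apply: rcont_cintegrable => t; exact: Bi.
- exact: cintegrable_sum.
rewrite -mulrA; apply: ler_cmod_cI_cst.
  by apply: cintegrableD => //; exact: cintegrable_sum.
move=> t /andP[t0 t1]; have t01 : 0 <= t <= 1 by rewrite !ltW.
have -> : \sum_(n < N) h n t + (-1) * (B (g t) * (1 - r (g t) * z)^-1) =
    - (B (g t) * (1 - r (g t) * z)^-1) * (r (g t) * z) ^+ N.
  have := subrX1 (r (g t) * z) N.
  have -> : \sum_(n < N) h n t = B (g t) * \sum_(n < N) (r (g t) * z) ^+ n.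
    by rewrite mulr_sumr; apply: eq_bigr => n _; rewrite /h exprMn mulrCA [z ^+ n * _]mulrC.
  move: (\sum_(_ < _) _) ((r (g t) * z) ^+ N) (nz t t01) => S x n0 e.
  have -> : x = 1 + (r (g t) * z - 1) * S by rewrite -e; ring.
  by field.
rewrite cmodM cmodN cmodX; apply: ler_pM; rewrite ?exprn_ge0 ?cmod_ge0 //; first exact: HK.
rewrite (cmodM (r (g t))); apply: lerXn2r; rewrite ?nnegrE ?mulr_ge0 ?cmod_ge0 //; last exact: rq.
by apply: le_trans (rq t t01); rewrite mulr_ge0 ?cmod_ge0.
Qed.

End GeometricKernel.

Section Taylor.
Context {R : realType}.
Implicit Types (f g F : R[i] -> R[i]) (z w d : R[i]) (rho t : R).

Lemma rcont_circle rho t : rcont (circle rho) t.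
Proof. exact: rdiff_cont (rdiff_circle rho t). Qed.

Lemma cdiff_contM f g z d d' : cdiff f z d -> cdiff g z d' ->
  ccont_at (fun w => f w * g w) z.
Proof. by move=> fd gd; exact: cdiff_cont (cdiffM _ _ _ _ _ fd gd). Qed.

Lemma cdiff_inv_expr w n : w != 0 -> cdiff (fun w => w^-1 ^+ n) w
  (n%:R * w^-1 ^+ n.-1 * (- w^-1 ^+ 2)).
Proof.
move=> w0; apply: cdiffX.
have := cdiff_invB 0 w w0; rewrite subr0.
by apply: (cdiff_ext _ _ _ _ 1 ltr01) => v _; rewrite subr0.
Qed.

Section Circle.
Variables (rho : R) (rho0 : 0 < rho).
Notation gam := (circle rho).

Let gam_neq0 t : gam t != 0.
Proof. by rewrite -cmod_gt0 cmod_circle // ltW. Qed.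

(** For n > 0 the function gam^(-n) is, up to the nonzero factor k = -2 pi i n, its own derivative
    in t, and the curve is closed. *)
Lemma cI_circle_expV n : cI (fun t => (gam t)^-1 ^+ n) = (n == 0%N)%:R.
Proof.
case: n => [|n].
  rewrite (eq_cI _ (fun=> 1)) ?(cI_FTC (fun t => 0 + t%:C * 1)) //=.
  - by rewrite rmorph0 rmorph1; ring.
  - by move=> t _ e e0; exists 1 => // s _; rewrite subrr cmod0 ltW.
  - by move=> t _; exact: rdiff_affine.
have p0 : (0 +i* (2 * pi) : R[i]) != 0.
  by rewrite -cmod_gt0 (lt_le_trans _ (ler_Im_cmod _)) //= normr_gt0 mulf_neq0 // gt_eqF ?pi_gt0.
set k : R[i] := - (n.+1%:R) * (0 +i* (2 * pi)).
have k0 : k != 0 by rewrite mulf_neq0 // oppr_eq0 pnatr_eq0.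
have C t : rcont (fun s => (gam s)^-1 ^+ n.+1) t.
  apply: (rcont_comp (fun w => w^-1 ^+ n.+1)); last exact: rcont_circle.
  exact: cdiff_cont (cdiff_inv_expr _ _ (gam_neq0 t)).
apply: (mulfI k0); rewrite mulr0 -cIZ; last by apply: rcont_cintegrable.
rewrite (cI_FTC (fun t => (gam t)^-1 ^+ n.+1)).
- by rewrite circle01 subrr.
- move=> t _; apply: (rcont_comp (fun w => k * w)) (C t).
  exact: cdiff_cont (cdiffZ _ _ _ _ (cdiff_id _)).
- move=> t _; have := rdiff_comp _ _ _ _ _ (cdiff_inv_expr _ n.+1 (gam_neq0 t))
    (rdiff_circle rho t).
  congr rdiff; rewrite /k /= (exprS _ n); set v := _ ^+ n; field; exact: gam_neq0.
Qed.

(** gam / (gam - z) is the geometric series in z / gam, of modulus |z| / rho < 1. *)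
Lemma cauchy_kernel_expansion (H : R[i] -> R[i]) z :
  (forall t, 0 <= t <= 1 -> ccont_at H (gam t)) -> cmod z < rho ->
  has_csum (fun n => cI (fun t => H (gam t) * (gam t)^-1 ^+ n) * z ^+ n)
    (cI (fun t => H (gam t) * (gam t * (gam t - z)^-1))).
Proof.
move=> Hc zr.
have := has_csum_geometric gam H (fun w => w^-1) z (cmod z / rho)
  (fun t _ => rcont_circle rho t) Hc (fun t _ => ccontV id _ (ccont_id _) (gam_neq0 t)).
rewrite (eq_cI (fun t => _ * (1 - _)^-1) (fun t => H (gam t) * (gam t * (gam t - z)^-1))).
  apply; last by rewrite ltr_pdivrMr // mul1r.
  by move=> t _; rewrite cmodV cmod_circle ?(ltW rho0) // mulrC.
move=> t _; congr (_ * _); have g0 := gam_neq0 t.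
have gz : gam t - z != 0.
  by rewrite subr_eq0; apply/eqP => E; move: zr; rewrite -E cmod_circle ?ltxx // ltW.
by field; rewrite gz.
Qed.

(** Only the constant term of the expansion has nonzero mean over the circle. *)
Lemma cI_cauchy_kernel z : cmod z < rho ->
  cI (fun t => gam t * (gam t - z)^-1) = 1.
Proof.
move=> zr.
have C1 w : ccont_at (fun=> 1 : R[i]) w by exact: cdiff_cont (cdiff_cst _ _).
have := cauchy_kernel_expansion (fun=> 1) z (fun t _ => C1 _) zr.
rewrite (eq_cI _ (fun t => gam t * (gam t - z)^-1)) => [H|t _]; last exact: mul1r.
apply: has_csum_uniq H _.
apply: (has_csum_squeeze _ _ (fun N => (N == 0%N)%:R)).
  by rewrite -cvg_shiftS; apply: (cvg_cst (0:R)).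
case=> [|N]; first by rewrite big_ord0 sub0r cmodN cmod1.
rewrite big_ord_recl big1 ?addr0 => [|i _].
  rewrite (eq_cI _ (fun t => (gam t)^-1 ^+ 0)) ?cI_circle_expV ?mul1r ?subrr ?cmod0 //.
  by move=> t _; rewrite mul1r.
rewrite (eq_cI _ (fun t => (gam t)^-1 ^+ (bump 0 i))) ?cI_circle_expV ?mul0r //.
by move=> t _; rewrite mul1r.
Qed.

(** The expansion is proved for a primitive F because the difference quotient g of F at z extends
    holomorphically across z. Since g has a primitive, g * gam has mean 0 over the circle, and F =
    (gam - z) g + F z gives Cauchy's formula at z. *)
Lemma cauchy_series f F : rho < 1 -> holo f ->
  (forall w, unit_disc w -> cdiff F w (f w)) ->
  exists2 A : nat -> R[i], exists B, forall n, cmod (A n) * rho ^+ n <= B &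
    forall z, cmod z < rho -> has_csum (fun n => A n * z ^+ n) (F z).
Proof.
move=> rho1 fh Fd.
have gD t : unit_disc (gam t) by rewrite /unit_disc /= cmod_circle // ltW.
have Fc t : ccont_at F (gam t) by exact: cdiff_cont (Fd _ (gD t)).
have [K HK] : exists K, forall t, 0 <= t <= 1 -> cmod (F (gam t)) <= K.
  apply: rcont_bounded => t _; apply: rcont_comp => //; exact: rcont_circle.
exists (fun n => cI (fun t => F (gam t) * (gam t)^-1 ^+ n)).
  exists (2 * K) => n; rewrite -ler_pdivlMr ?exprn_gt0 // -mulrA -exprVn.
  apply: ler_cmod_cI_cst.
    apply: rcont_cintegrable => t t01.
    apply: (rcont_comp (fun w => F w * w^-1 ^+ n)); last exact: rcont_circle.
    exact: cdiff_contM (Fd _ (gD t)) (cdiff_inv_expr _ _ (gam_neq0 t)).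
  move=> t /andP[t0 t1]; rewrite cmodM cmodX cmodV cmod_circle ?(ltW rho0) //.
  apply: ler_wpM2r; first by rewrite exprn_ge0 ?invr_ge0 ?(ltW rho0).
  by apply: HK; rewrite !ltW.
move=> z zr.
have hz : unit_disc z by rewrite /unit_disc /=; exact: lt_trans rho1.
have gz t : gam t - z != 0.
  by rewrite subr_eq0; apply/eqP => E; move: zr; rewrite -E cmod_circle ?ltxx // ltW.
have [g gh gE] := holo_quotient f F z fh Fd hz.
have [G HG] := holo_primitive g gh.
have I0 : cI (fun t => g (gam t) * gam t) = 0.
  have p0 : (0 +i* (2 * pi) : R[i]) != 0.
    by rewrite -cmod_gt0 (lt_le_trans _ (ler_Im_cmod _)) //= normr_gt0 mulf_neq0 // gt_eqF ?pi_gt0.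
  have C t : ccont_at (fun w => g w * w) (gam t).
    have [d Hd] := gh _ (gD t); exact: cdiff_contM Hd (cdiff_id _).
  apply: (mulfI p0); rewrite mulr0 -cIZ; last first.
    by apply: rcont_cintegrable => t _; exact: (rcont_comp _ _ _ (C t) (rcont_circle _ _)).
  rewrite (cI_FTC (fun t => G (gam t))).
  - by rewrite circle01 subrr.
  - move=> t _; apply: (rcont_comp (fun w => (0 +i* (2 * pi)) * (g w * w))); last exact: rcont_circle.
    have [d Hd] := gh _ (gD t).
    exact: cdiff_cont (cdiffZ _ _ _ _ (cdiffM _ _ _ _ _ Hd (cdiff_id _))).
  - move=> t _; have := rdiff_comp _ _ _ _ _ (HG _ (gD t)) (rdiff_circle rho t).
    by congr rdiff; ring.
have -> : F z = cI (fun t => F (gam t) * (gam t * (gam t - z)^-1)).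
  have cI1 : cintegrable (fun t => g (gam t) * gam t).
    apply: rcont_cintegrable => t _; apply: (rcont_comp (fun w => g w * w)); last exact: rcont_circle.
    have [d Hd] := gh _ (gD t); exact: cdiff_contM Hd (cdiff_id _).
  have cI2 : cintegrable (fun t => gam t * (gam t - z)^-1).
    apply: rcont_cintegrable => t _.
    apply: (rcont_comp (fun w => w * (w - z)^-1)); last exact: rcont_circle.
    by apply: cdiff_contM (cdiff_id _) (cdiff_invB _ _ _); rewrite -subr_eq0.
  rewrite (eq_cI _ (fun t => g (gam t) * gam t + F z * (gam t * (gam t - z)^-1))).
    by rewrite cID ?cIZ ?I0 ?add0r ?cI_cauchy_kernel ?mulr1 //; exact: cintegrableZ.
  move=> t _; have := gE _ (gD t) => E.
  have -> : F (gam t) = (gam t - z) * g (gam t) + F z by rewrite E subrK.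
  by field.
by apply: cauchy_kernel_expansion.
Qed.

End Circle.
End Taylor.

(** * Taylor expansion on the whole disc *)

Section HoloPowerSeries.
Context {R : realType}.
Implicit Types (f g F : R[i] -> R[i]) (z w d : R[i]) (rho t : R) (c : nat -> R[i]).

Lemma tempered_bound rho c : 0 < rho ->
  (exists B, forall n, cmod (c n) * rho ^+ n <= B) -> tempered rho c.
Proof.
move=> rho0 [B HB] r /andP[r0 rr]; exists B => n; apply: le_trans (HB n).
by rewrite ler_wpM2l ?cmod_ge0 //; apply: lerXn2r; rewrite ?nnegrE ?(ltW rho0) ?(ltW rr).
Qed.

Lemma power_series_deriv rho c F : tempered rho c ->
  (forall z, cmod z < rho -> has_csum (fun n => c n * z ^+ n) (F z)) ->
  forall z, cmod z < rho -> exists2 s, has_csum (fun n => pderiv c n * z ^+ n) s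
     & cdiff F z s.
Proof.
move=> tc HF z zr.
have [s Hs] := has_csum_tempered _ _ z (tempered_pderiv _ _ tc) zr.
by exists s => //; exact: (cdiff_power_series _ _ _ _ _ tc zr HF Hs).
Qed.

(** Differentiating n times leaves n! c_n as constant term. The coefficients are thus determined by
    F, independently of the radius of the circle that produced them. *)
Lemma power_series_coef rho c F n : 0 < rho -> tempered rho c ->
  (forall z, cmod z < rho -> has_csum (fun n => c n * z ^+ n) (F z)) ->
  iter n (fun g => derive1 (g : R[i]^o -> R[i]^o)) F 0 = n`!%:R * c n.
Proof.
move=> rho0; elim: n c F => [|n IH] c F tc HF.
  have H0 := HF 0; rewrite cmod0 in H0; have {}H0 := H0 rho0.
  by rewrite /= mul1r; exact: has_csum_at0.
rewrite iterSr (IH (pderiv c)).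
- by rewrite /pderiv factS natrM; ring.
- exact: tempered_pderiv.
- move=> z zr; have [s Hs Hd] := power_series_deriv _ _ _ tc HF z zr.
  by have [_ ->] := cdiff_derivable _ _ _ Hd.
Qed.

(** The expansions of a primitive F on all discs of radius rho < 1 share the coefficients A given by
    its derivatives at 0, so they form one series on the disc; its derivative is the series of f. *)
Theorem holo_power_series f : holo f -> exists2 a, tempered 1 a &
  forall z, unit_disc z -> has_csum (fun n => a n * z ^+ n) (f z).
Proof.
move=> fh; have [F HF] := holo_primitive _ fh.
pose A n : R[i] := iter n (fun g => derive1 (g : R[i]^o -> R[i]^o)) F 0 / n`!%:R.
have key rho : 0 < rho < 1 ->
    (exists B, forall n, cmod (A n) * rho ^+ n <= B) /\
    (forall z, cmod z < rho -> has_csum (fun n => A n * z ^+ n) (F z)).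
  move=> /andP[rho0 rho1].
  have [A' HB HS] := cauchy_series rho rho0 f F rho1 fh HF.
  suff -> : A = A' by [].
  apply/funext => n; rewrite /A (power_series_coef rho A') //.
    by rewrite mulrAC divff ?mul1r // pnatr_eq0 -lt0n fact_gt0.
  exact: tempered_bound.
have tA : tempered 1 A.
  move=> r /andP[r0 r1].
  have [|HB _] := key ((r + 1) / 2); first by apply/andP; split; lra.
  have r20 : 0 < (r + 1) / 2 by lra.
  by apply: (tempered_bound _ _ r20 HB); rewrite r0 /=; lra.
have SA z : cmod z < 1 -> has_csum (fun n => A n * z ^+ n) (F z).
  move=> z1; have z0 := cmod_ge0 z.
  have [|_ H] := key ((cmod z + 1) / 2); first by apply/andP; split; lra.
  by apply: H; lra.
exists (pderiv A); first exact: tempered_pderiv.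
move=> z hz; have [s Hs Hd] := power_series_deriv _ _ _ tA SA z hz.
by rewrite (cdiff_uniq _ _ _ _ (HF z hz) Hd).
Qed.

End HoloPowerSeries.

(** * Parseval's identity for radial weights *)

Section Area.
Context {R : realType}.
Notation mu := (@lebesgue_measure R).
Implicit Types (h : R * R -> \bar R) (a b s c rho : R).

Let affine_measurable a b : measurable_fun setT (fun x : R => a * x + b).
Proof. by apply: measurable_funD => //; exact: measurable_funM. Qed.

(** Lebesgue measure equals a times its image under x |-> a x + b, by uniqueness, since both agree
    on half-open intervals. *)
Lemma ge0_integral_affine (G : R -> \bar R) a b : 0 < a ->
  measurable_fun setT G -> (forall x, 0 <= G x)%E ->
  (\int[mu]_x G x = a%:E * \int[mu]_x G (a * x + b)%R)%E.
Proof.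
move=> a0 mG G0.
pose phi : R -> measurableTypeR R := fun x => a * x + b.
have mphi : measurable_fun setT phi by exact: affine_measurable.
have E A : measurable A -> mu A = mscale (NngNum (ltW a0)) (pushforward mu phi) A.
  move=> mA; apply: lebesgue_measure_unique => //= _ [[p q]] _ <-.
  rewrite /mscale /= /pushforward.
  have -> : phi @^-1` `]p, q] = `](p - b) / a, (q - b) / a]%classic.
    apply/seteqP; split => x /=; rewrite !in_itv /= /phi.
      by rewrite ltr_pdivrMr // ler_pdivlMr // ltrBlDr lerBrDr mulrC.
    by rewrite ltr_pdivrMr // ler_pdivlMr // ltrBlDr lerBrDr mulrC.
  rewrite !lebesgue_measure_itv /= !lte_fin.
  rewrite ltr_pM2r ?invr_gt0 // ltrD2r; case: ifP => _; last by rewrite mule0.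
  by rewrite -!EFinB -EFinM; congr EFin; field; exact: lt0r_neq0.
rewrite (eq_measure_integral (mscale (NngNum (ltW a0)) (pushforward mu phi)));
  last by move=> A mA _; exact: E.
rewrite ge0_integral_mscale //=.
by rewrite ge0_integral_pushforward // preimage_setT.
Qed.

Notation mu2 := (@area_measure R).

Let mcoord1 a b : measurable_fun setT (fun p : R * R => a * p.1 + b * p.2).
Proof. by apply: measurable_funD; apply: measurable_funM. Qed.

Definition lin2 a b c s (p : R * R) : R * R :=
  (a * p.1 + b * p.2, c * p.1 + s * p.2).

Lemma measurable_linear a b c s :
  measurable_fun setT (lin2 a b c s).
Proof. by apply: measurable_fun_pair; exact: mcoord1. Qed.

Lemma measurable_comp_linear h a b c s : measurable_fun setT h ->
  measurable_fun setT (fun p : R * R => h (lin2 a b c s p)).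
Proof. by move=> mh; apply: (measurableT_comp mh); exact: measurable_linear. Qed.

(** By Tonelli: on each horizontal line the shear is a translation. *)
Lemma area_shear1 h s : measurable_fun setT h -> (forall p, 0 <= h p)%E ->
  (\int[mu2]_p h (lin2 1 s 0 1 p) = \int[mu2]_p h p)%E.
Proof.
move=> mh h0; rewrite /area_measure.
rewrite fubini_tonelli2 //; last exact: measurable_comp_linear.
rewrite [RHS]fubini_tonelli2 //; apply: eq_integral => y _.
rewrite /fubini_G /lin2 /=.
rewrite (@ge0_integral_affine (fun x => h (x, y)) 1 (s * y)) //; last first.
  by apply: measurableT_comp => //; exact: measurable_pair2.
rewrite mul1e; apply: eq_integral => x _.
by rewrite mul0r add0r (mul1r y).
Qed.

Lemma area_shear2 h s : measurable_fun setT h -> (forall p, 0 <= h p)%E ->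
  (\int[mu2]_p h (lin2 1 0 s 1 p) = \int[mu2]_p h p)%E.
Proof.
move=> mh h0; rewrite /area_measure.
rewrite fubini_tonelli1 //; last exact: measurable_comp_linear.
rewrite [RHS]fubini_tonelli1 //; apply: eq_integral => x _.
rewrite /fubini_F /lin2 /=.
rewrite (@ge0_integral_affine (fun y => h (x, y)) 1 (s * x)) //; last first.
  by apply: measurableT_comp => //; exact: measurable_pair1.
rewrite mul1e; apply: eq_integral => y _.
by rewrite mul0r addr0 (mul1r x) addrC.
Qed.

(* A rotation by an angle other than a multiple of pi is a product of three shears. *)
Lemma area_rotation h c s : c ^+ 2 + s ^+ 2 = 1 -> s != 0 ->
  measurable_fun setT h -> (forall p, 0 <= h p)%E ->
  (\int[mu2]_p h (lin2 c (- s) s c p) = \int[mu2]_p h p)%E.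
Proof.
(* For the angle theta with c = cos theta and s = sin theta, t is -tan(theta / 2), the parameter of
   the two outer shears. *)
move=> cs s0 mh h0; pose t := (c - 1) / s.
have mh1 := measurable_comp_linear h 1 t 0 1 mh.
have mh2 := measurable_comp_linear _ 1 0 s 1 mh1.
rewrite -(area_shear1 h t) // -(area_shear2 (fun p => h (lin2 1 t 0 1 p)) s) //.
rewrite -(area_shear1 (fun p => h (lin2 1 t 0 1 (lin2 1 0 s 1 p))) t) //.
apply: eq_integral => p _.
congr h; rewrite /lin2 /=; congr pair; last by rewrite /t; field.
have -> : c * p.1 + - s * p.2 = c * p.1 - (s ^+ 2) / s * p.2 by field.
have -> : s ^+ 2 = 1 - c ^+ 2 by lra.
by rewrite /t; field.
Qed.

Lemma area_scale h rho : 0 < rho -> measurable_fun setT h ->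
  (forall p, 0 <= h p)%E ->
  (\int[mu2]_p h p = (rho ^+ 2)%:E * \int[mu2]_p h (lin2 rho 0 0 rho p))%E.
Proof.
move=> rho0 mh h0; rewrite /area_measure.
rewrite fubini_tonelli1 // fubini_tonelli1 //; last first.
  exact: measurable_comp_linear.
pose F := fubini_F mu h.
have F0 x : (0 <= F x)%E by apply: integral_ge0 => y _; exact: h0.
have mF : measurable_fun setT F by exact: measurable_fun_fubini_tonelli_F.
rewrite (@ge0_integral_affine F rho 0) // expr2 EFinM -muleA; congr (_ * _)%E.
rewrite -ge0_integralZl_EFin ?ltW //.
- apply: eq_integral => x _; rewrite addr0 /F /fubini_F /lin2 /=.
  rewrite (@ge0_integral_affine (fun y => h (rho * x, y)) rho 0) //; last first.
    by apply: measurableT_comp => //; exact: measurable_pair1.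
  by congr (_ * _)%E; apply: eq_integral => y _; rewrite !mul0r !addr0 add0r.
- by move=> x _; apply: integral_ge0.
- apply: measurable_fun_fubini_tonelli_F => //; exact: measurable_comp_linear.
Qed.

End Area.

(** * Roots of unity and the discrete Parseval identity *)

Section RootsOfUnity.
Context {R : realType}.
Implicit Types (z w : R[i]) (d : nat -> R[i]).

Lemma prim_root_exists (F : closedFieldType) n : n%:R != 0 :> F ->
  exists w : F, n.-primitive_root w.
Proof.
move=> nF; have n0 : (0 < n)%N by case: (n) nF => [|//]; rewrite eqxx.
have [r] := closed_field_poly_normal ('X^n - 1 : {poly F}).
rewrite (monicP _) ?monicXnsubC // scale1r => Xn1.
have size_r : size r = n.
  by apply: succn_inj; rewrite -(size_prod_XsubC r id) -Xn1 size_XnsubC.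
have uniq_r : uniq r by rewrite -separable_prod_XsubC -Xn1 separable_Xn_sub_1.
have roots_r : all n.-unity_root r.
  by apply/allP => z zr; rewrite /root_of_unity Xn1 root_prod_XsubC.
by have /hasP[w _ pw] := has_prim_root n0 roots_r uniq_r (eq_leq (esym size_r)); exists w.
Qed.

Lemma cmod_sqrC z : (cmod z ^+ 2)%:C = z * conjc z.
Proof. by rewrite rmorphXn /= -normC_cmod sqr_normc. Qed.

Lemma prim_root_cmod w n : n.-primitive_root w -> cmod w = 1.
Proof.
move=> pw; have n0 := prim_order_gt0 pw.
apply/eqP; rewrite -(pexpr_eq1 n0) ?cmod_ge0 //.
by rewrite -cmodX (prim_expr_order pw) cmod1.
Qed.

Lemma prim_root_conj w n : n.-primitive_root w -> w * conjc w = 1.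
Proof. by move=> /prim_root_cmod w1; rewrite -cmod_sqrC w1 expr1n. Qed.

(** For n <> m below M the ratio v = w^(n-m) is an M-th root of unity other than 1, so its geometric
    sum vanishes. *)
Lemma prim_root_orth w M n m : M.-primitive_root w -> (n < M)%N -> (m < M)%N ->
  \sum_(j < M) (w ^+ n * conjc w ^+ m) ^+ j = if n == m then M%:R else 0.
Proof.
move=> pw nM mM; have ww := prim_root_conj _ _ pw.
have wc : conjc w ^+ M = 1 by rewrite -rmorphXn /= (prim_expr_order pw) rmorph1.
case: eqVneq => [->|nm].
  rewrite -exprMn ww expr1n; under eq_bigr do rewrite expr1n.
  by rewrite sumr_const card_ord.
set v := w ^+ n * _.
have v1 : v - 1 != 0.
  rewrite subr_eq0; apply: contra nm => /eqP Ev.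
  have : w ^+ n = w ^+ m.
    by rewrite -[RHS]mul1r -Ev /v -mulrA -exprMn [conjc w * w]mulrC ww expr1n mulr1.
  by move/eqP; rewrite (eq_prim_root_expr pw) !modn_small.
apply: (mulfI v1); rewrite mulr0 -subrX1 /v exprMn -!exprM.
by rewrite mulnC exprM (prim_expr_order pw) expr1n mulnC exprM wc expr1n mulr1 subrr.
Qed.

Lemma discrete_parseval w M N d z : M.-primitive_root w -> (N <= M)%N ->
  \sum_(j < M) cmod (\sum_(n < N) d n * (w ^+ j * z) ^+ n) ^+ 2 =
  M%:R * \sum_(n < N) cmod (d n) ^+ 2 * cmod z ^+ (n * 2).
Proof.
move=> pw NM; apply: complexI; rewrite rmorph_sum rmorphM rmorph_nat rmorph_sum /=.
pose u n := d n * z ^+ n.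
have sq (v : nat -> R[i]) : (cmod (\sum_(n < N) v n) ^+ 2)%:C =
    \sum_(n < N) \sum_(m < N) v n * conjc (v m).
  rewrite cmod_sqrC (rmorph_sum (@conjc R)) mulr_suml; apply: eq_bigr => n _.
  by rewrite mulr_sumr.
under eq_bigr => j _ do rewrite (sq (fun n => d n * (w ^+ j * z) ^+ n)).
rewrite exchange_big /= mulr_sumr; apply: eq_bigr => n _.
rewrite exchange_big /=.
transitivity (\sum_(m < N) u n * conjc (u m) *
    \sum_(j < M) (w ^+ n * conjc w ^+ m) ^+ j).
  apply: eq_bigr => m _; rewrite mulr_sumr; apply: eq_bigr => j _.
  rewrite /u !rmorphM !rmorphXn !rmorphM !rmorphXn /= !exprMn -!exprM.
  by rewrite (mulnC j n) (mulnC j m); ring.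
rewrite (bigD1 n) //= [X in _ + X]big1 ?addr0 => [|m mn].
  rewrite prim_root_orth ?eqxx ?(leq_trans _ NM) // mulrC; congr (_ * _).
  by rewrite -cmod_sqrC /u cmodM exprMn cmodX -exprM.
rewrite prim_root_orth ?(leq_trans _ NM) // ifN ?mulr0 //.
by rewrite eq_sym.
Qed.

End RootsOfUnity.

Section PlaneIntegrals.
Context {R : realType}.
Notation mu2 := (@area_measure R).
Implicit Types (g : R * R -> R[i]) (d : nat -> R[i]) (W : R -> R).

Definition zc (p : R * R) : R[i] := p.1 +i* p.2.

Definition cmeas g : Prop := measurable_fun setT (fun p => complex.Re (g p)) /\
  measurable_fun setT (fun p => complex.Im (g p)).

Lemma cmeas_cst (c : R[i]) : cmeas (fun=> c).
Proof. by split; exact: measurable_cst. Qed.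

Lemma cmeas_zc : cmeas zc.
Proof. by split => /=; [exact: measurable_fst|exact: measurable_snd]. Qed.

Lemma cmeasD g g' : cmeas g -> cmeas g' -> cmeas (fun p => g p + g' p).
Proof.
move=> [gR gI] [hR hI]; split; under eq_fun do rewrite ?cReD ?cImD.
  exact: measurable_funD.
exact: measurable_funD.
Qed.

Lemma cmeasM g g' : cmeas g -> cmeas g' -> cmeas (fun p => g p * g' p).
Proof.
move=> [gR gI] [hR hI]; split; under eq_fun do rewrite ?cReM ?cImM.
  by apply: measurable_funB; exact: measurable_funM.
by apply: measurable_funD; exact: measurable_funM.
Qed.

Lemma cmeasX g n : cmeas g -> cmeas (fun p => g p ^+ n).
Proof.
move=> mg; elim: n => [|n IH]; first exact: cmeas_cst.
by under eq_fun do rewrite exprS; exact: cmeasM.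
Qed.

Lemma cmeas_sum N (F : nat -> R * R -> R[i]) : (forall n, cmeas (F n)) ->
  cmeas (fun p => \sum_(n < N) F n p).
Proof.
move=> mF; elim: N => [|N IH].
  under eq_fun do rewrite big_ord0; exact: cmeas_cst.
by under eq_fun do rewrite big_ord_recr /=; exact: cmeasD.
Qed.

Lemma cmeas_poly d N : cmeas (fun p => \sum_(n < N) d n * zc p ^+ n).
Proof.
apply: (cmeas_sum N (fun n p => d n * zc p ^+ n)) => n.
by apply: cmeasM; [exact: cmeas_cst|exact/cmeasX/cmeas_zc].
Qed.

Lemma cmeas_cmod2 g : cmeas g -> measurable_fun setT (fun p => cmod (g p) ^+ 2).
Proof.
move=> [gR gI]; under eq_fun do rewrite cmod_sqr.
by apply: measurable_funD; exact: measurable_funX.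
Qed.

Lemma cmeas_cmod g : cmeas g -> measurable_fun setT (fun p => cmod (g p)).
Proof.
move=> mg; rewrite (_ : (fun p => _) = (@powR R ^~ 2^-1) \o (fun p => cmod (g p) ^+ 2)).
  apply: measurableT_comp; [exact: measurable_powR|exact: cmeas_cmod2].
by apply/funext => p /=; rewrite powR12_sqrt ?exprn_ge0 ?cmod_ge0 // sqrtr_sqr ger0_norm ?cmod_ge0.
Qed.

Lemma measurable_radial W : measurable_fun setT W ->
  measurable_fun setT (fun p => W (cmod (zc p))).
Proof. by move=> mW; exact: (measurableT_comp mW (cmeas_cmod _ cmeas_zc)). Qed.

Lemma zc_rotation (w : R[i]) p :
  zc (lin2 (complex.Re w) (- complex.Im w) (complex.Im w) (complex.Re w) p) = w * zc p.
Proof. by apply: eq_ReIm; rewrite /= ?cReM ?cImM /= ?mulNr // addrC. Qed.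

Lemma area_rotationC (h : R[i] -> \bar R) (w : R[i]) : cmod w = 1 ->
  complex.Im w != 0 -> measurable_fun setT (fun p => h (zc p)) ->
  (forall z, 0 <= h z)%E ->
  (\int[mu2]_p h (w * zc p)%R = \int[mu2]_p h (zc p))%E.
Proof.
move=> w1 w0 mh h0.
rewrite -(@area_rotation _ (fun p => h (zc p)) (complex.Re w) (complex.Im w)) //.
  by apply: eq_integral => p _; rewrite zc_rotation.
by rewrite -cmod_sqr w1 expr1n.
Qed.

Lemma measurable_rotation (h : R[i] -> \bar R) (w : R[i]) :
  measurable_fun setT (fun p => h (zc p)) ->
  measurable_fun setT (fun p => h (w * zc p)).
Proof.
move=> mh; under eq_fun do rewrite -zc_rotation.
exact: (measurable_comp_linear (fun p => h (zc p))).
Qed.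

Lemma area_rotationX (h : R[i] -> \bar R) (w : R[i]) j : cmod w = 1 ->
  complex.Im w != 0 -> measurable_fun setT (fun p => h (zc p)) ->
  (forall z, 0 <= h z)%E ->
  (\int[mu2]_p h (w ^+ j * zc p)%R = \int[mu2]_p h (zc p))%E.
Proof.
move=> w1 w0 mh h0; elim: j => [|j IH].
  by apply: eq_integral => p _; rewrite expr0 mul1r.
rewrite -[RHS]IH -(area_rotationC (fun z => h (w ^+ j * z)) w) //.
  by apply: eq_integral => p _; rewrite exprSr mulrA.
exact: measurable_rotation.
Qed.

(** A real root equals its conjugate, so its square is 1 and its order divides 2. *)
Lemma prim_root_Im (w : R[i]) M : (2 < M)%N -> M.-primitive_root w ->
  complex.Im w != 0.
Proof.
move=> M2 pw; apply/eqP => w0.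
have : w ^+ 2 == 1.
  apply/eqP; rewrite -[RHS](prim_root_conj _ _ pw) expr2; congr (_ * _).
  by move: w0; case: (w) => a b /= ->; rewrite oppr0.
by rewrite -(prim_order_dvd pw) => /(dvdn_leq (isT : (0 < 2)%N)); rewrite leqNgt M2.
Qed.

(* Average over the rotations by the M-th roots of unity, for which the cross terms
   cancel; M = N + 3 > 2 makes a primitive root non-real, as [area_rotation] needs. *)
Lemma poly_parseval d N W : measurable_fun setT W -> (forall r, 0 <= W r) ->
  (\int[mu2]_p (cmod (\sum_(n < N) d n * zc p ^+ n)%R ^+ 2 * W (cmod (zc p)))%:E =
  \sum_(n < N) (cmod (d n) ^+ 2)%:E *
     \int[mu2]_p (cmod (zc p) ^+ (n * 2) * W (cmod (zc p)))%:E)%E.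
Proof.
move=> mW W0.
have [|w pw] := prim_root_exists R[i] N.+3; first by rewrite pnatr_eq0.
have w1 := prim_root_cmod _ _ pw; have wI := prim_root_Im w N.+3 isT pw.
pose h (z : R[i]) : \bar R :=
  (cmod (\sum_(n < N) d n * z ^+ n) ^+ 2 * W (cmod z))%:E.
have h0 z : (0 <= h z)%E by rewrite lee_fin mulr_ge0 ?exprn_ge0 ?cmod_ge0.
have mh : measurable_fun setT (fun p => h (zc p)).
  rewrite /h; apply/measurable_EFinP.
  apply: measurable_funM; last exact: measurable_radial.
  exact: (cmeas_cmod2 _ (cmeas_poly _ _)).
pose k n (p : R * R) : \bar R := (cmod (zc p) ^+ (n * 2) * W (cmod (zc p)))%:E.
have mk n : measurable_fun setT (k n).
  rewrite /k; apply/measurable_EFinP.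
  apply: measurable_funM; last exact: measurable_radial.
  apply: measurable_funX; exact: (cmeas_cmod _ cmeas_zc).
have k0 n p : (0 <= k n p)%E by rewrite lee_fin mulr_ge0 ?exprn_ge0 ?cmod_ge0.
have E : ((N.+3%:R)%:E * \int[mu2]_p h (zc p) = (N.+3%:R)%:E *
    \sum_(n < N) (cmod (d n) ^+ 2)%:E * \int[mu2]_p k n p)%E.
  transitivity (\sum_(j < N.+3) \int[mu2]_p h (w ^+ j * zc p)%R)%E.
    under eq_bigr do rewrite area_rotationX //.
    elim: N.+3 => [|m IH]; first by rewrite big_ord0 mul0e.
    by rewrite big_ord_recr /= -IH -natr1 EFinD ge0_muleDl ?lee_fin // mul1e.
  rewrite -ge0_integral_sum //; last by move=> j; exact: measurable_rotation.
  transitivity (\int[mu2]_p ((N.+3%:R)%:E * \sum_(n < N) (cmod (d n) ^+ 2)%:E * k n p))%E.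
    apply: eq_integral => p _.
    rewrite /h /k; under eq_bigr do rewrite cmodM cmodX w1 expr1n mul1r.
    rewrite sumEFin -mulr_suml discrete_parseval //; last by rewrite !leqW.
    have -> : (\sum_(n < N) (cmod (d n) ^+ 2)%:E *
        (cmod (zc p) ^+ (n * 2) * W (cmod (zc p)))%:E =
        (\sum_(n < N) cmod (d n) ^+ 2 * cmod (zc p) ^+ (n * 2) *
           W (cmod (zc p)))%R%:E)%E.
      by rewrite -sumEFin; apply: eq_bigr => n _; rewrite -EFinM mulrA.
    by rewrite -EFinM -mulr_suml mulrA.
  rewrite ge0_integralZl_EFin //.
  - congr (_ * _)%E; rewrite ge0_integral_sum //.
    + apply: eq_bigr => n _; rewrite ge0_integralZl_EFin //; [exact: mk|by rewrite exprn_ge0 ?cmod_ge0].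
    + by move=> n; apply: measurable_funeM; exact: mk.
    + by move=> n p _; rewrite mule_ge0 // lee_fin exprn_ge0 ?cmod_ge0.
  - by move=> p _; apply: sume_ge0 => n _; rewrite mule_ge0 // lee_fin exprn_ge0 ?cmod_ge0.
  - by apply: emeasurable_sum => n; apply: measurable_funeM; exact: mk.
(* The integrals may be infinite, so the factor is removed by multiplying by its inverse. *)
have N0 : (N.+3%:R != 0 :> R) by [].
have : ((N.+3%:R)^-1%:E * ((N.+3%:R)%:E * \int[mu2]_p h (zc p)) =
  (N.+3%:R)^-1%:E * ((N.+3%:R)%:E *
    \sum_(n < N) (cmod (d n) ^+ 2)%:E * \int[mu2]_p k n p))%E by rewrite E.
by rewrite !muleA -!EFinM mulVf // !mul1e.
Qed.

End PlaneIntegrals.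

(** * The norm in terms of Taylor coefficients *)

Section Moments.
Context {R : realType}.
Notation mu2 := (@area_measure R).
Implicit Types (W V : R -> R) (rho : R).

Definition radint W : \bar R := (\int[mu2]_p (W (cmod (zc p)))%:E)%E.

Lemma measurable_radialE W : measurable_fun setT W ->
  measurable_fun setT (fun p => (W (cmod (zc p)))%:E).
Proof. by move=> mW; apply/measurable_EFinP; exact: measurable_radial. Qed.

Lemma radint_ge0 W : (forall r, 0 <= W r) -> (0 <= radint W)%E.
Proof. by move=> W0; apply: integral_ge0 => p _; rewrite lee_fin. Qed.

Lemma le_radint W V : measurable_fun setT W -> measurable_fun setT V ->
  (forall r, 0 <= W r) -> (forall r, 0 <= r -> W r <= V r) ->
  (radint W <= radint V)%E.
Proof.
move=> mW mV W0 WV; apply: ge0_le_integral => //.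
- by move=> p _; rewrite lee_fin.
- exact: measurable_radialE.
- exact: measurable_radialE.
- by move=> p _; rewrite lee_fin WV // cmod_ge0.
Qed.

Lemma radintD W V : measurable_fun setT W -> measurable_fun setT V ->
  (forall r, 0 <= W r) -> (forall r, 0 <= V r) ->
  radint (fun r => W r + V r) = (radint W + radint V)%E.
Proof.
move=> mW mV W0 V0; rewrite /radint -ge0_integralD //.
- by move=> p _; rewrite lee_fin.
- exact: measurable_radialE.
- by move=> p _; rewrite lee_fin.
- exact: measurable_radialE.
Qed.

Lemma radintZ W k : 0 <= k -> measurable_fun setT W -> (forall r, 0 <= W r) ->
  radint (fun r => k * W r) = (k%:E * radint W)%E.
Proof.
move=> k0 mW W0; rewrite /radint -ge0_integralZl_EFin //.
- by move=> p _; rewrite lee_fin.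
- exact: measurable_radialE.
Qed.

Lemma radint_scale W rho : 0 < rho -> measurable_fun setT W ->
  (forall r, 0 <= W r) ->
  radint W = ((rho ^+ 2)%:E * radint (fun r => W (rho * r)%R))%E.
Proof.
move=> rho0 mW W0.
rewrite /radint (@area_scale _ (fun p => (W (cmod (zc p)))%:E) rho) //.
- congr (_ * _)%E; apply: eq_integral => p _; congr (W _)%:E.
  have -> : zc (lin2 rho 0 0 rho p) = rho%:C * zc p.
    by apply: eq_ReIm; rewrite /= ?cReM ?cImM /= ?mul0r ?subr0 ?addr0 ?add0r.
  by rewrite cmodM cmodR gtr0_norm.
- exact: measurable_radialE.
- by move=> p; rewrite lee_fin.
Qed.

Definition below rho (r : R) : R := ((r < rho)%R : nat)%:R.

Lemma below_ge0 rho r : 0 <= below rho r.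
Proof. exact: ler0n. Qed.

Lemma measurable_below rho : measurable_fun setT (below rho).
Proof.
rewrite (_ : below rho = \1_(`]-oo, rho[)); first exact: measurable_indic.
by apply/funext => r; rewrite /below indicE mem_setE in_itv.
Qed.

(** The absolute value makes the function nonnegative on the whole line; it is evaluated at
    moduli. *)
Definition powbelow n rho (r : R) : R := `|r| ^+ n * below rho r.

Lemma powbelow_ge0 n rho r : 0 <= powbelow n rho r.
Proof. by rewrite mulr_ge0 ?exprn_ge0 ?below_ge0. Qed.

Lemma measurable_powbelow n rho : measurable_fun setT (powbelow n rho).
Proof.
apply: measurable_funM; last exact: measurable_below.
by apply: measurable_funX; exact: normr_measurable.
Qed.

(** Homogeneity: n factors rho come from the integrand and two from the area element. *)
Lemma radint_powbelow n rho : 0 < rho ->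
  radint (powbelow n rho) = ((rho ^+ n.+2)%:E * radint (powbelow n 1))%E.
Proof.
move=> rho0.
rewrite (radint_scale _ _ rho0 (measurable_powbelow n rho) (powbelow_ge0 n rho)).
have -> : (fun r => powbelow n rho (rho * r)) =
    (fun r => rho ^+ n * powbelow n 1 r).
  apply/funext => r; rewrite /powbelow /below normrM (gtr0_norm rho0) exprMn.
  by rewrite -[X in _ < X]mulr1 ltr_pM2l // mulrA.
rewrite radintZ ?exprn_ge0 ?ltW //; last 2 first.
- exact: measurable_powbelow.
- exact: powbelow_ge0.
by rewrite muleA -EFinM -exprD addnC addn2.
Qed.

Let square (l : R) : set (R * R) := `[- l, l] `*` `[- l, l].

Let area_square l : 0 <= l -> mu2 (square l) = ((2 * l) ^+ 2)%:E.
Proof.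
move=> l0; rewrite /area_measure /square product_measure1E //=.
rewrite !lebesgue_measure_itv /= lte_fin.
case: ltP => h; first by rewrite -EFinD -EFinM; congr EFin; ring.
have -> : l = 0 by lra.
by rewrite mul0e mulr0 expr0n.
Qed.

(** The disc lies between the squares of half-sides 1/2 and 1, whose areas are 1 and 4. *)
Lemma disc_area : exists2 a : R, 0 < a & radint (powbelow 0 1) = a%:E.
Proof.
have mS l : measurable (square l) by apply: measurableX.
have indS l : (\int[mu2]_p (\1_(square l) p)%:E = mu2 (square l))%E.
  by rewrite integral_indic //=; [congr (mu2 _); exact: setIT|exact: mS].
have hi : (radint (powbelow 0 1) <= 4%:E)%E.
  have -> : (4 : R)%:E = mu2 (square 1) by rewrite area_square //; congr EFin; ring.
  rewrite -indS; apply: ge0_le_integral => //.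
  - by move=> p _; rewrite lee_fin powbelow_ge0.
  - exact: (measurable_radialE _ (measurable_powbelow 0 1)).
  - by apply/measurable_EFinP; apply: measurable_indic; exact: mS.
  - move=> p _; rewrite lee_fin /powbelow expr0 mul1r /below indicE.
    case: (ltP _ 1) => [h|_]; last by rewrite ler0n.
    rewrite mem_set //; split; rewrite /= in_itv /= -ler_norml.
      by apply: le_trans (ltW h); exact: (ler_Re_cmod (zc p)).
    by apply: le_trans (ltW h); exact: (ler_Im_cmod (zc p)).
have lo : (1%:E <= radint (powbelow 0 1))%E.
  have -> : (1 : R)%:E = mu2 (square (2^-1)).
    by rewrite area_square ?invr_ge0 //; congr EFin; field.
  rewrite -indS; apply: ge0_le_integral => //.
  - by apply/measurable_EFinP; apply: measurable_indic; exact: mS.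
  - exact: (measurable_radialE _ (measurable_powbelow 0 1)).
  - move=> p _; rewrite lee_fin /powbelow expr0 mul1r /below indicE.
    case: (boolP (p \in square _)) => [|_]; last by rewrite ler0n.
    rewrite inE => -[] /=; rewrite !in_itv /= -!ler_norml => h1 h2.
    rewrite (_ : cmod (zc p) < 1) //.
    rewrite -(ltr_pXn2r (n := 2)) ?nnegrE ?cmod_ge0 // expr1n cmod_sqr /=.
    have g (x : R) : `|x| <= 2^-1 -> x ^+ 2 <= 4^-1.
      move=> hx; rewrite -real_normK ?num_real //.
      apply: le_trans (_ : (2^-1) ^+ 2 <= _); last by rewrite expr2; lra.
      by apply: lerXn2r; rewrite ?nnegrE ?invr_ge0.
    have := g _ h1; have := g _ h2; lra.
case E : (radint (powbelow 0 1)) => [a| |]; rewrite ?E // in hi lo.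
by exists a => //; move: lo; rewrite lee_fin; exact: lt_le_trans.
Qed.

(** The base is the inverse of 1 + 1/(m+1), whose (m+2)-th power is at least 2 by Bernoulli's
    inequality. *)
Lemma bernoulli_half m : (1 - (m.+2%:R)^-1) ^+ m.+2 <= 2^-1 :> R.
Proof.
have e : 1 - (m.+2%:R)^-1 = (1 + (m.+1%:R)^-1)^-1 :> R.
  rewrite -[m.+2%:R]natr1; have k0 : 0 < m.+1%:R :> R by rewrite ltr0n.
  by field; apply/andP; split; apply: lt0r_neq0; lra.
rewrite e exprVn lef_pV2 ?posrE ?exprn_gt0 ?addr_gt0 ?invr_gt0 //.
have h k : 1 + k%:R * (m.+1%:R)^-1 <= (1 + (m.+1%:R)^-1) ^+ k :> R.
  elim: k => [|k IH]; first by rewrite mul0r addr0 expr0.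
  rewrite exprSr; apply: le_trans (ler_wpM2r _ IH); last by rewrite addr_ge0 ?invr_ge0.
  have : 0 <= k%:R * (m.+1%:R)^-1 * (m.+1%:R)^-1 :> R by rewrite !mulr_ge0 ?invr_ge0.
  rewrite -natr1; lra.
apply: le_trans (h m.+2); rewrite -[m.+2%:R]natr1 mulrDl divff ?pnatr_eq0 // mul1r.
by rewrite -[2]/(1 + 1) addrA lerDl invr_ge0.
Qed.

(* Split the disc at the radius rho = 1 - 1/(n+2): outside r^n <= 1, and the inner
   part is, by scaling, rho^(n+2) <= 1/2 times the whole integral. *)
Lemma radint_powbelow_le a n : radint (powbelow 0 1) = a%:E -> 0 < a ->
  (radint (powbelow n 1) <= (4 * a / (n.+1%:R))%:E)%E.
Proof.
move=> Ea a0.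
have le1 : (radint (powbelow n 1) <= a%:E)%E.
  rewrite -Ea; apply: le_radint;
    [exact: measurable_powbelow|exact: measurable_powbelow|exact: powbelow_ge0|].
  move=> r r0; rewrite /powbelow /below expr0 mul1r; case: ltP => r1; last by rewrite mulr0.
  by rewrite mulr1 ger0_norm // exprn_ile1 // ltW.
have ge0 := radint_ge0 _ (powbelow_ge0 n 1).
case Ej : (radint (powbelow n 1)) => [j| |]; rewrite ?Ej // in le1 ge0 *.
rewrite !lee_fin in le1 ge0 *.
pose rho : R := 1 - (n.+2%:R)^-1.
have i0 : 0 < (n.+2%:R)^-1 :> R by rewrite invr_gt0.
have i1 : (n.+2%:R)^-1 <= 2^-1 :> R by rewrite lef_pV2 ?posrE // ler_nat.
have rho0 : 0 < rho by rewrite /rho subr_gt0 (le_lt_trans i1) // invf_lt1 // ltr1n.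
have rho1 : rho < 1 by rewrite /rho gtrBl.
(* The areas are added on both sides instead of subtracted, the values being extended reals. With j
   the n-th moment this becomes j + rho^2 a <= rho^(n+2) j + a. *)
have H : (radint (fun r => powbelow n 1 r + powbelow 0 rho r)%R <=
    radint (fun r => powbelow n rho r + powbelow 0 1 r)%R)%E.
  apply: le_radint.
  - apply: measurable_funD; exact: measurable_powbelow.
  - apply: measurable_funD; exact: measurable_powbelow.
  - by move=> r; rewrite addr_ge0 ?powbelow_ge0.
  - move=> r r0; rewrite /powbelow /below !expr0 !mul1r ger0_norm //.
    case: (ltP r 1) => r1; case: (ltP r rho) => rr; rewrite ?(mulr1, mulr0, addr0, add0r) //.
      by rewrite exprn_ile1 // ltW.
    by lra.
rewrite !radintD ?(radint_powbelow _ _ rho0) ?Ea ?Ej -?EFinM -?EFinD ?lee_fin in H;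
  try exact: measurable_powbelow; try exact: powbelow_ge0.
have hb := bernoulli_half n; rewrite -/rho in hb.
have h1 : j * 2^-1 <= a * (2 * (n.+2%:R)^-1).
  have A : rho ^+ n.+2 * j <= 2^-1 * j by rewrite ler_wpM2r.
  have B : 0 <= a * ((n.+2%:R)^-1 * (n.+2%:R)^-1) by rewrite !mulr_ge0 // ltW.
  have E : rho ^+ 2 * a = a - 2 * (a * (n.+2%:R)^-1) +
      a * ((n.+2%:R)^-1 * (n.+2%:R)^-1) by rewrite /rho; ring.
  rewrite E in H; move: H A B; rewrite (mulrCA a 2).
  set i := (n.+2%:R)^-1; set ai := a * i; set P := rho ^+ _ * j; set aii := a * _.
  by clear; lra.
have h2 : (n.+2%:R)^-1 <= (n.+1%:R)^-1 :> R by rewrite lef_pV2 ?posrE // ler_nat.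
have h3 : a * (n.+2%:R)^-1 <= a * (n.+1%:R)^-1 by rewrite ler_wpM2l // ltW.
move: h1 h3; rewrite -mulrA (mulrCA a 2); set x := a * _; set y := a * _.
by clear; lra.
Qed.

End Moments.

Section MomentBounds.
Context {R : realType}.
Variables (alpha : R) (alpha_gt0 : 0 < alpha) (alpha_lt2 : alpha < 2).

Definition wgt (a rho r : R) : R := below rho r * (1 - r) `^ a.

Lemma wgt_ge0 a rho r : 0 <= wgt a rho r.
Proof. by rewrite mulr_ge0 ?below_ge0 ?powR_ge0. Qed.

Lemma measurable_wgt a rho : measurable_fun setT (wgt a rho).
Proof.
apply: measurable_funM; first exact: measurable_below.
have m1 : measurable_fun setT (fun r : R => 1 - r) by exact: measurable_funB.
exact: (measurableT_comp (measurable_powR _) m1).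
Qed.

Definition wmom a rho n (r : R) : R := r ^+ (n * 2) * wgt a rho r.

Lemma wmom_ge0 a rho n r : 0 <= wmom a rho n r.
Proof. by rewrite /wmom exprM mulr_ge0 ?sqr_ge0 ?wgt_ge0. Qed.

Lemma measurable_wmom a rho n : measurable_fun setT (wmom a rho n).
Proof. by apply: measurable_funM; [exact: measurable_funX|exact: measurable_wgt]. Qed.

Lemma powR_le1Dsqr (x : R) : 0 <= x -> x `^ alpha <= 1 + x ^+ 2.
Proof.
move=> x0; have [x1|x1] := leP x 1.
  apply: (@le_trans _ _ 1); last by rewrite lerDl sqr_ge0.
  have e1 : 1 `^ alpha = 1 :> R by rewrite powR1.
  rewrite -[leRHS]e1; apply: ge0_ler_powR => //; rewrite ?nnegrE //; exact: ltW.
apply: (@le_trans _ _ (x `^ 2%:R)); first by apply: ler_powR; exact: ltW.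
by rewrite powR_mulrn // lerDr.
Qed.

(** Partial sums of the series of (1 - r)^(-2), with an explicit nonnegative remainder. *)
Lemma sum_muln_expr_le (r : R) N : 0 <= r <= 1 ->
  (1 - r) ^+ 2 * \sum_(k < N) k.+1%:R * r ^+ k <= 1.
Proof.
move=> /andP[r0 r1].
suff -> : (1 - r) ^+ 2 * \sum_(k < N) k.+1%:R * r ^+ k =
    1 - r ^+ N - N%:R * r ^+ N * (1 - r).
  have : 0 <= r ^+ N by rewrite exprn_ge0.
  have : 0 <= N%:R * r ^+ N * (1 - r) by rewrite !mulr_ge0 ?exprn_ge0 ?subr_ge0.
  lra.
elim: N => [|N IH]; first by rewrite big_ord0 !mul0r expr0; ring.
by rewrite big_ord_recr /= mulrDr IH (exprSr r N) -natr1; ring.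
Qed.

(** Write (n+1)^2 <= 2 (1 + ... + (n+1)) and replace r^n by the larger r^k in the k-th term. *)
Lemma sqr_muln_expr_le (r : R) n : 0 <= r <= 1 ->
  r ^+ n * (n.+1%:R * (1 - r)) ^+ 2 <= 2.
Proof.
move=> /andP[r0 r1].
have tri : n.+1%:R ^+ 2 <= 2 * \sum_(k < n.+1) k.+1%:R :> R.
  elim: n => [|m IH]; first by rewrite big_ord_recr big_ord0 /= add0r expr1n; lra.
  rewrite big_ord_recr /= mulrDr; apply: le_trans _ (lerD IH (lexx _)).
  have -> : m.+2%:R = m.+1%:R + 1 :> R by rewrite natr1.
  have := ler0n R m.+1; set k := m.+1%:R; move=> k0; rewrite expr2; nra.
have S : r ^+ n * \sum_(k < n.+1) k.+1%:R <= \sum_(k < n.+1) k.+1%:R * r ^+ k.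
  rewrite mulr_sumr; apply: ler_sum => k _; rewrite mulrC ler_wpM2l //.
  by apply: ler_wiXn2l => //; rewrite -ltnS.
have H := sum_muln_expr_le r n.+1 (introT andP (conj r0 r1)).
rewrite exprMn mulrA.
apply: (@le_trans _ _ (2 * (\sum_(k < n.+1) k.+1%:R * r ^+ k) * (1 - r) ^+ 2)).
  apply: ler_wpM2r; first exact: sqr_ge0.
  have := ler_wpM2l (exprn_ge0 n r0) tri; rewrite mulrCA; lra.
by move: H; rewrite -mulrA [_ * (1 - r) ^+ 2]mulrC; lra.
Qed.

(** In r^(2n) = r^n r^n one factor absorbs x^alpha for x = (n+1)(1 - r): since x^alpha <= 1 + x^2,
    the product r^n x^alpha is at most 3. The other factor has the unweighted moment, at most
    4a/(n+1). *)
Lemma mom_upper : exists2 C : R, 0 < C & forall n,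
  (radint (wmom alpha 1 n) <= (C * (n.+1%:R `^ (- (1 + alpha))))%:E)%E.
Proof.
have [a a0 Ea] := @disc_area R.
exists (3 * (4 * a)) => [|n]; first by rewrite !mulr_gt0.
have p0 : 0 <= n.+1%:R `^ (- alpha) :> R by exact: powR_ge0.
apply: (@le_trans _ _ (radint (fun r => (3 * n.+1%:R `^ (- alpha)) * powbelow n 1 r))).
  apply: le_radint.
  - exact: measurable_wmom.
  - by apply: measurable_funM => //; exact: measurable_powbelow.
  - exact: wmom_ge0.
  move=> r r0; rewrite /wmom /wgt /powbelow ger0_norm // /below.
  case: (ltP r 1) => r1; last by rewrite !(mul0r, mulr0).
  rewrite mul1r mulr1 muln2 -addnn exprD -mulrA [leRHS]mulrC.
  apply: ler_wpM2l; first exact: exprn_ge0.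
  have x0 : 0 <= n.+1%:R * (1 - r) by rewrite mulr_ge0 // subr_ge0 ltW.
  have -> : (1 - r) `^ alpha = n.+1%:R `^ (- alpha) * (n.+1%:R * (1 - r)) `^ alpha.
    by rewrite powRM ?subr_ge0 ?(ltW r1) // powRN mulrA mulVf ?mul1r.
  rewrite mulrCA [3 * _]mulrC; apply: ler_wpM2l => //.
  apply: (@le_trans _ _ (r ^+ n * (1 + (n.+1%:R * (1 - r)) ^+ 2))).
    by apply: ler_wpM2l; [exact: exprn_ge0|exact: powR_le1Dsqr].
  rewrite mulrDr mulr1.
  have := sqr_muln_expr_le r n (introT andP (conj r0 (ltW r1))).
  have : r ^+ n <= 1 by rewrite exprn_ile1 // ltW.
  lra.
rewrite radintZ; last 3 first.
- by rewrite mulr_ge0.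
- exact: measurable_powbelow.
- exact: powbelow_ge0.
apply: (@le_trans _ _ ((3 * n.+1%:R `^ (- alpha))%:E * (4 * a / n.+1%:R)%:E)%E).
  by apply: lee_wpmul2l; [rewrite lee_fin mulr_ge0|exact: radint_powbelow_le].
rewrite -EFinM lee_fin opprD powRD; last by rewrite pnatr_eq0 implybT.
rewrite powR_inv1 // le_eqVlt; apply/orP; left; apply/eqP; ring.
Qed.

(** For n > 0 the base is 1/(1 + 2/n) >= exp(-2/n). *)
Lemma expr_lower n : expR (- 4) <= (1 - 2 * (n.+2%:R)^-1) ^+ (n * 2) :> R.
Proof.
case: n => [|n]; first by rewrite expr0 expR_le1; lra.
have n0 : 0 < n.+1%:R :> R by rewrite ltr0n.
have E : 1 - 2 * (n.+3%:R)^-1 = (1 + 2 / n.+1%:R)^-1 :> R.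
  have -> : n.+3%:R = n.+1%:R + 2 :> R by rewrite -natrD addn2.
  by field; apply/andP; split; apply: lt0r_neq0; lra.
have h : expR (- (2 / n.+1%:R)) <= 1 - 2 * (n.+3%:R)^-1 :> R.
  by rewrite E expRN lef_pV2 ?posrE ?expR_gt0 //; exact: expR_ge1Dx.
apply: (@le_trans _ _ (expR (- (2 / n.+1%:R)) ^+ (n.+1 * 2))).
  rewrite -expRM_natl natrM; rewrite le_eqVlt; apply/orP; left; apply/eqP.
  by congr expR; field; exact: lt0r_neq0.
apply: lerXn2r => //; rewrite ?nnegrE ?expR_ge0 //.
by apply: le_trans h; exact: expR_ge0.
Qed.

(* Restrict the integral to the annulus 1 - 2/(n+2) <= r < 1 - 1/(n+2). *)
Lemma mom_lower : exists2 c : R, 0 < c & forall n rho,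
  1 - (n.+2%:R)^-1 <= rho ->
  ((c * (n.+1%:R `^ (- (1 + alpha))))%:E <= radint (wmom alpha rho n))%E.
Proof.
have [a a0 Ea] := @disc_area R.
(* With i = 1/(n+2): on the annulus r^(2n) >= exp(-4) and (1 - r)^alpha >= i^alpha; its area is a i
   (2 - 3i) >= a i / 2; the last factor comes from n + 2 <= 2 (n+1). *)
exists (expR (- 4) * a / 2 * 2 `^ (- (1 + alpha))) => [|n rho Hrho].
  by rewrite mulr_gt0 ?powR_gt0 // divr_gt0 // mulr_gt0 // expR_gt0.
set i := (n.+2%:R)^-1 in Hrho *.
have i0 : 0 < i by rewrite invr_gt0.
have i1 : i <= 2^-1 by rewrite lef_pV2 ?posrE // ler_nat.
pose r2 := 1 - i; pose r1 := 1 - 2 * i.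
have r20 : 0 < r2 by move: i1; rewrite /r2; lra.
have r1_ge0 : 0 <= r1 by move: i1; rewrite /r1; lra.
set kappa := expR (- 4) * i `^ alpha.
have k0 : 0 <= kappa by rewrite mulr_ge0 ?expR_ge0 ?powR_ge0.
have H : (radint (fun r => kappa * powbelow 0 r2 r)%R <=
    radint (fun r => wmom alpha rho n r + kappa * powbelow 0 r1 r)%R)%E.
  apply: le_radint.
  - by apply: measurable_funM => //; exact: measurable_powbelow.
  - apply: measurable_funD; first exact: measurable_wmom.
    by apply: measurable_funM => //; exact: measurable_powbelow.
  - by move=> r; rewrite mulr_ge0 ?powbelow_ge0.
  move=> r r0; rewrite /powbelow !expr0 !mul1r /below.
  case: (ltP r r2) => h2; last first.
    by rewrite mulr0 addr_ge0 ?wmom_ge0 // mulr_ge0.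
  case: (ltP r r1) => h1; first by rewrite lerDr wmom_ge0.
  rewrite mulr0 addr0 mulr1 /wmom /wgt /below (lt_le_trans h2 Hrho) mul1r.
  apply: ler_pM; rewrite ?expR_ge0 ?powR_ge0 //.
    apply: le_trans (expr_lower n) _; apply: lerXn2r; rewrite ?nnegrE //.
  apply: ge0_ler_powR; rewrite ?nnegrE ?(ltW alpha_gt0) ?(ltW i0) //.
    by move: h2 i0; rewrite /r2; lra.
  by move: h2; rewrite /r2; lra.
have J1 : radint (powbelow 0 r1) = ((r1 ^+ 2) * a)%:E.
  have [r1z|r1n] := eqVneq r1 0; last first.
    by rewrite radint_powbelow ?Ea -?EFinM // lt0r r1n.
  rewrite r1z expr0n mul0r; apply: integral0_eq => p _.
  by rewrite /powbelow /below ltNge cmod_ge0 mulr0.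
have mp (rho' : R) : measurable_fun setT (powbelow 0 rho') := measurable_powbelow 0 rho'.
have gp (rho' : R) := powbelow_ge0 0 rho'.
have HL : radint (fun r => kappa * powbelow 0 r2 r) = (kappa * (r2 ^+ 2 * a))%:E.
  by rewrite (radintZ _ _ k0 (mp r2) (gp r2)) (radint_powbelow _ _ r20) Ea -!EFinM.
have HR : radint (fun r => kappa * powbelow 0 r1 r) = (kappa * (r1 ^+ 2 * a))%:E.
  by rewrite (radintZ _ _ k0 (mp r1) (gp r1)) J1 -EFinM.
rewrite radintD ?HL ?HR in H; last 4 first.
- exact: measurable_wmom.
- by apply: measurable_funM.
- exact: wmom_ge0.
- by move=> r; rewrite mulr_ge0 ?powbelow_ge0.
have {}H : ((kappa * (r2 ^+ 2 * a) - kappa * (r1 ^+ 2 * a))%:E <=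
    radint (wmom alpha rho n))%E.
  by rewrite EFinB leeBlDr.
apply: le_trans H; rewrite lee_fin.
have -> : kappa * (r2 ^+ 2 * a) - kappa * (r1 ^+ 2 * a) =
   expR (- 4) * a * (i `^ alpha * i) * (2 - 3 * i) by rewrite /kappa /r2 /r1; ring.
have ia : i `^ alpha * i = n.+2%:R `^ (- (1 + alpha)).
  rewrite opprD powRD ?pnatr_eq0 ?implybT // powR_inv1 // mulrC -/i; congr (_ * _).
  by rewrite /i -powR_inv1 // -powRrM mulN1r.
rewrite ia.
have p2 : 2 `^ (- (1 + alpha)) * n.+1%:R `^ (- (1 + alpha)) <= n.+2%:R `^ (- (1 + alpha)).
  rewrite -powRM // !powRN lef_pV2 ?posrE ?powR_gt0 ?mulr_gt0 //.
  have a1 : 0 <= 1 + alpha by rewrite addr_ge0 // ltW.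
  apply: ge0_ler_powR => //; rewrite ?nnegrE ?mulr_ge0 //.
  by rewrite -natrM ler_nat mul2n -addnn addSn ltnS addnS ltnS leq_addl.
have e0 : 0 <= expR (- 4) * a by rewrite mulr_ge0 ?expR_ge0 // ltW.
have q0 : 0 <= n.+2%:R `^ (- (1 + alpha)) :> R by exact: powR_ge0.
have h1 : expR (- 4) * a * (2 `^ (- (1 + alpha)) * n.+1%:R `^ (- (1 + alpha))) <=
   expR (- 4) * a * n.+2%:R `^ (- (1 + alpha)) by rewrite ler_wpM2l.
have h2 : 2^-1 <= 2 - 3 * i by move: i1; lra.
have := ler_wpM2l (mulr_ge0 e0 q0) h2.
have -> : expR (- 4) * a / 2 * 2 `^ (- (1 + alpha)) * n.+1%:R `^ (- (1 + alpha)) =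
  expR (- 4) * a * (2 `^ (- (1 + alpha)) * n.+1%:R `^ (- (1 + alpha))) / 2 by ring.
move=> h3; apply: le_trans h3; rewrite ler_wpM2r ?invr_ge0 //.
Qed.

End MomentBounds.

Section NormEquivalence.
Context {R : realType}.
Variables (alpha : R) (alpha_gt0 : 0 < alpha) (alpha_lt2 : alpha < 2).
Notation mu2 := (@area_measure R).
Implicit Types (f g : R[i] -> R[i]) (c d : nat -> R[i]).

Definition psum_to d N (z : R[i]) : R[i] := \sum_(n < N) d n * z ^+ n.

Definition wint (rho : R) g : \bar R :=
  (\int[mu2]_p (cmod (g (zc p)) ^+ 2 * wgt alpha rho (cmod (zc p)))%:E)%E.

Lemma dirichlet_norm2E f :
  dirichlet_norm2 alpha f =
  ((cmod (f 0) ^+ 2)%:E + wint 1 (derive1 (f : R[i]^o -> R[i]^o)))%E.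
Proof.
rewrite /dirichlet_norm2 /wint integral_mkcond; congr (_ + _)%E.
apply: eq_integral => p _; rewrite patchE /wgt /below.
case: ifPn => [|/negP]; rewrite inE /area_disc /unit_disc /=.
  by move=> h; rewrite /zc h mul1r.
by move=> /negP/negbTE h; rewrite /zc h mul0r mulr0.
Qed.

(** The weight vanishes off the disc, so the convergence holds at every point of the plane. *)
Lemma cvg_integrand d g rho (z : R[i]) : rho <= 1 ->
  (forall w, unit_disc w -> has_csum (fun n => d n * w ^+ n) (g w)) ->
  (fun N => cmod (psum_to d N z) ^+ 2 * wgt alpha rho (cmod z)) @ \oo -->
     cmod (g z) ^+ 2 * wgt alpha rho (cmod z).
Proof.
move=> rho1 H; have [z1|z1] := ltP (cmod z) 1.
  by apply: cvgM; [exact: has_csum_cmod2 (H z z1)|exact: cvg_cst].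
rewrite /wgt /below ltNge (le_trans rho1 z1) /= mul0r.
by under eq_fun do rewrite mulr0; rewrite mulr0; exact: cvg_cst.
Qed.

Lemma measurable_poly_integrand d N rho : measurable_fun setT
  (fun p => cmod (psum_to d N (zc p)) ^+ 2 * wgt alpha rho (cmod (zc p))).
Proof.
apply: measurable_funM; first exact: (cmeas_cmod2 _ (cmeas_poly _ _)).
apply: measurable_radial; exact: measurable_wgt.
Qed.

Lemma measurable_integrand d g rho : rho <= 1 ->
  (forall w, unit_disc w -> has_csum (fun n => d n * w ^+ n) (g w)) ->
  measurable_fun setT
    (fun p => cmod (g (zc p)) ^+ 2 * wgt alpha rho (cmod (zc p))).
Proof.
move=> rho1 H.
apply: (@measurable_fun_cvg _ _ _ _ (fun N p =>
  cmod (psum_to d N (zc p)) ^+ 2 * wgt alpha rho (cmod (zc p)))) => //.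
- by move=> N; exact: measurable_poly_integrand.
- by move=> p _; exact: cvg_integrand.
Qed.

Lemma wint_poly d N rho : wint rho (psum_to d N) =
  (\sum_(n < N) (cmod (d n) ^+ 2)%:E * radint (wmom alpha rho n))%E.
Proof.
by rewrite /wint /psum_to poly_parseval //; [exact: measurable_wgt|exact: wgt_ge0].
Qed.

(** Fatou's lemma along the Taylor polynomials of g. *)
Lemma wint_upper d g K :
  (forall w, unit_disc w -> has_csum (fun n => d n * w ^+ n) (g w)) ->
  (forall N, (wint 1 (psum_to d N) <= K%:E)%E) -> (wint 1 g <= K%:E)%E.
Proof.
move=> H HK.
pose F N p := (cmod (psum_to d N (zc p)) ^+ 2 * wgt alpha 1 (cmod (zc p)))%:E : \bar R.
have -> : wint 1 g = (\int[mu2]_p (limn_einf (F ^~ p)))%E.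
  apply: eq_integral => p _; rewrite /F.
  have C := cvg_integrand d g 1 (zc p) (lexx _) H.
  have C' : (fun N => (cmod (psum_to d N (zc p)) ^+ 2 *
     wgt alpha 1 (cmod (zc p)))%:E) @ \oo -->
     (cmod (g (zc p)) ^+ 2 * wgt alpha 1 (cmod (zc p)))%:E.
    by apply: cvg_EFin => //; exact: nearW.
  by have [-> _] := cvg_limn_einf_sup C'.
apply: le_trans (fatou _ _ _ _) _ => //.
- by move=> N; apply/measurable_EFinP; exact: measurable_poly_integrand.
- by move=> N p _; rewrite lee_fin mulr_ge0 ?exprn_ge0 ?cmod_ge0 ?wgt_ge0.
rewrite limn_einf_lim; apply: lime_le; first exact: is_cvg_einfs.
apply: nearW => N; apply: le_trans (HK N); apply: ereal_inf_lbound.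
by exists N => /=.
Qed.

Lemma le_wint g (h : R[i] -> R) rho :
  measurable_fun setT (fun p => cmod (g (zc p)) ^+ 2 * wgt alpha rho (cmod (zc p))) ->
  measurable_fun setT (fun p => h (zc p)) ->
  (forall z, cmod (g z) ^+ 2 * wgt alpha rho (cmod z) <= h z) ->
  (wint rho g <= \int[mu2]_p (h (zc p))%:E)%E.
Proof.
move=> mg mh gh; apply: ge0_le_integral => //.
- by move=> p _; rewrite lee_fin mulr_ge0 ?exprn_ge0 ?cmod_ge0 ?wgt_ge0.
- exact/measurable_EFinP.
- exact/measurable_EFinP.
- by move=> p _; rewrite lee_fin.
Qed.

Lemma wmom0_fin rho : rho <= 1 -> exists2 q : R, 0 <= q & radint (wgt alpha rho) = q%:E.
Proof.
move=> rho1; have [C C0 HC] := mom_upper alpha alpha_gt0 alpha_lt2.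
have le1 : (radint (wgt alpha rho) <= (C * 1%:R `^ (- (1 + alpha)))%:E)%E.
  apply: le_trans (HC 0%N); apply: le_radint.
  - exact: measurable_wgt.
  - exact: measurable_wmom.
  - exact: wgt_ge0.
  move=> r r0; rewrite /wmom mul0n expr0 mul1r /wgt /below.
  apply: ler_wpM2r; first exact: powR_ge0.
  by case: (ltP r rho) => [/lt_le_trans ->|]//.
have ge0 := radint_ge0 _ (wgt_ge0 alpha rho).
case E : (radint (wgt alpha rho)) => [q| |]; rewrite E // in le1 ge0.
by exists q; rewrite // -lee_fin.
Qed.

(* On the disc of radius rho < 1 the Taylor polynomials P_M of g are within
   S - s M of g, so that |P_M|^2 <= 2 |g|^2 + 2 (S - s M)^2. *)
Lemma wint_lower : exists2 k : R, 0 < k & forall d g (I : R) N,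
  tempered 1 d ->
  (forall w, unit_disc w -> has_csum (fun n => d n * w ^+ n) (g w)) ->
  wint 1 g = I%:E ->
  \sum_(n < N) cmod (d n) ^+ 2 * n.+1%:R `^ (- (1 + alpha)) <= k * I.
Proof.
have [c c0 Hc] := mom_lower alpha alpha_gt0.
exists (2 / c) => [|d g I N td H EI]; first by rewrite divr_gt0.
(* For n < N this radius is at least 1 - 1/(n+2), as the lower moment bound requires. *)
pose rho : R := 1 - (N.+1%:R)^-1.
have rho0 : 0 <= rho by rewrite subr_ge0 invf_le1 // ler1n.
have rho1 : rho < 1 by rewrite gtrBl invr_gt0.
have [q q0 Eq] := wmom0_fin rho (ltW rho1).
pose s M := \sum_(n < M) cmod (d n) * rho ^+ n.
have [K HK] := tempered_summable _ _ rho td (introT andP (conj rho0 rho1)).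
have [|S s_cvg sS] := cvg_nonneg_series (fun n => cmod (d n) * rho ^+ n) K _ HK.
  by move=> n; rewrite mulr_ge0 ?cmod_ge0 ?exprn_ge0.
rewrite -/s in s_cvg; have {}sS M : s M <= S by exact: sS.
have err M z : cmod z < rho -> cmod (g z - psum_to d M z) <= S - s M.
  move=> zr; apply: (has_csum_bound M _ _ _ _ (H z (lt_trans zr rho1))) => L ML.
  have term n : cmod (d n * z ^+ n) <= cmod (d n) * rho ^+ n.
    rewrite cmodM cmodX ler_wpM2l ?cmod_ge0 //.
    by apply: lerXn2r; rewrite ?nnegrE ?cmod_ge0 ?(ltW zr).
  have diff a b : (a <= b)%N -> cmod (psum_to d b z - psum_to d a z) <= s b - s a.
    move=> ab; rewrite /psum_to /s.
    rewrite -!(big_mkord xpredT (fun n => d n * z ^+ n)).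
    rewrite -!(big_mkord xpredT (fun n => cmod (d n) * rho ^+ n)).
    rewrite (big_cat_nat (leq0n a) ab) //= [X in _ <= X - _](big_cat_nat (leq0n a) ab) //=.
    rewrite !(addrC (\sum_(0 <= i < a) _)) !addrK.
    by apply: le_trans (cmod_sum _ _ _ _) _; apply: ler_sum => i _.
  rewrite -/(psum_to d L z).
  by apply: le_trans (diff _ _ ML) _; rewrite lerD2r.
have wfin z : 0 <= wgt alpha rho (cmod z) := wgt_ge0 _ _ _.
have key M : (N <= M)%N ->
    \sum_(n < N) cmod (d n) ^+ 2 * (c * n.+1%:R `^ (- (1 + alpha))) <=
    2 * I + 2 * (S - s M) ^+ 2 * q.
  move=> NM; rewrite -lee_fin.
  have h1 : (wint rho (psum_to d M) <= (2 * I + 2 * (S - s M) ^+ 2 * q)%:E)%E.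
    have mg := measurable_integrand d g 1 (lexx _) H.
    have mW := measurable_radial _ (measurable_wgt alpha rho).
    pose h z := 2 * (cmod (g z) ^+ 2 * wgt alpha 1 (cmod z)) +
       2 * (S - s M) ^+ 2 * wgt alpha rho (cmod z).
    have -> : (2 * I + 2 * (S - s M) ^+ 2 * q)%:E = (\int[mu2]_p (h (zc p))%:E)%E.
      have t0 : 0 <= 2 * (S - s M) ^+ 2 by rewrite mulr_ge0 ?sqr_ge0.
      have A0 p : (0 <= (cmod (g (zc p)) ^+ 2 * wgt alpha 1 (cmod (zc p)))%:E)%E.
        by rewrite lee_fin mulr_ge0 ?sqr_ge0 ?wgt_ge0.
      have B0 p : (0 <= (wgt alpha rho (cmod (zc p)))%:E)%E by rewrite lee_fin wgt_ge0.
      rewrite /h; under eq_integral do rewrite EFinD EFinM (EFinM (2 * _)).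
      have mA : measurable_fun setT (fun p : R * R =>
          (cmod (g (zc p)) ^+ 2 * wgt alpha 1 (cmod (zc p)))%:E) by exact/measurable_EFinP.
      have mB : measurable_fun setT (fun p : R * R =>
          (wgt alpha rho (cmod (zc p)))%:E) by exact/measurable_EFinP.
      have E1 : (\int[mu2]_p (2%:E * (cmod (g (zc p)) ^+ 2 *
          wgt alpha 1 (cmod (zc p)))%:E) = (2 * I)%:E)%E.
        by rewrite ge0_integralZl_EFin // -/(wint 1 g) EI.
      have E2 : (\int[mu2]_p ((2 * (S - s M) ^+ 2)%R%:E * (wgt alpha rho (cmod (zc p)))%:E) =
          (2 * (S - s M) ^+ 2 * q)%:E)%E.
        by rewrite ge0_integralZl_EFin // -/(radint (wgt alpha rho)) Eq.
      rewrite ge0_integralD //; first by rewrite E1 E2.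
      - by move=> p _; apply: mule_ge0.
      - exact: measurable_funeM.
      - by move=> p _; apply: mule_ge0.
      - exact: measurable_funeM.
    apply: le_wint; first exact: measurable_poly_integrand.
      apply: measurable_funD; apply: measurable_funM => //.
    move=> z; rewrite /h.
    case: (ltP (cmod z) rho) => [zr|zr]; last first.
      have -> : wgt alpha rho (cmod z) = 0 by rewrite /wgt /below ltNge zr mul0r.
      rewrite !mulr0 addr0. apply: mulr_ge0 => //; apply: mulr_ge0; [exact: sqr_ge0|exact: wgt_ge0].
    have -> : wgt alpha 1 (cmod z) = wgt alpha rho (cmod z).
      by rewrite /wgt /below zr (lt_trans zr rho1).
    rewrite mulrA -mulrDl; apply: ler_wpM2r => //.
    have e1 : cmod (psum_to d M z) <= cmod (g z) + (S - s M).
      have := cmodB (psum_to d M z) (g z); have := err M z zr.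
      by rewrite (cmodBC (g z)); lra.
    have e2 : 0 <= S - s M by rewrite subr_ge0.
    have e3 := cmod_ge0 (psum_to d M z); have e4 := cmod_ge0 (g z).
    move: (cmod (psum_to d M z)) (cmod (g z)) (S - s M) e1 e2 e3 e4 => x y t e1 e2 e3 e4.
    have : x ^+ 2 <= (y + t) ^+ 2 by apply: lerXn2r; rewrite ?nnegrE ?addr_ge0.
    have : 0 <= (y - t) ^+ 2 by exact: sqr_ge0.
    rewrite !expr2; lra.
  apply: le_trans h1; rewrite wint_poly -sumEFin.
  apply: (@le_trans _ _ (\sum_(n < N) (cmod (d n) ^+ 2)%:E * radint (wmom alpha rho n))%E).
    apply: lee_sum => n _; rewrite EFinM; apply: lee_wpmul2l.
      by rewrite lee_fin sqr_ge0.
    apply: Hc; rewrite /rho lerD2l lerN2 lef_pV2 ?posrE // ler_nat.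
    by rewrite ltnS; exact: ltn_ord.
  rewrite -!(big_mkord xpredT (fun n => (cmod (d n) ^+ 2)%:E * radint (wmom alpha rho n))%E).
  rewrite [leRHS](big_cat_nat (leq0n N) NM) //= leeDl //; apply: sume_ge0 => n _.
  by rewrite mule_ge0 ?lee_fin ?sqr_ge0 // radint_ge0 //; exact: wmom_ge0.
(* N, and with it rho, is fixed while the degree M tends to infinity, so the uniform error
   disappears. *)
have lim : (fun M => 2 * I + 2 * (S - s M) ^+ 2 * q) @ \oo --> 2 * I.
  have : (fun M => 2 * I + 2 * (S - s M) ^+ 2 * q) @ \oo -->
      2 * I + 2 * ((S - S) * (S - S)) * q.
    apply: cvgD; first exact: cvg_cst.
    apply: cvgM; last exact: cvg_cst.
    apply: cvgM; first exact: cvg_cst.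
    by under eq_fun do rewrite expr2; apply: cvgM; apply: cvgB => //; exact: cvg_cst.
  by rewrite subrr !mulr0 mul0r addr0.
have fin : \sum_(n < N) cmod (d n) ^+ 2 * (c * n.+1%:R `^ (- (1 + alpha))) <= 2 * I.
  apply: (ler_cvg_to (cvg_cst _) lim); exists N => // M; exact: key.
rewrite mulrAC ler_pdivlMr // mulr_suml; apply: le_trans fin.
by apply: ler_sum => n _; rewrite -mulrA [_ * c]mulrC.
Qed.

End NormEquivalence.

(** * Schur's test *)

Section Schur.
Context {R : realType}.

(** Young's inequality for y^q and 1 with exponents 1/q and 1/(1-q). *)
Lemma powR_bernoulli (y q : R) : 0 <= y -> 0 < q < 1 -> y `^ q <= 1 - q * (1 - y).
Proof.
move=> y0 /andP[q0 q1].
have p1 : 0 < 1 - q by rewrite subr_gt0.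
have := @conjugate_powR R (y `^ q) 1 q^-1 (1 - q)^-1 (powR_ge0 _ _) ler01.
rewrite !invrK mulr1 -powRrM divff ?gt_eqF // powRr1 // powR1.
rewrite !invr_gt0 => /(_ q0 p1) h.
have {}h : y `^ q <= y * q + 1 * (1 - q) by apply: h; lra.
lra.
Qed.

Lemma powR_neg_bernoulli (y q : R) : 0 < y -> 0 < q ->
  1 + q * (1 - y) <= y `^ (- q).
Proof.
move=> y0 q0; rewrite /powR gt_eqF //.
apply: le_trans (expR_ge1Dx _); rewrite lerD2l mulNr -mulrN ler_pM2l //.
have : ln (1 + (y - 1)) <= y - 1 by apply: le_ln1Dx; lra.
by rewrite addrC subrK; lra.
Qed.

(** A discrete form of comparison with the integral of x^(q-1): the induction step is Bernoulli's
    inequality at y = M/(M+1), multiplied by (M+1)^q. The tail estimate below uses the exponent -q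
    in the same way. *)
Lemma sum_powR_below (q : R) M : 0 < q < 1 ->
  \sum_(k < M) k.+1%:R `^ (q - 1) <= M%:R `^ q / q.
Proof.
move=> /andP[q0 q1]; elim: M => [|M IH].
  by rewrite big_ord0 divr_ge0 ?powR_ge0 // ltW.
rewrite big_ord_recr /=; apply: le_trans (lerD IH (lexx _)) _.
rewrite ler_pdivlMr // mulrDl divfK ?gt_eqF //.
have n0 : 0 < M.+1%:R :> R by rewrite ltr0n.
have y0 : 0 <= M%:R / M.+1%:R :> R by rewrite divr_ge0.
have := powR_bernoulli _ q y0 (introT andP (conj q0 q1)).
have -> : 1 - M%:R / M.+1%:R = M.+1%:R^-1 :> R.
  by rewrite -natr1; field; rewrite natr1 gt_eqF.
move=> /(ler_wpM2r (powR_ge0 M.+1%:R q)).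
rewrite -powRM // divfK ?gt_eqF // mulrBl mul1r => h.
have -> : M.+1%:R `^ (q - 1) = M.+1%:R^-1 * M.+1%:R `^ q :> R.
  by rewrite powRB ?pnatr_eq0 ?implybT // powRr1 // mulrC.
move: h; move: (M.+1%:R `^ q) (M.+1%:R^-1 : R) (M%:R `^ q) => X v Y; lra.
Qed.

Lemma sum_powR_above (q : R) n M : 0 < q -> (n < M)%N ->
  \sum_(n.+1 <= k < M) k.+1%:R `^ (- q - 1) <= (n.+1%:R `^ (- q) - M%:R `^ (- q)) / q.
Proof.
move=> q0; elim: M => [//|M IH]; rewrite ltnS leq_eqVlt => /predU1P[->|nM].
  by rewrite big_geq // subrr mul0r.
rewrite big_nat_recr //=; apply: le_trans (lerD (IH nM) (lexx _)) _.
rewrite ler_pdivlMr // mulrDl divfK ?gt_eqF //.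
have M0 : 0 < M%:R :> R by rewrite ltr0n (leq_ltn_trans _ nM).
have n0 : 0 < M.+1%:R :> R by rewrite ltr0n.
have y0 : 0 < M%:R / M.+1%:R :> R by rewrite divr_gt0.
have := powR_neg_bernoulli _ q y0 q0.
have -> : 1 - M%:R / M.+1%:R = M.+1%:R^-1 :> R.
  by rewrite -natr1; field; rewrite natr1 gt_eqF.
move=> /(ler_wpM2r (powR_ge0 M.+1%:R (- q))).
rewrite -powRM ?(ltW y0) // divfK ?gt_eqF // mulrDl mul1r => h.
have -> : M.+1%:R `^ (- q - 1) = M.+1%:R^-1 * M.+1%:R `^ (- q) :> R.
  by rewrite powRB ?pnatr_eq0 ?implybT // powRr1 // mulrC.
move: h; move: (M.+1%:R `^ (- q)) (M.+1%:R^-1 : R) (M%:R `^ (- q))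
  (n.+1%:R `^ (- q)) => X v Y Z; lra.
Qed.

Definition max_kernel n k : R := ((maxn n k).+1%:R)^-1.

Lemma max_kernel_ge0 n k : 0 <= max_kernel n k.
Proof. by rewrite invr_ge0. Qed.

Lemma max_kernel_le n k : max_kernel n k <= k.+1%:R^-1.
Proof. by rewrite lef_pV2 ?posrE ?ltr0n // ler_nat ltnS leq_maxr. Qed.

Lemma max_kernelC n k : max_kernel n k = max_kernel k n.
Proof. by rewrite /max_kernel maxnC. Qed.

(** Split at k = n. Up to n the kernel is 1/(n+1) and the sum of powers costs 1/(1-q); beyond n it
    is 1/(k+1) and the tail costs 1/q. *)
Lemma sum_max_kernel (q : R) : 0 < q < 1 -> exists2 C : R, 0 < C & forall n M,
  \sum_(k < M) k.+1%:R `^ (- q) * max_kernel n k <= C * n.+1%:R `^ (- q).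
Proof.
move=> /andP[q0 q1]; have p1 : 0 < 1 - q by rewrite subr_gt0.
exists ((1 - q)^-1 + q^-1) => [|n M]; first by rewrite addr_gt0 ?invr_gt0.
have n0 : 0 < n.+1%:R :> R by rewrite ltr0n.
pose F k := k.+1%:R `^ (- q) * max_kernel n k.
have F0 k : 0 <= F k by rewrite mulr_ge0 ?powR_ge0 ?max_kernel_ge0.
apply: (@le_trans _ _ (\sum_(0 <= k < n.+1 + M) F k)).
  rewrite -(big_mkord xpredT F) [leRHS](big_cat_nat (leq0n M) (leq_addl _ _)) /=.
  by rewrite lerDl sumr_ge0.
rewrite (big_cat_nat (leq0n n.+1) (leq_addr _ _)) /= mulrDl; apply: lerD.
- have h := sum_powR_below (1 - q) n.+1.
  have {}h : \sum_(k < n.+1) k.+1%:R `^ (- q) <= n.+1%:R `^ (1 - q) / (1 - q) :> R.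
    have E : 1 - q - 1 = - q by ring.
    by move: h; rewrite E; apply; apply/andP; split; lra.
  apply: (@le_trans _ _ ((\sum_(k < n.+1) k.+1%:R `^ (- q)) * (n.+1%:R)^-1)).
    rewrite big_mkord mulr_suml; apply: ler_sum => k _.
    by rewrite /F /max_kernel (maxn_idPl _) // -ltnS.
  apply: le_trans (ler_wpM2r _ h) _; first by rewrite invr_ge0 ltW.
  rewrite powRD ?pnatr_eq0 ?implybT // powRr1 ?(ltW n0) //.
  rewrite le_eqVlt; apply/orP; left; apply/eqP.
  by field; rewrite !gt_eqF.
- have h := sum_powR_above q n (n.+1 + M) q0 (leq_addr _ _).
  apply: (@le_trans _ _ (\sum_(n.+1 <= k < n.+1 + M) k.+1%:R `^ (- q - 1))).
    rewrite [leLHS]big_seq [leRHS]big_seq; apply: ler_sum => k.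
    rewrite mem_index_iota => /andP[/ltnW nk _].
    rewrite /F /max_kernel (maxn_idPr _) // powRB ?pnatr_eq0 ?implybT // powRr1 //.
  apply: le_trans h _; rewrite [leRHS]mulrC ler_wpM2r ?invr_ge0 ?(ltW q0) //.
  by rewrite gerBl powR_ge0.
Qed.

(** Lagrange's identity: twice the difference of the two sides is the sum of p_i p_j (u_i -
    u_j)^2. *)
Lemma weighted_jensen M (p u : nat -> R) : (forall k, 0 <= p k) ->
  (\sum_(k < M) p k * u k) ^+ 2 <=
  (\sum_(k < M) p k) * \sum_(k < M) p k * u k ^+ 2.
Proof.
move=> p0.
have : 0 <= \sum_(i < M) \sum_(j < M) p i * p j * (u i - u j) ^+ 2.
  by apply: sumr_ge0 => i _; apply: sumr_ge0 => j _; apply: mulr_ge0; [exact: mulr_ge0|exact: sqr_ge0].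
have -> : \sum_(i < M) \sum_(j < M) p i * p j * (u i - u j) ^+ 2 =
  2 * ((\sum_(k < M) p k) * \sum_(k < M) p k * u k ^+ 2) -
  2 * (\sum_(k < M) p k * u k) ^+ 2.
  have e1 : (\sum_(k < M) p k) * (\sum_(k < M) p k * u k ^+ 2) =
     \sum_(i < M) \sum_(j < M) p i * (p j * u j ^+ 2).
    by rewrite mulr_suml; apply: eq_bigr => i _; rewrite mulr_sumr.
  have e2 : (\sum_(k < M) p k * u k) ^+ 2 =
     \sum_(i < M) \sum_(j < M) (p i * u i) * (p j * u j).
    by rewrite expr2 mulr_suml; apply: eq_bigr => i _; rewrite mulr_sumr.
  have e3 : (\sum_(k < M) p k) * (\sum_(k < M) p k * u k ^+ 2) =
     \sum_(i < M) \sum_(j < M) p j * (p i * u i ^+ 2).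
    by rewrite e1 exchange_big.
  rewrite mulr2n !mulrDl !mul1r {1}e1 e3 e2 -big_split /= -big_split /= -sumrB.
  apply: eq_bigr => i _; rewrite -big_split /= -big_split /= -sumrB.
  apply: eq_bigr => j _; ring.
lra.
Qed.

(* The test sequence is (k+1)^(-(1+beta)/2). *)
Theorem schur_max_kernel (beta : R) : -1 < beta < 1 ->
  exists2 C : R, 0 < C & forall (b : nat -> R) N M, (forall k, 0 <= b k) ->
  \sum_(n < N) n.+1%:R `^ beta * (\sum_(k < M) b k * max_kernel n k) ^+ 2 <=
  C * \sum_(k < M) k.+1%:R `^ beta * b k ^+ 2.
Proof.
(* Both s and s - beta = (1 - beta) / 2 lie in ]0, 1[ because |beta| < 1; the row sums use s, and
   the column sums use s - beta. *)
move=> /andP[b1 b2]; pose s := (1 + beta) / 2.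
have [|C C0 HC] := sum_max_kernel s; first by apply/andP; split; rewrite /s; lra.
have [|C' C'0 HC'] := sum_max_kernel (s - beta).
  by apply/andP; split; rewrite /s; lra.
exists (C * C') => [|b N M b0]; first exact: mulr_gt0.
have pw (n : nat) : n.+1%:R != 0 :> R by rewrite pnatr_eq0.
have h n : n.+1%:R `^ beta * (\sum_(k < M) b k * max_kernel n k) ^+ 2 <=
  C * \sum_(k < M) (b k ^+ 2 * k.+1%:R `^ s) * (n.+1%:R `^ (- (s - beta)) * max_kernel k n).
  pose p k := k.+1%:R `^ (- s) * max_kernel n k.
  pose u k := b k * k.+1%:R `^ s.
  have pu k : b k * max_kernel n k = p k * u k.
    rewrite /p /u powRN; field; by rewrite powR_eq0 (negbTE (pw k)).
  have p0 k : 0 <= p k by rewrite mulr_ge0 ?powR_ge0 ?max_kernel_ge0.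
  under eq_bigr do rewrite pu.
  apply: le_trans (ler_wpM2l (powR_ge0 _ _) (weighted_jensen M p u p0)) _.
  have S0 : 0 <= \sum_(k < M) p k * u k ^+ 2.
    by apply: sumr_ge0 => k _; rewrite mulr_ge0 ?sqr_ge0.
  apply: le_trans (ler_wpM2l (powR_ge0 _ _) (ler_wpM2r S0 (HC n M))) _.
  rewrite -!mulrA mulrCA; apply: ler_wpM2l; first exact: ltW.
  rewrite mulrA -powRD ?pw ?implybT // mulr_sumr; apply: ler_sum => k _.
  rewrite le_eqVlt; apply/orP; left; apply/eqP.
  rewrite max_kernelC /p /u powRN opprB.
  field; by rewrite powR_eq0 (negbTE (pw k)).
apply: (@le_trans _ _ (\sum_(n < N) C * \sum_(k < M) (b k ^+ 2 * k.+1%:R `^ s) *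
    (n.+1%:R `^ (- (s - beta)) * max_kernel k n))).
  by apply: ler_sum => n _; exact: h.
rewrite -mulr_sumr -mulrA; apply: ler_wpM2l; first exact: ltW.
rewrite exchange_big /= mulr_sumr; apply: ler_sum => k _.
rewrite -mulr_sumr; apply: le_trans (ler_wpM2l _ (HC' k N)) _.
  by rewrite mulr_ge0 ?sqr_ge0 ?powR_ge0.
rewrite le_eqVlt; apply/orP; left; apply/eqP.
have -> : k.+1%:R `^ beta = k.+1%:R `^ s * k.+1%:R `^ (- (s - beta)) :> R.
  by rewrite -powRD ?pw ?implybT //; congr (_ `^ _); ring.
by ring.
Qed.

End Schur.

(** * Comparison of the Dirichlet norm with the weighted coefficient norm *)

Section CoefficientNorm.
Context {R : realType}.
Variables (alpha : R) (alpha_gt0 : 0 < alpha) (alpha_lt2 : alpha < 2).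
Implicit Types (f g : R[i] -> R[i]) (a c d : nat -> R[i]).

Definition coefw n : R := n.+1%:R `^ (1 - alpha).

Lemma coefw_ge0 n : 0 <= coefw n. Proof. exact: powR_ge0. Qed.

Lemma powR_double (t b : R) : 1 <= t -> t <= 2 -> b <= 1 -> t `^ b <= 2.
Proof.
move=> t1 t2 b1; apply: le_trans (_ : t `^ 1 <= _); first exact: ler_powR.
by rewrite powRr1 // (le_trans ler01).
Qed.

Let ratio n : (n.+2%:R = (n.+2%:R / n.+1%:R) * n.+1%:R :> R) *
  (1 <= n.+2%:R / n.+1%:R :> R) * (n.+2%:R / n.+1%:R <= 2 :> R).
Proof.
split; last first.
  by rewrite ler_pdivrMr // -natrM ler_nat mul2n -addnn addSn ltnS addnS ltnS leq_addl.
split; first by rewrite divfK // pnatr_eq0.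
by rewrite ler_pdivlMr // mul1r ler_nat.
Qed.

(** The ratio (n+2)/(n+1) lies in [1, 2] and |1 - alpha| <= 1. These two comparisons absorb the
    index shift between f and f'. *)
Lemma coefwS_le n : coefw n.+1 <= 2 * coefw n.
Proof.
rewrite /coefw; have [[E r1] r2] := ratio n.
have t0 : 0 < n.+2%:R / n.+1%:R :> R by rewrite (lt_le_trans _ r1).
rewrite E powRM ?(ltW t0) //.
apply: ler_wpM2r; first exact: powR_ge0.
apply: powR_double; [exact: r1|exact: r2|by rewrite gerBl ltW].
Qed.

Lemma le_coefwS n : coefw n <= 2 * coefw n.+1.
Proof.
rewrite /coefw; have [[E r1] r2] := ratio n.
have t0 : 0 < n.+2%:R / n.+1%:R :> R by rewrite (lt_le_trans _ r1).
rewrite E powRM ?(ltW t0) // mulrA.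
apply: ler_peMl; first exact: powR_ge0.
rewrite -[1 - alpha]opprK powRN ler_pdivlMr ?powR_gt0 // mul1r.
by apply: powR_double; [exact: r1|exact: r2|rewrite opprB lerBlDr; exact: ltW].
Qed.

Lemma coefw_pderiv a n : cmod (pderiv a n) ^+ 2 * n.+1%:R `^ (- (1 + alpha)) =
  coefw n * cmod (a n.+1) ^+ 2.
Proof.
rewrite /pderiv cmodM cmodn exprMn /coefw mulrAC; congr (_ * _).
rewrite -powR_mulrn // -powRD ?pnatr_eq0 ?implybT //; congr (_ `^ _); ring.
Qed.

Lemma wint_ge0 rho g : (0 <= wint alpha rho g)%E.
Proof.
apply: integral_ge0 => p _.
by rewrite lee_fin mulr_ge0 ?exprn_ge0 ?cmod_ge0 ?wgt_ge0.
Qed.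

(** The summand 1 of the constant accounts for |f(0)|^2, and 2k for the integral of |f'|^2, the 2
    being the cost of the index shift. *)
Lemma dirichlet_coef_le : exists2 C : R, 0 < C & forall f a N,
  dirichlet alpha f -> tempered 1 a ->
  (forall z, unit_disc z -> has_csum (fun n => a n * z ^+ n) (f z)) ->
  \sum_(n < N) coefw n * cmod (a n) ^+ 2 <= C * fine (dirichlet_norm2 alpha f).
Proof.
have [k k0 Hk] := wint_lower alpha alpha_gt0 alpha_lt2.
exists (1 + 2 * k) => [|f a N [_ ffin] ta Ha]; first by rewrite addr_gt0 // mulr_gt0.
have Hd w : unit_disc w -> has_csum (fun n => pderiv a n * w ^+ n)
    (derive1 (f : R[i]^o -> R[i]^o) w).
  move=> hw; have [s Hs Hd] := power_series_deriv _ _ _ ta Ha w hw.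
  by have [_ ->] := cdiff_derivable _ _ _ Hd.
have f0 : f 0 = a 0%N.
  by apply: has_csum_at0; apply: Ha; rewrite /unit_disc /= cmod0.
have EN := dirichlet_norm2E alpha f; rewrite EN in ffin *.
have ge0 := wint_ge0 1 (derive1 (f : R[i]^o -> R[i]^o)).
case EI : (wint alpha 1 _) => [I| |]; rewrite EI // in ffin ge0 *.
rewrite lee_fin in ge0; rewrite -EFinD /=.
have c0 : 0 <= cmod (f 0) ^+ 2 by exact: sqr_ge0.
case: N => [|N]; first by rewrite big_ord0 mulr_ge0 ?addr_ge0 // mulr_ge0 // ltW.
rewrite big_ord_recl /= -f0 /coefw powR1 mul1r -/coefw.
have h : \sum_(i < N) coefw (bump 0 i) * cmod (a (bump 0 i)) ^+ 2 <= 2 * (k * I).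
  apply: (@le_trans _ _ (2 * \sum_(n < N) cmod (pderiv a n) ^+ 2 * n.+1%:R `^ (- (1 + alpha)))).
    rewrite mulr_sumr; apply: ler_sum => i _.
    rewrite coefw_pderiv mulrA; apply: ler_wpM2r; first exact: sqr_ge0.
    exact: coefwS_le.
  by rewrite ler_pM2l //; apply: (Hk (pderiv a) _ I N (tempered_pderiv _ _ ta) Hd EI).
apply: le_trans (lerD (lexx _) h) _.
have kc : 0 <= k * cmod (f 0) ^+ 2 by rewrite mulr_ge0 // ltW.
lra.
Qed.

(** Since alpha < 2 the weight is at least 1/(n+1), so |c_n|^2 <= K (n+1) and the coefficients grow
    at most polynomially. *)
Lemma tempered_coef c K : (forall N, \sum_(n < N) coefw n * cmod (c n) ^+ 2 <= K) ->
  tempered 1 c.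
Proof.
move=> HK r /andP[r0 r1].
have K0 : 0 <= K by apply: le_trans (HK 0%N); rewrite big_ord0.
have i0 : 0 <= (1 - r)^-1 by rewrite invr_ge0 subr_ge0 ltW.
exists (1 + K * (1 - r)^-1) => n.
have h : coefw n * cmod (c n) ^+ 2 <= K.
  apply: le_trans (HK n.+1); rewrite big_ord_recr /= lerDr.
  by apply: sumr_ge0 => i _; apply: mulr_ge0; [exact: coefw_ge0|exact: sqr_ge0].
have n1 : 1 <= n.+1%:R :> R by rewrite ler1n.
have w1 : 1 <= n.+1%:R * coefw n.
  rewrite /coefw -{1}[n.+1%:R]powRr1 // -powRD ?pnatr_eq0 ?implybT //.
  by rewrite -[leLHS](powRr0 n.+1%:R); apply: ler_powR => //; have := alpha_lt2; lra.
have c2 : cmod (c n) ^+ 2 <= n.+1%:R * K.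
  apply: (@le_trans _ _ (n.+1%:R * (coefw n * cmod (c n) ^+ 2))).
    by rewrite mulrA; apply: ler_peMl => //; exact: sqr_ge0.
  by rewrite ler_wpM2l.
have c1 : cmod (c n) <= 1 + n.+1%:R * K.
  have := sqr_ge0 (cmod (c n) - 1); have := cmod_ge0 (c n).
  move: (cmod (c n)) (n.+1%:R * K) c2 => x y; rewrite !expr2; nra.
apply: le_trans (ler_wpM2r (exprn_ge0 n r0) c1) _.
rewrite mulrDl mul1r; apply: lerD; first by rewrite exprn_ile1 // ltW.
rewrite [_ * K]mulrC -mulrA; apply: ler_wpM2l => //.
exact: muln_expr_le.
Qed.

(** Membership in the space is part of the conclusion, since g is given only by a series: its
    coefficients are tempered, so g is differentiable on the disc with the termwise derivative. *)
Lemma dirichlet_coef_ge : exists2 C : R, 0 < C & forall g c K,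
  (forall z, unit_disc z -> has_csum (fun n => c n * z ^+ n) (g z)) ->
  (forall N, \sum_(n < N) coefw n * cmod (c n) ^+ 2 <= K) ->
  dirichlet alpha g /\ (dirichlet_norm2 alpha g <= (C * K)%:E)%E.
Proof.
have [C C0 HC] := mom_upper alpha alpha_gt0 alpha_lt2.
exists (1 + 2 * C) => [|g c K Hg HK]; first by rewrite addr_gt0 // mulr_gt0.
have tc := tempered_coef _ _ HK.
have Hd w : unit_disc w -> derivable (g : R[i]^o -> R[i]^o) w 1 /\
    has_csum (fun n => pderiv c n * w ^+ n) (derive1 (g : R[i]^o -> R[i]^o) w).
  move=> hw; have [s Hs Hd] := power_series_deriv _ _ _ tc Hg w hw.
  by have [? ->] := cdiff_derivable _ _ _ Hd.
have g0 : g 0 = c 0%N.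
  by apply: has_csum_at0; apply: Hg; rewrite /unit_disc /= cmod0.
have K0 : cmod (g 0) ^+ 2 <= K.
  by have := HK 1%N; rewrite big_ord_recr big_ord0 /= add0r /coefw powR1 mul1r g0.
have I0 : (wint alpha 1 (derive1 (g : R[i]^o -> R[i]^o)) <= (2 * C * K)%:E)%E.
  apply: (wint_upper _ (pderiv c)) => [w /Hd[]//|N].
  rewrite wint_poly.
  apply: (@le_trans _ _ (\sum_(n < N) (2 * C * (coefw n.+1 * cmod (c n.+1) ^+ 2))%:E)%E).
    apply: lee_sum => n _.
    apply: (@le_trans _ _ ((cmod (pderiv c n) ^+ 2)%:E * (C * n.+1%:R `^ (- (1 + alpha)))%:E)%E).
      by apply: lee_wpmul2l; [rewrite lee_fin sqr_ge0|exact: HC].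
    rewrite -EFinM lee_fin mulrCA coefw_pderiv [2 * C]mulrC -mulrA ler_pM2l // mulrA.
    by apply: ler_wpM2r; [exact: sqr_ge0|exact: le_coefwS].
  rewrite sumEFin lee_fin -mulr_sumr; apply: ler_wpM2l; first by rewrite mulr_ge0 // ltW.
  apply: le_trans (HK N.+1); rewrite big_ord_recl /= lerDr.
  by apply: mulr_ge0; [exact: coefw_ge0|exact: sqr_ge0].
have N0 : (dirichlet_norm2 alpha g <= ((1 + 2 * C) * K)%:E)%E.
  rewrite dirichlet_norm2E mulrDl mul1r EFinD; apply: leeD => //.
split=> //; split; first by move=> z /Hd[].
by apply: le_lt_trans N0 _; rewrite ltry.
Qed.

End CoefficientNorm.

(** * Operators given by matrices *)

Section SeriesIntegral.
Context {R : realType}.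
Notation mu := (@lebesgue_measure R).
Implicit Types (gam kap : R -> R[i]) (a : nat -> R[i]) (f : R[i] -> R[i]).

Lemma dominated01 (u : nat -> R -> R) (v : R -> R) (h : R -> \bar R) :
  (forall n, measurable_fun (`]0, 1[%classic : set R) (u n)) ->
  (forall t, 0 < t < 1 -> (fun n => u n t) @ \oo --> v t) ->
  (forall n t, 0 < t < 1 -> (`|u n t|%:E <= h t)%E) ->
  mu.-integrable `]0, 1[ h ->
  mu.-integrable `]0, 1[ (EFin \o v) /\
  (fun n => \int[mu]_(t in `]0, 1[) u n t) @ \oo --> \int[mu]_(t in `]0, 1[) v t.
Proof.
move=> mu_ uv uh ih.
have mv : measurable_fun (`]0, 1[%classic : set R) v.
  apply: (@measurable_fun_cvg _ _ _ _ u) => // t /=; rewrite in_itv /=; exact: uv.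
have [] := @dominated_convergence _ _ R mu `]0, 1[%classic (measurable_itv _)
  (fun n => EFin \o u n) (EFin \o v) h.
- by move=> n; apply/measurable_EFinP; exact: mu_.
- by apply/measurable_EFinP.
- apply: aeW => t /=; rewrite in_itv /= => /uv H.
  by apply: cvg_EFin => //; exact: nearW.
- exact: ih.
- by apply: aeW => t n /=; rewrite in_itv /=; exact: uh.
move=> iv _ cv; split=> //.
by apply: fine_cvg; rewrite fineK //; exact: integrable_fin_num iv.
Qed.

(** The majorant of |gam|^k: t^k covers curves that reach the circle at t = 1, and (1 - del t)^k
    those that leave it at t = 0 with speed at least del. *)
Lemma integral_powers (del : R) k : 0 < del <= 1 ->
  mu.-integrable `]0, 1[ (EFin \o (fun t : R => t ^+ k + (1 - del * t) ^+ k)) /\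
  \int[mu]_(t in `]0, 1[) (t ^+ k + (1 - del * t) ^+ k) <= (1 + del^-1) / k.+1%:R.
Proof.
move=> /andP[d0 d1].
have c (t : R) : {for t, continuous (fun t : R => t ^+ k + (1 - del * t) ^+ k)}.
  apply: continuousD; first exact: exprn_continuous.
  apply: (@continuous_comp _ _ _ (fun t : R => 1 - del * t) (fun x => x ^+ k)); last exact: exprn_continuous.
  apply: continuousB; first exact: cvg_cst.
  apply: continuousM; [exact: cvg_cst|exact: cvg_id].
split; first by apply: continuous_integrable01.
pose F (t : R) := (k.+1%:R)^-1 * t ^+ k.+1 - (k.+1%:R * del)^-1 * (1 - del * t) ^+ k.+1.
have k0 : k.+1%:R != 0 :> R by rewrite pnatr_eq0.
have D t : derivable F t 1 /\ derive1 F t = t ^+ k + (1 - del * t) ^+ k.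
  (* The real derivative of F is read off from that of its complex extension G. *)
  pose G (w : R[i]) := (k.+1%:R)^-1 * w ^+ k.+1 +
    (- (k.+1%:R * del%:C)^-1) * (1 + - del%:C * w) ^+ k.+1.
  have dC : del%:C != 0 by rewrite -cmod_gt0 cmodR gtr0_norm.
  have kC : k.+1%:R != 0 :> R[i] by rewrite pnatr_eq0.
  have dG (w : R[i]) : cdiff G w (w ^+ k + (1 - del%:C * w) ^+ k).
    have h1 := cdiffX _ _ _ k.+1 (cdiff_id w).
    have h2 := cdiffX _ _ _ k.+1 (cdiffD _ _ _ _ _ (cdiff_cst 1 w)
      (cdiffZ (- del%:C) _ _ _ (cdiff_id w))).
    apply: cdiff_eq (cdiffD _ _ _ _ _ (cdiffZ (k.+1%:R)^-1 _ _ _ h1)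
      (cdiffZ (- (k.+1%:R * del%:C)^-1) _ _ _ h2)).
    have -> : 1 - del%:C * w = 1 + - del%:C * w by rewrite mulNr.
    move: (k.+1%:R) kC => m mC /=.
    move: (w ^+ k) ((1 + - del%:C * w) ^+ k) => X Y.
    by field; apply/andP.
  have := rdiff_Re _ _ _ (rdiff_comp _ _ _ _ _ (dG _) (rdiff_affine 0 1 t)).
  have -> : (fun s : R => complex.Re (G (0 + s%:C * 1))) = F.
    apply/funext => s; rewrite mulr1 add0r.
    suff -> : G s%:C = (F s)%:C by [].
    rewrite /G /F rmorphB !rmorphM !rmorphXn !fmorphV rmorphM rmorphB rmorphM.
    by rewrite !rmorph_nat rmorph1 !mulNr.
  have -> : ((0 + t%:C * 1) ^+ k + (1 - del%:C * (0 + t%:C * 1)) ^+ k) * 1 =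
      (t ^+ k + (1 - del * t) ^+ k)%:C.
    by rewrite !mulr1 !add0r rmorphD !rmorphXn rmorphB rmorphM rmorph1.
  by [].
rewrite (Rintegral_FTC01 _ F) //.
rewrite /F expr1n expr0n /= !mulr0 subr0 expr1n.
have : 0 <= (k.+1%:R * del)^-1 * (1 - del * 1) ^+ k.+1.
  by rewrite mulr_ge0 ?invr_ge0 ?mulr_ge0 ?exprn_ge0 ?(ltW d0) // mulr1 subr_ge0.
have -> : (1 + del^-1) / k.+1%:R = (k.+1%:R)^-1 + (k.+1%:R * del)^-1 :> R.
  by field; rewrite nat1r k0 gt_eqF.
rewrite !mulr1 sub0r.
by move: ((k.+1%:R * del)^-1) (k.+1%:R^-1 : R) ((1 - del) ^+ k.+1) => x y w; lra.
Qed.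

(** Dominated convergence. The majorant h is K times the series of |a_k| (t^k + (1 - del t)^k), with
    K a bound for the kernel along the curve; integrated termwise it is at most K (1 + 1/del) A,
    although it may be unbounded near the endpoints. *)
Lemma series_integral gam (kp : R[i] -> R[i]) (del A : R) a f : 0 < del <= 1 ->
  (forall t, 0 <= t <= 1 -> rcont gam t) ->
  (forall t, 0 <= t <= 1 -> ccont_at kp (gam t)) ->
  (forall t, 0 < t < 1 -> unit_disc (gam t)) ->
  (forall t k, 0 < t < 1 -> cmod (gam t) ^+ k <= t ^+ k + (1 - del * t) ^+ k) ->
  (forall w, unit_disc w -> has_csum (fun k => a k * w ^+ k) (f w)) ->
  (forall M, \sum_(k < M) cmod (a k) / k.+1%:R <= A) ->
  cintegrable (fun t => f (gam t) * kp (gam t)) /\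
  has_csum (fun k => a k * cI (fun t => gam t ^+ k * kp (gam t)))
    (cI (fun t => f (gam t) * kp (gam t))).
Proof.
move=> hdel gc kc gD gk fa hA; have /andP[d0 d1] := hdel.
have A0 : 0 <= A by apply: le_trans (hA 0%N); rewrite big_ord0.
have [K HK] : exists K, forall t, 0 <= t <= 1 -> cmod (kp (gam t)) <= K.
  by apply: rcont_bounded => t t01; apply: rcont_comp; [exact: kc|exact: gc].
have K0 : 0 <= K by apply: le_trans (HK 0 _); rewrite ?cmod_ge0 // lexx ler01.
have ig k : cintegrable (fun t => gam t ^+ k * kp (gam t)).
  apply: rcont_cintegrable => t t01.
  apply: (rcont_comp (fun w => w ^+ k * kp w)); last exact: gc.
  apply: ccontM; last exact: kc.
  exact: cdiff_cont (cdiffX _ _ _ k (cdiff_id _)).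
have iag k : cintegrable (fun t => a k * (gam t ^+ k * kp (gam t))).
  exact: cintegrableZ.
pose S n t := \sum_(k < n) a k * (gam t ^+ k * kp (gam t)).
have iS n : cintegrable (S n).
  exact: (cintegrable_sum n (fun k t => a k * (gam t ^+ k * kp (gam t)))).
have sS t : 0 < t < 1 -> has_csum (fun k => a k * (gam t ^+ k * kp (gam t)))
    (f (gam t) * kp (gam t)).
  move=> t01; rewrite mulrC; apply: eq_has_csum (has_csumZ (kp (gam t)) _ _ (fa _ (gD t t01))).
  by move=> k; ring.
pose m k (t : R) := t ^+ k + (1 - del * t) ^+ k.
pose h (t : R) : \bar R := (K%:E * \sum_(k <oo) (cmod (a k) * m k t)%:E)%E.
have m0 k t : 0 < t < 1 -> 0 <= m k t.
  move=> /andP[t0 t1]; rewrite addr_ge0 ?exprn_ge0 ?(ltW t0) // subr_ge0.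
  by rewrite mulr_ile1 // ltW.
have Sh n t : 0 < t < 1 -> ((cmod (S n t))%:E <= h t)%E.
  move=> t01; rewrite /h /S.
  apply: (@le_trans _ _ (K%:E * \sum_(0 <= k < n) (cmod (a k) * m k t)%:E)%E); last first.
    apply: lee_wpmul2l; first by rewrite lee_fin.
    apply: nneseries_lim_ge => k _ _.
    by rewrite lee_fin mulr_ge0 ?cmod_ge0 // m0.
  rewrite sumEFin -EFinM lee_fin big_mkord mulr_sumr.
  apply: le_trans (cmod_sum _ _ _ _) _; apply: ler_sum => k _.
  rewrite cmodM [leRHS]mulrCA; apply: ler_wpM2l; first exact: cmod_ge0.
  rewrite cmodM [leRHS]mulrC cmodX; apply: ler_pM; rewrite ?exprn_ge0 ?cmod_ge0 ?gk //.
  by apply: HK; case/andP: t01 => t0 t1; rewrite !ltW.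
have im k : mu.-integrable `]0, 1[ (fun t => (cmod (a k) * m k t)%:E).
  by have [H _] := integral_powers del k hdel; exact: (integrable01_scale (cmod (a k)) _ H).
have ih : mu.-integrable `]0, 1[ h.
  have mser : measurable_fun (`]0, 1[%classic : set R)
      (fun t => \sum_(k <oo) (cmod (a k) * m k t)%:E)%E.
    apply: ge0_emeasurable_sum => k t.
      by move=> /=; rewrite in_itv /= => t01 _; rewrite lee_fin mulr_ge0 ?cmod_ge0 // m0.
    by move=> _; exact: (measurable_int mu (im k)).
  apply/integrableP; split; first exact: measurable_funeM.
  apply: (@le_lt_trans _ _ (\int[mu]_(t in `]0%R, 1%R[) h t)%E).
    rewrite le_eqVlt; apply/orP; left; apply/eqP; apply: eq_integral => t.
    rewrite inE /= in_itv /= => t01; rewrite gee0_abs // mule_ge0 //.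
    by apply: nneseries_ge0 => k _ _; rewrite lee_fin mulr_ge0 ?cmod_ge0 // m0.
  rewrite ge0_integralZl_EFin //; last first.
    move=> t /=; rewrite in_itv /= => t01; apply: nneseries_ge0 => k _ _.
    by rewrite lee_fin mulr_ge0 ?cmod_ge0 // m0.
  rewrite integral_nneseries //; last 2 first.
  - by move=> k; exact: (measurable_int mu (im k)).
  - by move=> k t /=; rewrite in_itv /= => t01; rewrite lee_fin mulr_ge0 ?cmod_ge0 // m0.
  apply: (@le_lt_trans _ _ (K%:E * ((1 + del^-1) * A)%:E)%E); last by rewrite -EFinM ltry.
  apply: lee_wpmul2l; first by rewrite lee_fin.
  apply: lime_le.
    apply: is_cvg_nneseries => k _ _; apply: integral_ge0 => t /=.
    by rewrite in_itv /= => t01; rewrite lee_fin mulr_ge0 ?cmod_ge0 // m0.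
  apply: nearW => M; rewrite big_mkord.
  apply: (@le_trans _ _ (\sum_(k < M) ((1 + del^-1) * (cmod (a k) / k.+1%:R))%:E)%E).
    apply: lee_sum => k _.
    have [H1 H2] := integral_powers del k hdel.
    have -> : (\int[mu]_(x in `]0%R, 1%R[) (cmod (a k) * m k x)%:E)%E =
        (\int[mu]_(x in `]0%R, 1%R[) (cmod (a k) * m k x))%R%:E.
      by rewrite /Rintegral fineK //; exact: integrable_fin_num (im k).
    rewrite RintegralZl // lee_fin mulrCA ler_wpM2l ?cmod_ge0 //.
  by rewrite sumEFin lee_fin -mulr_sumr ler_wpM2l // addr_ge0 // invr_ge0 ltW.
have [iR cR] : mu.-integrable `]0, 1[ (EFin \o (fun t => complex.Re (f (gam t) * kp (gam t)))) /\
  (fun n => \int[mu]_(t in `]0, 1[) complex.Re (S n t)) @ \oo -->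
     \int[mu]_(t in `]0, 1[) complex.Re (f (gam t) * kp (gam t)).
  apply: (dominated01 _ _ h) => //.
  - by move=> n; apply/measurable_EFinP; exact: (measurable_int mu (iS n).1).
  - move=> t /sS /has_csumP H; apply/cvgrPdistC_le => e /H[N0 HN].
    exists N0 => // n /HN; apply: le_trans; rewrite -cReN -cReD; exact: ler_Re_cmod.
  - by move=> n t /(Sh n); apply: le_trans; rewrite lee_fin ler_Re_cmod.
have [iI cIm] : mu.-integrable `]0, 1[ (EFin \o (fun t => complex.Im (f (gam t) * kp (gam t)))) /\
  (fun n => \int[mu]_(t in `]0, 1[) complex.Im (S n t)) @ \oo -->
     \int[mu]_(t in `]0, 1[) complex.Im (f (gam t) * kp (gam t)).
  apply: (dominated01 _ _ h) => //.
  - by move=> n; apply/measurable_EFinP; exact: (measurable_int mu (iS n).2).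
  - move=> t /sS /has_csumP H; apply/cvgrPdistC_le => e /H[N0 HN].
    exists N0 => // n /HN; apply: le_trans; rewrite -cImN -cImD; exact: ler_Im_cmod.
  - by move=> n t /(Sh n); apply: le_trans; rewrite lee_fin ler_Im_cmod.
split; first by split.
have E N : \sum_(k < N) a k * cI (fun t => gam t ^+ k * kp (gam t)) = cI (S N).
  rewrite /S (cI_sum N (fun k t => a k * (gam t ^+ k * kp (gam t)))) //.
  by apply: eq_bigr => k _; rewrite cIZ.
by apply: cvg_has_csum; under eq_fun do rewrite E.
Qed.

End SeriesIntegral.

Section MatrixOperator.
Context {R : realType}.
Variables (alpha : R) (alpha_gt0 : 0 < alpha) (alpha_lt2 : alpha < 2).
Implicit Types (a c : nat -> R[i]) (f : R[i] -> R[i]).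

Lemma analytic_power_series f : analytic_disc f -> exists2 a, tempered 1 a &
  forall z, unit_disc z -> has_csum (fun n => a n * z ^+ n) (f z).
Proof.
by move=> fa; apply: holo_power_series => z /fa; exact: derivable_cdiff.
Qed.

(** Cauchy-Schwarz, applied termwise as x y <= w x^2 + y^2 / w with w = [coefw alpha k] and y =
    1/(k+1). The second part is (k+1)^(alpha-3), which is summable because alpha < 2. *)
Lemma coef_sum_bound a K : 0 <= K ->
  (forall N, \sum_(n < N) coefw alpha n * cmod (a n) ^+ 2 <= K) ->
  exists A, forall M, \sum_(k < M) cmod (a k) / k.+1%:R <= A.
Proof.
move=> K0 HK.
have q0 : 0 < 2 - alpha by rewrite subr_gt0.
exists (K + (1 + (2 - alpha)^-1)) => M.
apply: (@le_trans _ _ (\sum_(k < M) (coefw alpha k * cmod (a k) ^+ 2 +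
    k.+1%:R `^ (- (2 - alpha) - 1)))).
  apply: ler_sum => k _.
  have w0 : 0 < coefw alpha k by rewrite powR_gt0.
  have n0 : 0 < k.+1%:R :> R by rewrite ltr0n.
  have -> : k.+1%:R `^ (- (2 - alpha) - 1) =
      (coefw alpha k)^-1 * (k.+1%:R^-1) ^+ 2 :> R.
    rewrite /coefw -powRN -powR_inv1 ?(ltW n0) // -powR_mulrn ?powR_ge0 //.
    rewrite -powRrM -powRD ?pnatr_eq0 ?implybT //; congr (_ `^ _); ring.
  move: (cmod (a k)) (cmod_ge0 (a k)) (k.+1%:R^-1 : R) => x x0 y.
  have : 0 <= coefw alpha k * (x - (coefw alpha k)^-1 * y) ^+ 2.
    by rewrite mulr_ge0 ?sqr_ge0 // ltW.
  have -> : coefw alpha k * (x - (coefw alpha k)^-1 * y) ^+ 2 =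
    coefw alpha k * x ^+ 2 - 2 * (x * y) + (coefw alpha k)^-1 * y ^+ 2.
    by field; rewrite gt_eqF.
  have : 0 <= coefw alpha k * x ^+ 2 by rewrite mulr_ge0 ?sqr_ge0 // ltW.
  have : 0 <= (coefw alpha k)^-1 * y ^+ 2 by rewrite mulr_ge0 ?sqr_ge0 // invr_ge0 ltW.
  lra.
rewrite big_split /=; apply: lerD; first exact: HK.
case: M => [|M]; first by rewrite big_ord0 addr_ge0 // invr_ge0 ltW.
pose F k : R := k.+1%:R `^ (- (2 - alpha) - 1).
rewrite -(big_mkord xpredT F) big_nat_recl // {1}/F powR1; apply: lerD => //.
have -> : \sum_(0 <= i < M) F i.+1 = \sum_(1 <= i < M.+1) F i by rewrite big_add1.
apply: le_trans (sum_powR_above (2 - alpha) 0 M.+1 q0 isT) _.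
rewrite powR1 ler_pdivrMr // mulVf ?gt_eqF // gerBl powR_ge0 //.
Qed.

Lemma has_csum_finsum M (u : nat -> nat -> R[i]) (s : nat -> R[i]) :
  (forall k, has_csum (u k) (s k)) ->
  has_csum (fun n => \sum_(k < M) u k n) (\sum_(k < M) s k).
Proof.
move=> H; elim: M => [|M IH].
  rewrite big_ord0; apply: (has_csum_squeeze _ _ (fun=> 0)); first exact: cvg_cst.
  move=> N; rewrite big1 ?subrr ?cmod0 // => n _; exact: big_ord0.
rewrite big_ord_recr /=; apply: eq_has_csum (has_csumD _ _ _ _ IH (H M)) => n.
by rewrite big_ord_recr.
Qed.

(** Interchange of the sums over n and k. As the kernel is at most 1/(k+1), cutting the k-sum at M
    changes every c_n by at most C0 (P - p M), uniformly in n; against |z|^n this sums to a small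
    quantity, and finitely many columns can be exchanged freely. *)
Lemma double_series a (C0 A : R) (T : nat -> nat -> R[i]) (S : nat -> R[i]) c z s :
  0 <= C0 ->
  (forall M, \sum_(k < M) cmod (a k) / k.+1%:R <= A) ->
  (forall n k, cmod (T n k) <= C0 * max_kernel n k) ->
  (forall n, has_csum (fun k => a k * T n k) (c n)) ->
  cmod z < 1 ->
  (forall k, has_csum (fun n => T n k * z ^+ n) (S k)) ->
  has_csum (fun k => a k * S k) s ->
  has_csum (fun n => c n * z ^+ n) s.
Proof.
move=> C00 hA hT hc z1 hS hs.
pose p M : R := \sum_(k < M) cmod (a k) / k.+1%:R.
have [|P p_cvg pP] := cvg_nonneg_series (fun k => cmod (a k) / k.+1%:R) A _ hA.
  by move=> k; rewrite divr_ge0 ?cmod_ge0.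
rewrite -/p in p_cvg; have {}pP M : p M <= P by exact: pP.
have tail n M : cmod (c n - \sum_(k < M) a k * T n k) <= C0 * (P - p M).
  apply: (has_csum_bound M _ _ _ _ (hc n)) => L ML.
  rewrite -!(big_mkord xpredT (fun k => a k * T n k)).
  rewrite (big_cat_nat (leq0n M) ML) //= addrAC subrr add0r.
  apply: le_trans (cmod_sum _ _ _ _) _.
  apply: (@le_trans _ _ (C0 * (p L - p M))); last by rewrite ler_wpM2l // lerD2r.
  rewrite /p -!(big_mkord xpredT (fun k => cmod (a k) / k.+1%:R)).
  rewrite (big_cat_nat (leq0n M) ML) //= addrAC subrr add0r mulr_sumr.
  apply: ler_sum => k _; rewrite cmodM mulrCA; apply: ler_wpM2l; first exact: cmod_ge0.
  by apply: le_trans (hT n k) _; rewrite ler_wpM2l ?max_kernel_le.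
have r0 := cmod_ge0 z; have rz : 0 < 1 - cmod z by rewrite subr_gt0.
apply/has_csumP => e e0; have e3 : 0 < e / 3 by rewrite divr_gt0.
have [M0 HM0] := (has_csumP _ _).1 hs _ e3.
have D0 : 0 < C0 * (1 - cmod z)^-1 + 1 by rewrite ltr_wpDl // mulr_ge0 // invr_ge0 ltW.
move/cvgrPdist_le : p_cvg => /(_ _ (divr_gt0 e3 D0))[M1 _ HM1].
pose M := maxn M0 M1.
have H0 := HM0 M (leq_maxl _ _); have := HM1 M (leq_maxr _ _).
rewrite /= ger0_norm ?subr_ge0 // => H1.
have hM := has_csum_finsum M (fun k n => a k * (T n k * z ^+ n)) (fun k => a k * S k)
  (fun k => has_csumZ (a k) _ _ (hS k)).
have [N0 HN] := (has_csumP _ _).1 hM _ e3.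
exists N0 => N /HN h.
pose x := \sum_(n < N) \sum_(k < M) a k * (T n k * z ^+ n).
apply: le_trans (cmod_triangle _ x _) _.
have -> : e = e / 3 + (e / 3 + e / 3) by field.
apply: lerD; last exact: le_trans (cmod_triangle _ (\sum_(k < M) a k * S k) _) (lerD h H0).
rewrite /x -sumrB.
apply: le_trans (cmod_sum _ _ _ _) _.
apply: (@le_trans _ _ (\sum_(n < N) C0 * (P - p M) * cmod z ^+ n)).
  apply: ler_sum => n _.
  have -> : c n * z ^+ n - \sum_(k < M) a k * (T n k * z ^+ n) =
     (c n - \sum_(k < M) a k * T n k) * z ^+ n.
    by rewrite mulrBl mulr_suml; congr (_ - _); apply: eq_bigr => k _; rewrite mulrA.
  by rewrite cmodM cmodX ler_wpM2r ?exprn_ge0.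
rewrite -mulr_sumr.
have pos : 0 <= C0 * (P - p M) by rewrite mulr_ge0 // subr_ge0.
apply: le_trans (ler_wpM2l pos (geometric_sum_le _ N r0 z1)) _.
have q0 : 0 <= P - p M by rewrite subr_ge0.
apply: (@le_trans _ _ ((P - p M) * (C0 * (1 - cmod z)^-1 + 1))).
  rewrite [leRHS](_ : _ = C0 * (P - p M) * (1 - cmod z)^-1 + (P - p M)); last by ring.
  by rewrite lerDl.
by rewrite -ler_pdivlMr.
Qed.

(* The bound on [gam] makes the integral of |gam|^k of order 1/(k+1), which allows
   the Taylor series of f to be integrated termwise up to the unit circle. *)
Theorem matrix_operator (T : (R[i]^o -> R[i]^o) -> (R[i]^o -> R[i]^o))
    (gam : R[i] -> R -> R[i]) (kp : R[i] -> R[i] -> R[i]) (del : R[i] -> R)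
    (t : nat -> nat -> R[i]) (C0 : R) :
  (forall f z, unit_disc z -> T f z = cI (fun s => f (gam z s) * kp z (gam z s))) ->
  (forall z, unit_disc z -> 0 < del z <= 1) ->
  (forall z s, unit_disc z -> 0 <= s <= 1 -> rcont (gam z) s) ->
  (forall z s, unit_disc z -> 0 <= s <= 1 -> ccont_at (kp z) (gam z s)) ->
  (forall z s, unit_disc z -> 0 < s < 1 -> unit_disc (gam z s)) ->
  (forall z s k, unit_disc z -> 0 < s < 1 ->
     cmod (gam z s) ^+ k <= s ^+ k + (1 - del z * s) ^+ k) ->
  (forall z k, unit_disc z -> has_csum (fun n => t n k * z ^+ n)
     (cI (fun s => gam z s ^+ k * kp z (gam z s)))) ->
  (forall n k, cmod (t n k) <= C0 * max_kernel n k) ->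
  well_defined_on alpha
    (fun f z => cintegrable (fun s => f (gam z s) * kp z (gam z s))) /\
  bounded_operator alpha T.
Proof.
move=> HT hdel hg hk hgD hgk ht hC.
have C00 : 0 <= C0.
  by have := le_trans (cmod_ge0 _) (hC 0%N 0%N); rewrite pmulr_lge0 // invr_gt0.
have [CL CL0 HL] := dirichlet_coef_le alpha alpha_gt0 alpha_lt2.
have [CU CU0 HU] := dirichlet_coef_ge alpha alpha_gt0 alpha_lt2.
have [|CS CS0 HS] := @schur_max_kernel R (1 - alpha).
  by apply/andP; split; have := alpha_lt2; have := alpha_gt0; lra.
have fine0 f : 0 <= fine (dirichlet_norm2 alpha f).
  apply: fine_ge0; rewrite /dirichlet_norm2 adde_ge0 ?lee_fin ?sqr_ge0 //.
  apply: integral_ge0 => p _.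
  by rewrite lee_fin mulr_ge0 ?powR_ge0 // sqr_ge0.
have main f : dirichlet alpha f ->
    (forall z, unit_disc z -> cintegrable (fun s => f (gam z s) * kp z (gam z s))) /\
    (dirichlet alpha (T f) /\ (dirichlet_norm2 alpha (T f) <=
      (CU * (C0 ^+ 2 * (CS * (CL * fine (dirichlet_norm2 alpha f)))))%:E)%E).
  move=> fD; have [a ta Ha] := analytic_power_series f fD.1.
  have aN N := HL f a N fD ta Ha.
  have [|A hA] := coef_sum_bound a _ _ aN; first by rewrite mulr_ge0 // ltW.
  (* These are the Taylor coefficients of T f; the series converge absolutely because t_nk =
     O(1/(k+1)). *)
  have [c hc] : exists c, forall n, has_csum (fun k => a k * t n k) (c n).
    suff H n : exists s, has_csum (fun k => a k * t n k) s.
      by exists (fun n => sval (cid (H n))) => n; exact: svalP.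
    apply: (has_csum_abs _ (C0 * A)) => M.
    apply: le_trans (ler_wpM2l C00 (hA M)); rewrite mulr_sumr; apply: ler_sum => k _.
    rewrite cmodM mulrCA; apply: ler_wpM2l; first exact: cmod_ge0.
    by apply: le_trans (hC n k) _; rewrite ler_wpM2l ?max_kernel_le.
  have SI z : unit_disc z -> _ := fun hz => series_integral (gam z) (kp z) (del z) A a f
    (hdel z hz) (fun s => hg z s hz) (fun s => hk z s hz) (fun s => hgD z s hz)
    (fun s k => hgk z s k hz) Ha hA.
  split; first by move=> z hz; exact: (SI z hz).1.
  apply: (HU (T f) c).
    move=> z hz; rewrite HT //.
    exact: (double_series a C0 A t _ c z _ C00 hA hC hc hz (fun k => ht z k hz) (SI z hz).2).
  move=> N.
  (* Schur's test bounds the finite sections uniformly in M; with N fixed, M then tends to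
     infinity. *)
  pose b M n := \sum_(k < M) a k * t n k.
  have bound M : \sum_(n < N) coefw alpha n * cmod (b M n) ^+ 2 <=
      C0 ^+ 2 * (CS * (CL * fine (dirichlet_norm2 alpha f))).
    apply: (@le_trans _ _ (C0 ^+ 2 * \sum_(n < N) n.+1%:R `^ (1 - alpha) *
       (\sum_(k < M) cmod (a k) * max_kernel n k) ^+ 2)).
      rewrite mulr_sumr; apply: ler_sum => n _.
      rewrite [leRHS]mulrCA; apply: ler_wpM2l; first exact: coefw_ge0.
      rewrite -exprMn; apply: lerXn2r; rewrite ?nnegrE ?cmod_ge0 //.
        rewrite mulr_ge0 // sumr_ge0 // => k _.
        by rewrite mulr_ge0 ?cmod_ge0 ?max_kernel_ge0.
      apply: le_trans (cmod_sum _ _ _ _) _; rewrite mulr_sumr; apply: ler_sum => k _.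
      by rewrite cmodM mulrCA ler_wpM2l ?cmod_ge0.
    apply: ler_wpM2l; first exact: sqr_ge0.
    apply: le_trans (HS (fun k => cmod (a k)) N M (fun k => cmod_ge0 _)) _.
    by apply: ler_wpM2l; [exact: ltW|exact: aN].
  have lim : (fun M => \sum_(n < N) coefw alpha n * cmod (b M n) ^+ 2) @ \oo -->
     \sum_(n < N) coefw alpha n * cmod (c n) ^+ 2.
    elim: {bound} N => [|N IH].
      by rewrite big_ord0; under eq_fun do rewrite big_ord0; exact: cvg_cst.
    rewrite big_ord_recr /=; under eq_fun do rewrite big_ord_recr /=.
    apply: cvgD => //; apply: cvgM; first exact: cvg_cst.
    exact: (has_csum_cmod2 _ _ (hc N)).
  by apply: (ler_cvg_to lim (cvg_cst _)); exact: nearW.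
split; first by move=> f z fD hz; exact: (main f fD).1.
split.
- by move=> f fD; case: (main f fD) => _ [].
- move=> x f g z fD gD hz; rewrite !HT //.
  rewrite -cIZ; last exact: (main f fD).1.
  rewrite -cID; last exact: (main g gD).1; last first.
    by apply: cintegrableZ; exact: (main f fD).1.
  by apply: eq_cI => s _; rewrite mulrDl mulrA.
- exists (Num.sqrt (CU * (C0 ^+ 2 * (CS * CL)))) => f fD.
  have [_ [_ H]] := main f fD; rewrite /dirichlet_norm -sqrtrM; last first.
    by rewrite !mulr_ge0 ?sqr_ge0 // ltW.
  apply: ler_wsqrtr.
  have -> : CU * (C0 ^+ 2 * (CS * CL)) * fine (dirichlet_norm2 alpha f) =
    CU * (C0 ^+ 2 * (CS * (CL * fine (dirichlet_norm2 alpha f)))) by ring.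
  case E : (dirichlet_norm2 alpha (T f)) H => [y| |] //= _.
  (* In the case that remains the value is infinite, and [fine] gives 0. *)
  by rewrite !mulr_ge0 ?sqr_ge0 ?fine0 // ltW.
Qed.

End MatrixOperator.

(** * The five operators *)

Section MonomialIntegrals.
Context {R : realType}.
Implicit Types (f F B r : R[i] -> R[i]) (g : R -> R[i]) (z w c : R[i]).

Lemma cI_cst c : cI (fun=> c) = c.
Proof. by apply: eq_ReIm => /=; rewrite Rintegral01_cst. Qed.

Lemma segment01 (t : R) : segment 0 1 t = t%:C.
Proof. by rewrite /segment add0r subr0 mulr1. Qed.

Lemma rcont_segment_curve (a b : R[i]) t : rcont (segment a b) t.
Proof. exact: rdiff_cont (rdiff_affine a (b - a) t). Qed.

(** The constant 4 is 2, from real and imaginary parts, times 1 + 1/del with del = 1. *)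
Lemma cI_power_bound g n : (forall t, 0 <= t <= 1 -> rcont g t) ->
  (forall t, 0 < t < 1 -> cmod (g t) <= t ^+ n + (1 - t) ^+ n) ->
  cmod (cI g) <= 4 / n.+1%:R.
Proof.
move=> gc gb; have [|I1 I2] := @integral_powers R 1 n; first by rewrite ltr01 lexx.
have := ler_cmod_cI g _ (rcont_cintegrable g gc) I1.
move=> /(_ _)/le_trans; apply; first by move=> t t01; rewrite mul1r; exact: gb.
apply: le_trans (ler_wpM2l (ler0n R 2) I2) _.
by rewrite invr1 mulrA -[1 + 1]/(2%:R) -natrM.
Qed.

Lemma has_csum_finite (u : nat -> R[i]) K :
  has_csum (fun n => if (n < K)%N then u n else 0) (\sum_(n < K) u n).
Proof.
elim: K u => [|K IH] u.
  rewrite big_ord0; apply: (has_csum_squeeze _ _ (fun=> 0)); first exact: cvg_cst.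
  by move=> N; rewrite big1 ?subrr ?cmod0.
by rewrite big_ord_recl; apply/(has_csum_shift (fun n => if (n < K.+1)%N then u n else 0));
  exact: (IH (fun n => u n.+1)).
Qed.

Lemma has_csum_delay (u : nat -> R[i]) k s : has_csum u s ->
  has_csum (fun n => if (k <= n)%N then u (n - k)%N else 0) s.
Proof.
move=> us; elim: k => [|k IH]; first by apply: eq_has_csum us => n; rewrite subn0.
rewrite -[s]add0r.
exact/(has_csum_shift (fun n => if (k < n)%N then u (n - k.+1)%N else 0)).
Qed.

End MonomialIntegrals.

Section Instances.
Context {R : realType}.
Variables (alpha : R) (alpha_gt0 : 0 < alpha) (alpha_lt2 : alpha < 2).
Implicit Types (f : R[i]^o -> R[i]^o) (z w : R[i]) (t : R).

Lemma one_subM_neq0 z w : cmod z <= 1 -> cmod w < 1 -> 1 - z * w != 0.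
Proof.
move=> z1 w1; rewrite -cmod_gt0; have := cmodB 1 (z * w).
rewrite cmod1 cmodM; have : cmod z * cmod w <= 1 * cmod w.
  by apply: ler_wpM2r => //; exact: cmod_ge0.
by move=> h1 h2; lra.
Qed.

Lemma cmod_unit_interval t : 0 <= t <= 1 -> cmod t%:C = t.
Proof. by move=> /andP[t0 _]; rewrite cmodR ger0_norm. Qed.

Lemma ltW_itv t : 0 < t < 1 -> 0 <= t <= 1.
Proof. by move=> /andP[t0 t1]; rewrite !ltW. Qed.

(** On w^k the integral is z^k times the sum over m of z^m and the integral of t^(k+m): the matrix
    is lower triangular with entries 1/(n+1), the Cesàro matrix. The entries are kept as integrals,
    so that [cI_power_bound] applies. *)
Lemma opC_bounded :
  well_defined_on alpha (fun f z => segment_integrable (opC_integrand f) 0 z)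
  /\ bounded_operator alpha (@opC R).
Proof.
pose tm (n k : nat) : R[i] :=
  if (k <= n)%N then cI (fun t => segment 0 1 t ^+ k * segment 0 1 t ^+ (n - k)) else 0.
apply: (matrix_operator alpha alpha_gt0 alpha_lt2 (@opC R) (segment 0)
  (fun _ w => (1 - w)^-1) (fun=> 1) tm 4).
(* At z = 0 the segment degenerates and the integrand is constantly f 0, the value prescribed by
   continuity. *)
- move=> f z _; rewrite /opC; case: eqP => [->|/eqP z0].
    rewrite (_ : (fun s => _) = fun=> f 0) ?cI_cst //; apply/funext => s.
    by rewrite /segment subrr mulr0 addr0 subr0 invr1 mulr1.
  by rewrite segment_integralE subr0 mulKf.
- by move=> z _; rewrite ltr01 lexx.
- by move=> z s _ _; exact: rcont_segment_curve.
- move=> z s hz s01; apply: ccontV.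
    by have := ccont_affine 1 (-1) (segment 0 z s); under eq_fun do rewrite mulN1r.
  have := one_subM_neq0 s%:C z; rewrite /segment add0r subr0 => -> //.
  by rewrite cmod_unit_interval //; case/andP: s01.
- move=> z s hz /andP[s0 s1]; apply: disc_segment => //; first exact: unit_disc0.
  by rewrite !ltW.
- move=> z s k hz /andP[s0 s1]; rewrite mul1r; apply: ler_wpDr; first by rewrite exprn_ge0 // subr_ge0 ltW.
  apply: lerXn2r; rewrite ?nnegrE ?cmod_ge0 ?(ltW s0) //.
  rewrite /segment add0r subr0 cmodM cmod_unit_interval ?(ltW s0, ltW s1) // -[leRHS]mulr1.
  by apply: ler_wpM2l; exact: ltW.
- move=> z k hz.
  have seg1 t : 0 <= t <= 1 -> cmod (segment 0 1 t : R[i]) <= 1.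
    by move=> t01; rewrite segment01 cmod_unit_interval //; case/andP: t01.
  have H := has_csum_geometric (segment 0 1) (fun w => w ^+ k) id z (cmod z)
    (fun t _ => rcont_segment_curve 0 1 t) (fun t _ => ccontX k _)
    (fun t _ => ccont_id _)
    (fun t h => ler_piMl (cmod_ge0 z) (seg1 t h)) hz.
  have := has_csum_delay _ k _ (has_csumZ (z ^+ k) _ _ H).
  rewrite -cIZ; last first.
    apply: rcont_cintegrable => t t01.
    apply: (rcont_comp (fun w => w ^+ k * (1 - w * z)^-1)); last exact: rcont_segment_curve.
    apply: ccontM; first exact: ccontX.
    apply: ccontV.
      have := ccont_affine 1 (-z) (segment 0 1 t).
      by under eq_fun do rewrite mulNr mulrC.
    by rewrite segment01 one_subM_neq0 ?cmod_unit_interval //; case/andP: t01.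
  rewrite (_ : cI _ = cI (fun s => segment 0 z s ^+ k * (1 - segment 0 z s)^-1)).
    apply: eq_has_csum => n; rewrite /tm; case: leqP => kn; last by rewrite mul0r.
    by rewrite mulrCA -exprD subnKC.
  by apply: eq_cI => t _; rewrite segment01 /segment add0r subr0 exprMn mulrCA mulrA.
- move=> n k; rewrite /tm; case: leqP => kn; last by rewrite cmod0 mulr_ge0 ?max_kernel_ge0.
  rewrite /max_kernel (maxn_idPl kn); apply: cI_power_bound.
    move=> t _; apply: (rcont_comp (fun w => w ^+ k * w ^+ (n - k))); last exact: rcont_segment_curve.
    by apply: ccontM; exact: ccontX.
  move=> t t01; rewrite -exprD subnKC // segment01 cmodX (cmod_unit_interval _ (ltW_itv _ t01)).
  have /andP[t0 t1] := t01.
  by rewrite lerDl exprn_ge0 // subr_ge0 ltW.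
Qed.

(** Common to a = 0 and a = -1: expanding 1/(1 - w z) in powers of z gives a Hankel matrix of
    moments, bounded by 4/(n+k+1), and n + k >= max(n, k). *)
Lemma hilbert_matrix_bounded (T : (R[i]^o -> R[i]^o) -> (R[i]^o -> R[i]^o)) (a : R[i]) :
  (forall f z, T f z = cI (fun t => opH_integrand f z (segment a 1 t))) ->
  (forall t, 0 < t < 1 -> unit_disc (segment a 1 t)) -> cmod a <= 1 ->
  (forall t k, 0 < t < 1 -> cmod (segment a 1 t) ^+ k <= t ^+ k + (1 - t) ^+ k) ->
  well_defined_on alpha (fun f z => segment_integrable (opH_integrand f z) a 1)
  /\ bounded_operator alpha T.
Proof.
move=> TE aD a1 ak.
have seg1 t : 0 <= t <= 1 -> cmod (segment a 1 t) <= 1.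
  by move=> t01; apply: cmod_convex => //; rewrite cmod1.
have cK z t : unit_disc z -> 0 <= t <= 1 ->
    ccont_at (fun w => (1 - w * z)^-1) (segment a 1 t).
  move=> hz t01; apply: ccontV; last by rewrite one_subM_neq0 ?seg1.
  have := ccont_affine 1 (-z) (segment a 1 t).
  by under eq_fun do rewrite mulNr mulrC.
apply: (matrix_operator alpha alpha_gt0 alpha_lt2 T (fun=> segment a 1)
  (fun z w => (1 - w * z)^-1) (fun=> 1)
  (fun n k => cI (fun t => segment a 1 t ^+ k * segment a 1 t ^+ n)) 4).
- by move=> f z _; rewrite TE.
- by move=> z _; rewrite ltr01 lexx.
- by move=> z s _ _; exact: rcont_segment_curve.
- by move=> z s hz s01; exact: cK.
- by move=> z s _; exact: aD.
- by move=> z s k _ s01; rewrite mul1r; exact: ak.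
- move=> z k hz; exact: (has_csum_geometric (segment a 1) (fun w => w ^+ k) id z (cmod z)
    (fun t _ => rcont_segment_curve a 1 t) (fun t _ => ccontX k _) (fun t _ => ccont_id _)
    (fun t h => ler_piMl (cmod_ge0 z) (seg1 t h)) hz).
- move=> n k; apply: le_trans (cI_power_bound _ (k + n) _ _) _.
  + move=> t _; apply: (rcont_comp (fun w => w ^+ k * w ^+ n)); last exact: rcont_segment_curve.
    by apply: ccontM; exact: ccontX.
  + by move=> t t01; rewrite -exprD cmodX; exact: ak.
  + rewrite ler_wpM2l // lef_pV2 ?posrE ?ltr0n // ler_nat ltnS geq_max.
    by rewrite leq_addl leq_addr.
Qed.

Lemma opH_bounded :
  well_defined_on alpha (fun f z => segment_integrable (opH_integrand f z) 0 1)
  /\ bounded_operator alpha (@opH R).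
Proof.
apply: hilbert_matrix_bounded.
- by move=> f z; rewrite /opH segment_integralE subr0 mul1r.
- move=> t /andP[t0 t1]; rewrite segment01 /unit_disc /= cmod_unit_interval //.
  by rewrite !ltW.
- by rewrite cmod0 ler01.
- move=> t k /andP[t0 t1]; rewrite segment01 cmod_unit_interval ?(ltW t0, ltW t1) //.
  by rewrite lerDl exprn_ge0 // subr_ge0 ltW.
Qed.

Lemma opH0_bounded :
  well_defined_on alpha (fun f z => segment_integrable (opH_integrand f z) (-1) 1)
  /\ bounded_operator alpha (@opH0 R).
Proof.
have segE t : segment (-1) 1 t = (2 * t - 1)%:C.
  by rewrite /segment rmorphB rmorphM rmorph_nat rmorph1 /=; ring.
apply: hilbert_matrix_bounded.
- move=> f z; rewrite /opH0 segment_integralE mulrA.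
  by rewrite opprK -[1 + 1]/(2%:R) mulVf ?mul1r // pnatr_eq0.
- move=> t /andP[t0 t1]; rewrite segE /unit_disc /= cmodR ltr_norml; apply/andP; split; lra.
- by rewrite cmodN cmod1.
- move=> t k /andP[t0 t1]; rewrite segE cmodR.
  (* |2t - 1| is at most 1 - t on the left half and at most t on the right half. *)
  have [h|h] := leP t (1 / 2).
    apply: ler_wpDl; first by rewrite exprn_ge0 // ltW.
    apply: lerXn2r; rewrite ?nnegrE ?normr_ge0 //; first lra.
    by rewrite ler_norml; apply/andP; split; lra.
  apply: ler_wpDr; first by rewrite exprn_ge0 // subr_ge0 ltW.
  apply: lerXn2r; rewrite ?nnegrE ?normr_ge0 ?(ltW t0) //.
  by rewrite ler_norml; apply/andP; split; lra.
Qed.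

End Instances.

(** * Operators integrating along segments that start at 1 *)

Section SegmentsFromOne.
Context {R : realType}.
Variables (alpha : R) (alpha_gt0 : 0 < alpha) (alpha_lt2 : alpha < 2).
Implicit Types (f : R[i]^o -> R[i]^o) (z w : R[i]) (t : R).

Lemma cmod_segment_from1 z t : 0 <= t <= 1 ->
  cmod (segment 1 z t) <= 1 - (1 - cmod z) * t.
Proof.
move=> /andP[t0 t1].
have -> : segment 1 z t = (1 - t)%:C + t%:C * z by rewrite /segment rmorphB rmorph1; ring.
apply: le_trans (cmodD _ _) _; rewrite cmodM !cmodR !ger0_norm ?subr_ge0 //; lra.
Qed.

Lemma unit_disc_neq1 z : unit_disc z -> z - 1 != 0.
Proof.
by rewrite /unit_disc /= => hz; rewrite subr_eq0; apply: contraTneq hz => ->; rewrite cmod1 ltxx.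
Qed.

(** The integral is (z^(k+1) - 1) / ((k+1)(z - 1)), a finite geometric sum; hence the matrix of A is
    upper triangular with entries 1/(k+1). *)
Lemma cI_segment_pow z k : unit_disc z ->
  cI (fun t => segment 1 z t ^+ k) = \sum_(n < k.+1) (k.+1%:R)^-1 * z ^+ n.
Proof.
move=> hz; have z1 := unit_disc_neq1 _ hz.
have k0 : k.+1%:R != 0 :> R[i] by rewrite pnatr_eq0.
have c t : rcont (fun t => segment 1 z t ^+ k) t.
  by apply: (rcont_comp (fun w => w ^+ k)); [exact: ccontX|exact: rcont_segment_curve].
have d t : rdiff (fun t => (k.+1%:R * (z - 1))^-1 * segment 1 z t ^+ k.+1) t (segment 1 z t ^+ k).
  have := rdiffZ (k.+1%:R * (z - 1))^-1 _ _ _ (rdiff_comp _ _ _ _ _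
    (cdiffX _ _ _ k.+1 (cdiff_id (segment 1 z t))) (rdiff_affine 1 (z - 1) t)).
  by congr (rdiff _ _ _); rewrite /= mulr1; move: (segment 1 z t ^+ k) (k.+1%:R : R[i]) k0 => x y y0; field; by rewrite y0 z1.
rewrite (cI_FTC _ _ (fun t _ => c t) (fun t _ => d t)) segment0 segment1 expr1n -mulrBr.
rewrite subrX1 -mulr_sumr; move: (\sum_(_ < _) _) (k.+1%:R : R[i]) k0 => x y y0; field; by rewrite y0 z1.
Qed.

Lemma from1_disc z t : unit_disc z -> 0 < t < 1 -> unit_disc (segment 1 z t).
Proof.
move=> hz /andP[t0 t1]; rewrite /unit_disc /=; apply: le_lt_trans (cmod_segment_from1 _ _ _) _.
  by rewrite !ltW.
by rewrite gtrBl mulr_gt0 // subr_gt0.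
Qed.

Lemma from1_pow z t k : unit_disc z -> 0 < t < 1 ->
  cmod (segment 1 z t) ^+ k <= t ^+ k + (1 - (1 - cmod z) * t) ^+ k.
Proof.
move=> hz /andP[t0 t1]; apply: ler_wpDl; first by rewrite exprn_ge0 // ltW.
have h : cmod (segment 1 z t) <= 1 - (1 - cmod z) * t.
  by apply: cmod_segment_from1; rewrite !ltW.
by apply: lerXn2r; rewrite ?nnegrE ?cmod_ge0 //; apply: le_trans h; exact: cmod_ge0.
Qed.

Lemma from1_del z : unit_disc z -> 0 < 1 - cmod z <= 1.
Proof. by rewrite /unit_disc /= => hz; rewrite subr_gt0 hz gerBl cmod_ge0. Qed.

Let tA (n k : nat) : R[i] := if (n < k.+1)%N then (k.+1%:R)^-1 else 0.

Lemma tA_le n k : cmod (tA n k) <= 1 * max_kernel n k.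
Proof.
rewrite mul1r /tA; case: ltnP => h; last by rewrite cmod0 max_kernel_ge0.
by rewrite /max_kernel (maxn_idPr (h : (n <= k)%N)) cmodV cmodn.
Qed.

Lemma tA_has_csum z k : unit_disc z ->
  has_csum (fun n => tA n k * z ^+ n) (cI (fun t => segment 1 z t ^+ k)).
Proof.
move=> hz; rewrite cI_segment_pow //.
apply: eq_has_csum (has_csum_finite (fun n => (k.+1%:R)^-1 * z ^+ n) k.+1) => n.
by rewrite /tA; case: ltnP => // _; rewrite mul0r.
Qed.

Lemma opA_bounded :
  well_defined_on alpha (fun f z => segment_integrable (opA_integrand f) 1 z)
  /\ bounded_operator alpha (@opA R).
Proof.
suff [W B] : well_defined_on alpha (fun f z => cintegrable (fun s => f (segment 1 z s) * 1))
  /\ bounded_operator alpha (@opA R).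
  split=> // f z fD hz; apply: eq_cintegrable (W f z fD hz) => t _.
  by rewrite mulr1.
apply: (matrix_operator alpha alpha_gt0 alpha_lt2 (@opA R) (segment 1)
  (fun _ _ => 1) (fun z => 1 - cmod z) tA 1).
- move=> f z hz; rewrite /opA segment_integralE mulKf ?unit_disc_neq1 //.
  by apply: eq_cI => t _; rewrite mulr1.
- exact: from1_del.
- by move=> z s _ _; exact: rcont_segment_curve.
- by move=> z s _ _; exact: ccont_cst.
- exact: from1_disc.
- by move=> z s k; exact: from1_pow.
- move=> z k hz; rewrite (_ : cI _ = cI (fun t => segment 1 z t ^+ k)).
    exact: tA_has_csum.
  by apply: eq_cI => t _; rewrite mulr1.
- exact: tA_le.
Qed.

(* The curve [r] and weight [b] of
   [1 / (-1 - segment 1 z t) = b t / (1 - r t * z)]. *)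
Let rJ (w : R[i]) : R[i] := w * (w - 2)^-1.
Let bJ (w : R[i]) : R[i] := (w - 2)^-1.
Let uJ n : R[i] := cI (fun t => bJ (segment 0 1 t) * rJ (segment 0 1 t) ^+ n).

(* From w^(k+1) / (-1 - w) = - w^k / (-1 - w) - w^k. *)
Fixpoint tJ n k : R[i] := if k is k'.+1 then - tJ n k' - tA n k' else uJ n.

Let seg_neq2 t : 0 <= t <= 1 -> (segment 0 1 t : R[i]) - 2 != 0.
Proof.
move=> /andP[t0 t1]; rewrite segment01 -[2]/(2%:R) -(rmorph_nat (real_complex R)) -rmorphB /=.
by rewrite fmorph_eq0; apply/eqP; lra.
Qed.

Let cmod_seg2 t : 0 <= t <= 1 -> cmod (segment 0 1 t - 2) = 2 - t.
Proof.
move=> /andP[t0 t1]; rewrite segment01 -[2]/(2%:R) -(rmorph_nat (real_complex R)) -rmorphB /= cmodR.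
by rewrite distrC ger0_norm //; lra.
Qed.

Let bJ_cont t : 0 <= t <= 1 -> ccont_at bJ (segment 0 1 t).
Proof.
move=> t01; apply: cdiff_cont; apply: (cdiff_invB 2).
by rewrite -subr_eq0 seg_neq2.
Qed.

Let rJ_cont t : 0 <= t <= 1 -> ccont_at rJ (segment 0 1 t).
Proof. by move=> t01; apply: ccontM; [exact: ccont_id|exact: bJ_cont]. Qed.

Let bJ_le t : 0 <= t <= 1 -> cmod (bJ (segment 0 1 t)) <= 1.
Proof.
move=> t01; rewrite /bJ cmodV cmod_seg2 // invf_le1; case/andP: t01 => t0 t1; lra.
Qed.

Let rJ_le t : 0 <= t <= 1 -> cmod (rJ (segment 0 1 t)) <= t.
Proof.
move=> t01; rewrite /rJ cmodM segment01 cmod_unit_interval // -segment01.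
by rewrite -[leRHS]mulr1; apply: ler_wpM2l (bJ_le _ t01); case/andP: t01.
Qed.

Let bJrJ_cont n t : 0 <= t <= 1 ->
  rcont (fun t => bJ (segment 0 1 t) * rJ (segment 0 1 t) ^+ n) t.
Proof.
move=> t01; apply: (rcont_comp (fun w => bJ w * rJ w ^+ n)); last exact: rcont_segment_curve.
apply: ccontM; first exact: bJ_cont.
by apply: (ccont_comp (fun w => w ^+ n)); [exact: ccontX|exact: rJ_cont].
Qed.

Let uJ_le n : cmod (uJ n) <= 4 / n.+1%:R.
Proof.
apply: cI_power_bound; first exact: bJrJ_cont.
move=> t /ltW_itv t01; have /andP[t0 t1] := t01.
apply: ler_wpDr; first by rewrite exprn_ge0 // subr_ge0.
rewrite cmodM cmodX -[leRHS]mul1r; apply: ler_pM; rewrite ?exprn_ge0 ?cmod_ge0 ?bJ_le //.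
by apply: lerXn2r; rewrite ?nnegrE ?cmod_ge0 ?rJ_le.
Qed.

(** For r = t/(t-2) and b = 1/(t-2) one has r' = b (1 - r), so b r^n - b r^(n+1) is the derivative
    of r^(n+1)/(n+1); moreover r(0) = 0 and r(1) = -1. *)
Let uJ_step n : uJ n = uJ n.+1 + (-1) ^+ n.+1 / n.+1%:R.
Proof.
have n0 : n.+1%:R != 0 :> R[i] by rewrite pnatr_eq0.
pose G t := n.+1%:R^-1 * rJ (segment 0 1 t) ^+ n.+1.
pose g t := bJ (segment 0 1 t) * rJ (segment 0 1 t) ^+ n +
  (-1) * (bJ (segment 0 1 t) * rJ (segment 0 1 t) ^+ n.+1).
have bI k : cintegrable (fun t => bJ (segment 0 1 t) * rJ (segment 0 1 t) ^+ k).
  by apply: rcont_cintegrable; exact: bJrJ_cont.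
have -> : uJ n = uJ n.+1 + cI g.
  rewrite /g cID //; last exact: cintegrableZ.
  by rewrite cIZ // -/(uJ n) -/(uJ n.+1); ring.
congr (_ + _); rewrite (cI_FTC G g).
- rewrite /G segment0 segment1 /rJ mul0r expr0n /= mulr0 subr0 mul1r mulrC.
  have -> : (1 - 2)^-1 = -1 :> R[i] by rewrite -[1 - 2]opprB addrK invrN invr1.
  by [].
- move=> t t01; apply: (rcont_comp (fun w => bJ w * rJ w ^+ n + (-1) * (bJ w * rJ w ^+ n.+1)));
    last exact: rcont_segment_curve.
  have c k : ccont_at (fun w => bJ w * rJ w ^+ k) (segment 0 1 t).
    apply: ccontM; first exact: bJ_cont.
    by apply: (ccont_comp (fun w => w ^+ k)); [exact: ccontX|exact: rJ_cont].
  by apply: ccontD => //; apply: ccontM => //; exact: ccont_cst.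
- move=> t t01; have h2 := seg_neq2 _ t01.
  have D := cdiffM _ _ _ _ _ (cdiff_id (segment 0 1 t))
    (cdiff_invB 2 (segment 0 1 t) (_ : segment 0 1 t != 2)).
  have := rdiffZ n.+1%:R^-1 _ _ _ (rdiff_comp _ _ _ _ _ (cdiffX _ _ _ n.+1 (D _))
    (rdiff_affine 0 (1 - 0) t)).
  move=> /(_ _); rewrite -subr_eq0 => /(_ h2).
  congr (rdiff _ _ _); rewrite /g /bJ (exprS (rJ (segment 0 1 t)) n) /= -/(segment 0 1 t) -/(rJ (segment 0 1 t)).
  move: (rJ _ ^+ n) (n.+1%:R : R[i]) n0 => y m m0; rewrite /rJ; move: (segment 0 1 t) h2 => x h2; field.
  by rewrite m0 h2.
Qed.

(** For k < n the recurrence only changes the sign. For n <= k its correction 1/(k+1) is exactly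
    what turns [uJ k] into [uJ k.+1], so no error accumulates over the k steps. *)
Lemma tJE n k : tJ n k = (-1) ^+ k * uJ (maxn n k).
Proof.
elim: k => [|k IH] /=; first by rewrite maxn0 mul1r.
rewrite IH /tA; case: ltnP => h.
  rewrite (maxn_idPr (h : (n <= k)%N)) (uJ_step k) !exprS.
  have : ((-1) ^+ k * (-1) ^+ k : R[i]) = 1 by rewrite -exprMn mulrNN mulr1 expr1n.
  move: ((-1) ^+ k) (k.+1%:R^-1) (uJ k.+1) => e v u e2.
  apply/eqP; rewrite -subr_eq0; apply/eqP; transitivity (v * (e * e - 1)); first by ring.
  by rewrite e2 subrr mulr0.
by rewrite (maxn_idPl (ltnW h)) subr0 exprS mulN1r mulNr.
Qed.

Lemma tJ_le n k : cmod (tJ n k) <= 4 * max_kernel n k.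
Proof.
by rewrite tJE cmodM cmodX cmodN cmod1 expr1n mul1r; exact: uJ_le.
Qed.

(** The segment stays away from the pole -1, its endpoint 1 included: |2 - t + t z| >= 2 - t - t |z|
    > 0. *)
Let from1_neqN1 z t : unit_disc z -> 0 <= t <= 1 -> -1 - segment 1 z t != 0.
Proof.
rewrite /unit_disc /= => hz /andP[t0 t1]; rewrite -cmod_gt0.
have -> : -1 - segment 1 z t = - ((2 - t)%:C + t%:C * z).
  by rewrite /segment rmorphB rmorph_nat /=; ring.
rewrite cmodN; have := cmodB (2 - t)%:C (- (t%:C * z)).
rewrite opprK cmodN cmodM !cmodR !ger0_norm ?subr_ge0 //; last lra.
have : t * cmod z <= cmod z by rewrite ler_piMl ?cmod_ge0.
lra.
Qed.

Lemma opJ_bounded :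
  well_defined_on alpha (fun f z => segment_integrable (opJ_integrand f) 1 z)
  /\ bounded_operator alpha (@opJ R).
Proof.
have kc z s : unit_disc z -> 0 <= s <= 1 -> ccont_at (fun w => (-1 - w)^-1) (segment 1 z s).
  move=> hz s01; apply: ccontV; last exact: from1_neqN1.
  by have := ccont_affine (-1) (-1) (segment 1 z s); under eq_fun do rewrite mulN1r.
have gI z k : unit_disc z ->
    cintegrable (fun t => segment 1 z t ^+ k * (-1 - segment 1 z t)^-1).
  move=> hz; apply: rcont_cintegrable => t t01.
  apply: (rcont_comp (fun w => w ^+ k * (-1 - w)^-1)); last exact: rcont_segment_curve.
  by apply: ccontM; [exact: ccontX|exact: kc].
apply: (matrix_operator alpha alpha_gt0 alpha_lt2 (@opJ R) (segment 1)
  (fun _ w => (-1 - w)^-1) (fun z => 1 - cmod z) tJ 4).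
- by move=> f z hz; rewrite /opJ segment_integralE mulKf ?unit_disc_neq1.
- exact: from1_del.
- by move=> z s _ _; exact: rcont_segment_curve.
- exact: kc.
- exact: from1_disc.
- by move=> z s k; exact: from1_pow.
- move=> z k hz; elim: k => [|k IH] /=.
    rewrite (_ : cI _ = cI (fun t => bJ (segment 0 1 t) * (1 - rJ (segment 0 1 t) * z)^-1)).
      apply: (has_csum_geometric (segment 0 1) bJ rJ z (cmod z)) => // t t01.
      - exact: rcont_segment_curve.
      - apply: ler_piMl; first exact: cmod_ge0.
        by apply: le_trans (rJ_le _ t01) _; case/andP: t01.
    apply: eq_cI => t /ltW_itv t01; rewrite mul1r /bJ -invfM; congr (_^-1).
    have := seg_neq2 _ t01; rewrite /rJ segment01 /segment => h; field.
    by [].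
  have pI : cintegrable (fun t => segment 1 z t ^+ k).
    apply: rcont_cintegrable => t t01.
    by apply: (rcont_comp (fun w => w ^+ k)); [exact: ccontX|exact: rcont_segment_curve].
  rewrite (_ : cI _ = (-1) * cI (fun t => segment 1 z t ^+ k * (-1 - segment 1 z t)^-1) +
      (-1) * cI (fun t => segment 1 z t ^+ k)).
    apply: eq_has_csum (has_csumD _ _ _ _ (has_csumZ (-1) _ _ IH)
      (has_csumZ (-1) _ _ (tA_has_csum z k hz))) => n.
    by ring.
  rewrite -!cIZ -?cID //; try (apply: cintegrableZ; exact: gI); try exact: cintegrableZ; try exact: gI.
  apply: eq_cI => t /ltW_itv t01; rewrite exprS.
  have := from1_neqN1 _ _ hz t01; move: (segment 1 z t) (_ ^+ k) => x y h; field.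
  by [].
- exact: tJ_le.
Qed.

End SegmentsFromOne.

Theorem corollary6 (R : realType) (alpha : R)
    (alpha_gt0 : 0 < alpha) (alpha_lt2 : alpha < 2) :
  [/\ well_defined_on alpha
        (fun f z => segment_integrable (opC_integrand f) 0 z)
      /\ bounded_operator alpha opC,
      well_defined_on alpha
        (fun f z => segment_integrable (opA_integrand f) 1 z)
      /\ bounded_operator alpha opA,
      well_defined_on alpha
        (fun f z => segment_integrable (opJ_integrand f) 1 z)
      /\ bounded_operator alpha opJ,
      well_defined_on alpha
        (fun f z => segment_integrable (opH_integrand f z) 0 1)
      /\ bounded_operator alpha opH
    & well_defined_on alpha
        (fun f z => segment_integrable (opH_integrand f z) (-1) 1)
      /\ bounded_operator alpha opH0].

Proof.
split.
- exact: opC_bounded.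
- exact: opA_bounded.
- exact: opJ_bounded.
- exact: opH_bounded.
- exact: opH0_bounded.
Qed.
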